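(* Let $D(h,\nu,k)$ be the Hill discriminant of Lamé's equation $y''+\bigl(h-\nu(\nu+1)k^2\operatorname{sn}^2(t,k)\bigr)y=0$, regarded as an equation with period $2K(k)$. For real $h,\nu$ with $\nu\ge-\tfrac12$ and $h>\nu(\nu+1)$ put $$\omega:=\sqrt{h-\nu(\nu+1)}>0,\qquad B:=\frac{\Gamma(1+\mathrm{i}\omega)\,\Gamma(\mathrm{i}\omega)}{\Gamma(1+\mathrm{i}\omega+\nu)\,\Gamma(\mathrm{i}\omega-\nu)}.$$ (a) Suppose $\nu\ge 0$ and $h>\nu(\nu+1)$. Then, for all $k\in(0,1)$, $$\bigl|D(h,\nu,k)-2\operatorname{Re}\bigl(B\,\mathrm{e}^{2\mathrm{i}\omega K(k)}\bigr)\bigr|\le 8h^{1/2}\omega^{-2}\nu(\nu+1)\bigl(E(k)+1-2\tanh K(k)\bigr).$$ (b) Suppose $\nu\in[-\tfrac12,0)$ and $h>0$. Then, for all $k\in(0,1)$, $$\bigl|D(h,\nu,k)-2\operatorname{Re}\bigl(B\,\mathrm{e}^{2\mathrm{i}\omega K(k)}\bigr)\bigr|\le 8\omega h^{-1}|\nu|(\nu+1)\bigl(E(k)+1-2\tanh K(k)\bigr).$$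
   Context: For $k\in(0,1)$, $\operatorname{sn}(t,k)$ is the Jacobian elliptic function of modulus $k$, and the complete elliptic integrals of the first and second kind are $$K(k)=\int_0^1\frac{\mathrm{d}t}{\sqrt{1-t^2}\sqrt{1-k^2t^2}},\qquad E(k)=\int_0^1\frac{\sqrt{1-k^2t^2}}{\sqrt{1-t^2}}\,\mathrm{d}t.$$ The function $t\mapsto\operatorname{sn}^2(t,k)$ has period $2K(k)$. For a Hill equation $\ddot w+q(t)w=0$ with $q$ continuous of period $\sigma>0$, the Hill discriminant is the trace of the linear endomorphism $w(t)\mapsto w(t+\sigma)$ of the two-dimensional solution space. $D(h,\nu,k)$ is this discriminant for Lamé's equation with $\sigma=2K(k)$. Equivalently, $D(h,\nu,k)=2\bigl(y_1(K)y_2'(K)+y_1'(K)y_2(K)\bigr)=2\bigl(2y_1(K)y_2'(K)-1\bigr)$, where $K=K(k)$ and $y_1,y_2$ are the solutions of Lamé's equation with $y_1(0)=y_2'(0)=1$, $y_1'(0)=y_2(0)=0$. $\Gamma$ is the gamma function. *)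

(* Defs.v *)
From Stdlib Require Import Reals Factorial.
From Coquelicot Require Import Coquelicot.
Open Scope R_scope.

Definition Cexp (z : C) : C :=
  (exp (Re z) * cos (Im z), exp (Re z) * sin (Im z)).

Fixpoint Crising (z : C) (n : nat) : C :=
  match n with
  | O => RtoC 1
  | S m => (Crising z m * (z + RtoC (INR m)))%C
  end.

(* n! n^z / (z (z + 1) ... (z + n)), for n > 0 *)
Definition gamma_seq (z : C) (n : nat) : C :=
  (RtoC (INR (fact n)) * Cexp (z * RtoC (ln (INR n))) / Crising z (S n))%C.

(* Euler-Gauss limit formula, valid for every z that is not a nonpositive
   integer, in particular for Re z <= 0 as soon as Im z <> 0. *)
Definition Cgamma (z : C) : C :=
  (real (Lim_seq (fun n => Re (gamma_seq z n))),
   real (Lim_seq (fun n => Im (gamma_seq z n)))).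

(* The integrands are singular at 1, hence improper integrals. *)
Definition ellK (k : R) : R :=
  RInt_gen (fun t => 1 / (sqrt (1 - t ^ 2) * sqrt (1 - k ^ 2 * t ^ 2)))
    (at_point 0) (at_left 1).

Definition ellE (k : R) : R :=
  RInt_gen (fun t => sqrt (1 - k ^ 2 * t ^ 2) / sqrt (1 - t ^ 2))
    (at_point 0) (at_left 1).

Definition ellF (phi k : R) : R :=
  RInt (fun theta => 1 / sqrt (1 - k ^ 2 * sin theta ^ 2)) 0 phi.

(* For 0 < k < 1, ellF _ k is an increasing bijection of R; the amplitude is
   its inverse, so that sn is defined on the whole real line. *)
Definition jacobi_am (t k : R) : R :=
  @iota R_CompleteNormedModule (fun phi => ellF phi k = t).

Definition jacobi_sn (t k : R) : R := sin (jacobi_am t k).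

Definition hill_solution (q w : R -> R) : Prop :=
  forall t, ex_derive w t /\ is_derive (Derive w) t (- (q t * w t)).

Definition hill_basis (q w1 w2 : R -> R) : Prop :=
  hill_solution q w1 /\ hill_solution q w2 /\
  forall w, hill_solution q w ->
    exists! c : R * R, forall t, w t = fst c * w1 t + snd c * w2 t.

(* D is the trace of w |-> w (. + sigma) on the solution space, read off from
   its matrix in some basis. *)
Definition is_hill_discriminant (q : R -> R) (sigma D : R) : Prop :=
  exists (w1 w2 : R -> R) (a b c d : R),
    hill_basis q w1 w2 /\
    (forall t, w1 (t + sigma) = a * w1 t + b * w2 t) /\
    (forall t, w2 (t + sigma) = c * w1 t + d * w2 t) /\
    D = a + d.

Definition hill_discriminant (q : R -> R) (sigma : R) : R :=
  @iota R_CompleteNormedModule (is_hill_discriminant q sigma).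

Definition lame_potential (h nu k : R) (t : R) : R :=
  h - nu * (nu + 1) * k ^ 2 * jacobi_sn t k ^ 2.

Definition lameD (h nu k : R) : R :=
  hill_discriminant (lame_potential h nu k) (2 * ellK k).

(* Main.v *)
(** Proof idea.  Write [lam = nu (nu + 1)] and compare Lame's equation on [[0, K]] with its
    limit [y'' + (omega^2 + lam / cosh^2) y = 0].  Since [0 <= k sn <= tanh] on [[0, K]], the
    potentials differ there by [|lam| (tanh^2 - k^2 sn^2)], whose integral is
    [|lam| (E - tanh K)].  Both potentials are monotone, so an energy argument bounds their
    solutions, and the discriminants computed from the data at [K] differ by a multiple of
    [E - tanh K].  For the limit equation, [(u' + i omega u) exp (- i omega t)] moves by a
    multiple of [1 - tanh K] between [K] and infinity, which gives the remaining error.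

    It remains to identify the product of the two limits at infinity with [i omega B].  The
    ladder operator [y |-> cosh y' + z sinh y] sends solutions of
    [y'' = (z^2 - lam / cosh^2) y] to solutions with [z + 1] in place of [z].  Hence the
    normalized product of the even and odd amplitudes at [z] is [1 - lam / (z (z + 1))] times
    the one at [z + 1], and it tends to 1 along [z, z + 1, z + 2, ...]; the resulting infinite
    product is the ratio of gamma functions, by the Euler-Gauss formula. *)
Require Import Defs.
From Stdlib Require Import Reals Factorial Lra Lia.
From Coquelicot Require Import Coquelicot.
Open Scope R_scope.

(** Both parts of the theorem come from one estimate with a pair of constants [(a, b)]: solutions
    with Cauchy data (0,1) and (1,0) at 0 have energy [y'^2 + omega^2 y^2] at most [a^2] and [b^2].
    The pair is [(1, sqrt h)] when the potentials decrease and [(omega / sqrt h, omega)] when they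
    increase. Replacing the potential on [[0, K]] costs [8 a^2 b / omega^2 * |lam| (E - tanh K)],
    going from [K] to infinity costs [4 a b / omega^2 * |lam| (1 - tanh K)]. As [a >= 1], the sum is
    at most [8 a^2 b / omega^2 * |lam| (E + 1 - 2 tanh K)], and [a^2 b / omega^2] is
    [sqrt h / omega^2] or [omega / h]. The ladder starts at [z = i omega], on the boundary of the
    half-plane [Re z >= 0], whereas the amplitudes are known only asymptotically, for large [|z|].
    So they are studied for complex [z] in the closed half-plane, with error bounds that depend on
    [|lam| / |z|] alone. The recursion in [z] and this asymptotics determine the product of the
    amplitudes, without hypergeometric functions or connection formulas. *)

(** * Mean value inequalities for real functions and complex functions of a real variable *)

Lemma derive_nonneg_le (f f' : R -> R) (a b : R) :
  a <= b -> (forall t, a <= t <= b -> is_derive f t (f' t)) ->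
  (forall t, a <= t <= b -> 0 <= f' t) -> f a <= f b.
Proof.
intros Hab Hd Hp.
destruct (MVT_gen f a b f') as [c [Hc Heq]].
- intros x Hx. rewrite Rmin_left, Rmax_right in Hx by lra. apply Hd; lra.
- intros x Hx. rewrite Rmin_left, Rmax_right in Hx by lra.
  apply derivable_continuous_pt. exists (f' x). apply is_derive_Reals, Hd; lra.
- rewrite Rmin_left, Rmax_right in Hc by lra.
  specialize (Hp c Hc). nra.
Qed.

Lemma derive_nonpos_ge (f f' : R -> R) (a b : R) :
  a <= b -> (forall t, a <= t <= b -> is_derive f t (f' t)) ->
  (forall t, a <= t <= b -> f' t <= 0) -> f b <= f a.
Proof.
intros Hab Hd Hp.
apply Ropp_le_cancel.
apply (derive_nonneg_le (fun t => - f t) (fun t => - f' t)); auto.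
- intros t Ht. apply (is_derive_opp f). auto.
- intros t Ht. specialize (Hp t Ht). lra.
Qed.

(** Stands in for integral estimates throughout: [g] is an antiderivative of the bound, so no
    integrability of [f'] or [g'] has to be discussed. *)
Lemma increment_bound (f f' g g' : R -> R) (a b : R) :
  a <= b ->
  (forall t, a <= t <= b -> is_derive f t (f' t)) ->
  (forall t, a <= t <= b -> is_derive g t (g' t)) ->
  (forall t, a <= t <= b -> Rabs (f' t) <= g' t) ->
  Rabs (f b - f a) <= g b - g a.
Proof.
intros Hab Hf Hg Hb. apply Rabs_le; split.
- enough (g a + f a <= g b + f b) by lra.
  apply (derive_nonneg_le (fun t => g t + f t) (fun t => g' t + f' t)); auto.
  + intros t Ht. apply (is_derive_plus g f); auto.
  + intros t Ht. specialize (Hb t Ht). apply Rabs_le_between in Hb. lra.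
- enough (g a - f a <= g b - f b) by lra.
  apply (derive_nonneg_le (fun t => g t - f t) (fun t => g' t - f' t)); auto.
  + intros t Ht. apply (is_derive_minus g f); auto.
  + intros t Ht. specialize (Hb t Ht). apply Rabs_le_between in Hb. lra.
Qed.

Lemma derive_zero_const (f : R -> R) :
  (forall t, is_derive f t 0) -> forall t s, f t = f s.
Proof.
assert (H : (forall t, is_derive f t 0) -> forall a b, a <= b -> f b = f a).
{ intros Hf a b Hab.
  enough (Rabs (f b - f a) <= 0 - 0).
  { apply Rabs_le_between in H. lra. }
  apply (increment_bound f (fun _ => 0) (fun _ => 0) (fun _ => 0)); auto.
  - intros. apply (is_derive_const (K := R_AbsRing) (V := R_NormedModule)).
  - intros. rewrite Rabs_R0. lra. }
intros Hf t s. destruct (Rle_dec t s).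
- symmetry; auto.
- apply H; auto; lra.
Qed.

Lemma is_derive_val (f : R -> R) (t l m : R) : is_derive f t l -> l = m -> is_derive f t m.
Proof. intros H <-. exact H. Qed.

(** Componentwise, so that every rule reduces to the real one; the variable is always real. *)
Definition is_Cderive (f : R -> C) (t : R) (l : C) : Prop :=
  is_derive (fun s => Re (f s)) t (Re l) /\ is_derive (fun s => Im (f s)) t (Im l).

Lemma is_Cderive_val (f : R -> C) (t : R) (l m : C) : is_Cderive f t l -> l = m -> is_Cderive f t m.
Proof. intros H <-. exact H. Qed.

Lemma is_Cderive_ext (f g : R -> C) (t : R) (l : C) :
  (forall s, f s = g s) -> is_Cderive f t l -> is_Cderive g t l.
Proof.
intros H [H1 H2]. split.
- apply (is_derive_ext (fun s => Re (f s))); auto. intros s. rewrite H. reflexivity.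
- apply (is_derive_ext (fun s => Im (f s))); auto. intros s. rewrite H. reflexivity.
Qed.

Lemma is_Cderive_const (c : C) (t : R) : is_Cderive (fun _ => c) t (RtoC 0).
Proof. split; apply (is_derive_const (K := R_AbsRing) (V := R_NormedModule)). Qed.

Lemma is_Cderive_RtoC (f : R -> R) (t l : R) :
  is_derive f t l -> is_Cderive (fun s => RtoC (f s)) t (RtoC l).
Proof.
split; cbn; auto. apply (is_derive_const (K := R_AbsRing) (V := R_NormedModule)).
Qed.

Lemma is_Cderive_plus (f g : R -> C) (t : R) (a b : C) :
  is_Cderive f t a -> is_Cderive g t b -> is_Cderive (fun s => f s + g s)%C t (a + b)%C.
Proof.
intros [H1 H2] [H3 H4]. split; cbn.
- apply (is_derive_plus (fun s => Re (f s)) (fun s => Re (g s))); auto.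
- apply (is_derive_plus (fun s => Im (f s)) (fun s => Im (g s))); auto.
Qed.

Lemma is_derive_Rmult (f g : R -> R) (t a b : R) :
  is_derive f t a -> is_derive g t b -> is_derive (fun s => f s * g s) t (a * g t + f t * b).
Proof. intros. apply (is_derive_mult f g); auto. intros; apply Rmult_comm. Qed.

Lemma is_Cderive_mult (f g : R -> C) (t : R) (a b : C) :
  is_Cderive f t a -> is_Cderive g t b ->
  is_Cderive (fun s => f s * g s)%C t (a * g t + f t * b)%C.
Proof.
intros [H1 H2] [H3 H4]. split; cbn.
- eapply is_derive_val.
  + apply (is_derive_minus (fun s => Re (f s) * Re (g s)) (fun s => Im (f s) * Im (g s)));
    apply is_derive_Rmult; eauto.
  + unfold minus, plus, opp, Re, Im; cbn. ring.
- eapply is_derive_val.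
  + apply (is_derive_plus (fun s => Re (f s) * Im (g s)) (fun s => Im (f s) * Re (g s)));
    apply is_derive_Rmult; eauto.
  + unfold minus, plus, opp, Re, Im; cbn. ring.
Qed.

Lemma is_Cderive_scal (c : C) (f : R -> C) (t : R) (a : C) :
  is_Cderive f t a -> is_Cderive (fun s => c * f s)%C t (c * a)%C.
Proof.
intros H. eapply is_Cderive_val.
- apply (is_Cderive_mult (fun _ => c)); [apply is_Cderive_const | exact H].
- ring.
Qed.

Lemma is_Cderive_Cexp (f : R -> C) (t : R) (a : C) :
  is_Cderive f t a -> is_Cderive (fun s => Cexp (f s)) t (a * Cexp (f t))%C.
Proof.
intros [H1 H2].
assert (He : is_derive (fun s => exp (Re (f s))) t (Re a * exp (Re (f t)))).
{ apply (is_derive_comp exp (fun s => Re (f s))); auto. apply is_derive_exp. }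
split; cbn.
- eapply is_derive_val.
  + apply is_derive_Rmult; [exact He|].
    apply (is_derive_comp cos (fun s => Im (f s))); [apply is_derive_cos | exact H2].
  + unfold scal, mult, Re, Im; cbn. unfold mult; cbn. ring.
- eapply is_derive_val.
  + apply is_derive_Rmult; [exact He|].
    apply (is_derive_comp sin (fun s => Im (f s))); [apply is_derive_sin | exact H2].
  + unfold scal, mult, Re, Im; cbn. unfold mult; cbn. ring.
Qed.

Lemma Cmod_sqr (z : C) : Cmod z ^ 2 = Re z ^ 2 + Im z ^ 2.
Proof. unfold Cmod. rewrite pow2_sqrt; [reflexivity|]. unfold Re, Im. nra. Qed.

Lemma re_dot_le (u v : C) : Rabs (Re u * Re v + Im u * Im v) <= Cmod u * Cmod v.
Proof.
pose proof (Cmod_ge_0 u). pose proof (Cmod_ge_0 v).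
pose proof (Cmod_sqr u). pose proof (Cmod_sqr v).
apply Rsqr_incr_0_var; [|nra].
rewrite <- Rsqr_abs. unfold Rsqr.
replace (Cmod u * Cmod v * (Cmod u * Cmod v)) with ((Cmod u ^ 2) * (Cmod v ^ 2)) by ring.
rewrite H1, H2. pose proof (pow2_ge_0 (Re u * Im v - Im u * Re v)). nra.
Qed.

(** Project on the direction [d = f b - f a]: the real inner product of [d] with [f] grows by
    [|d|^2] and its derivative is at most [|d| g']. The real inequality then gives
    [|d|^2 <= |d| (g b - g a)], and [|d|] cancels. *)
Lemma Cincrement_bound (f f' : R -> C) (g g' : R -> R) (a b : R) :
  a <= b ->
  (forall t, a <= t <= b -> is_Cderive f t (f' t)) ->
  (forall t, a <= t <= b -> is_derive g t (g' t)) ->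
  (forall t, a <= t <= b -> Cmod (f' t) <= g' t) ->
  Cmod (f b - f a)%C <= g b - g a.
Proof.
intros Hab Hf Hg Hb.
assert (Hg0 : 0 <= g b - g a).
{ enough (g a <= g b) by lra.
  apply (derive_nonneg_le g g'); auto.
  intros t Ht. eapply Rle_trans; [apply Cmod_ge_0 | apply (Hb t Ht)]. }
set (d := (f b - f a)%C).
assert (H : Rabs ((Re d * Re (f b) + Im d * Im (f b)) - (Re d * Re (f a) + Im d * Im (f a)))
            <= Cmod d * g b - Cmod d * g a).
{ apply (increment_bound (fun t => Re d * Re (f t) + Im d * Im (f t))
     (fun t => Re d * Re (f' t) + Im d * Im (f' t))
     (fun t => Cmod d * g t) (fun t => Cmod d * g' t)); auto.
  - intros t Ht. destruct (Hf t Ht) as [H1 H2].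
    apply (is_derive_plus (fun t => Re d * Re (f t)) (fun t => Im d * Im (f t)));
    apply is_derive_scal; auto.
  - intros t Ht. apply is_derive_scal; auto.
  - intros t Ht. eapply Rle_trans; [apply re_dot_le|].
    apply Rmult_le_compat_l; [apply Cmod_ge_0 | auto]. }
replace (Re d * Re (f b) + Im d * Im (f b) - (Re d * Re (f a) + Im d * Im (f a)))
  with (Cmod d ^ 2) in H
  by (rewrite Cmod_sqr; unfold d, Re, Im; cbn; ring).
apply Rabs_le_between in H.
pose proof (Cmod_ge_0 d).
destruct (Req_dec (Cmod d) 0) as [E|E]; [lra|]. nra.
Qed.

(** * Linear second-order equations and Hill's discriminant *)

Lemma is_derive_RInt_continuous (f : R -> R) (a t : R) :
  (forall s, continuous f s) -> is_derive (fun x => RInt f a x) t (f t).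
Proof.
intros Hf. apply (is_derive_RInt f (fun x => RInt f a x) a).
- apply filter_forall. intros x. apply (RInt_correct f).
  apply (ex_RInt_continuous f). auto.
- apply Hf.
Qed.

Lemma is_derive_continuous (f : R -> R) (t l : R) : is_derive f t l -> continuous f t.
Proof. intros H. apply (ex_derive_continuous f). exists l. exact H. Qed.

(** The terms of the Picard series, not its partial sums: only term 0 carries the initial data, all
    later terms vanish at 0, and the solution is the sum of the series. *)
Fixpoint picard (q : R -> R) (a b : R) (n : nat) : (R -> R) * (R -> R) :=
  match n with
  | O => (fun _ => a, fun _ => b)
  | S m => (fun t => RInt (snd (picard q a b m)) 0 t,
            fun t => RInt (fun s => - (q s * fst (picard q a b m) s)) 0 t)
  end.

Lemma picard_continuous (q : R -> R) (a b : R) (n : nat) :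
  (forall t, continuous q t) ->
  (forall t, continuous (fst (picard q a b n)) t) /\
  (forall t, continuous (snd (picard q a b n)) t) /\
  (forall t, continuous (fun s => - (q s * fst (picard q a b n) s)) t).
Proof.
intros Hq.
assert (Hm : forall f : R -> R, (forall t, continuous f t) ->
   forall t, continuous (fun s => - (q s * f s)) t).
{ intros f Hf t. apply (continuous_opp (fun s => q s * f s)).
  apply (continuous_mult q f); auto. }
induction n as [|n [IH1 [IH2 IH3]]].
- cbn. repeat split; intros.
  + apply continuous_const.
  + apply continuous_const.
  + apply (Hm (fun _ => a)). intros; apply continuous_const.
- assert (H1 : forall t, continuous (fst (picard q a b (S n))) t).
  { intros t. eapply is_derive_continuous. cbn. apply is_derive_RInt_continuous; auto. }
  repeat split; auto.
  intros t. eapply is_derive_continuous. cbn.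
  apply (is_derive_RInt_continuous (fun s => - (q s * fst (picard q a b n) s))); auto.
Qed.

Lemma picard_derive (q : R -> R) (a b : R) (n : nat) (t : R) :
  (forall t, continuous q t) ->
  is_derive (fst (picard q a b (S n))) t (snd (picard q a b n) t) /\
  is_derive (snd (picard q a b (S n))) t (- (q t * fst (picard q a b n) t)).
Proof.
intros Hq. destruct (picard_continuous q a b n Hq) as [H1 [H2 H3]]. cbn. split.
- apply is_derive_RInt_continuous; auto.
- apply (is_derive_RInt_continuous (fun s => - (q s * fst (picard q a b n) s))); auto.
Qed.

(* The weight [exp (2 M |t|)] turns the Picard operator into a contraction by 1/2. *)
Lemma contraction_bound (f f' : R -> R) (c M : R) :
  0 < M -> (forall t, is_derive f t (f' t)) -> f 0 = 0 ->
  (forall t, Rabs (f' t) <= M * (c * exp (2 * M * Rabs t))) ->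
  forall t, Rabs (f t) <= c / 2 * exp (2 * M * Rabs t).
Proof.
intros HM Hd H0 Hb.
assert (Hc : 0 <= c).
{ specialize (Hb 0). pose proof (Rabs_pos (f' 0)).
  pose proof (exp_pos (2 * M * Rabs 0)).
  destruct (Rle_lt_dec 0 c); auto.
  assert (M * (c * exp (2 * M * Rabs 0)) < 0); [|lra].
  assert (0 < M * exp (2 * M * Rabs 0)) by (apply Rmult_lt_0_compat; auto). nra. }
assert (H : forall e t, (e = 1 \/ e = -1) -> 0 <= t ->
   Rabs (f (e * t)) <= c / 2 * exp (2 * M * t)).
{ intros e t He Ht.
  assert (Hi : Rabs (f (e * t) - f (e * 0)) <= c / 2 * exp (2 * M * t) - c / 2 * exp (2 * M * 0)).
  { apply (increment_bound (fun t => f (e * t)) (fun t => e * f' (e * t))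
       (fun t => c / 2 * exp (2 * M * t)) (fun t => M * (c * exp (2 * M * t)))); auto.
    - intros s Hs.
      apply (is_derive_comp f (fun t => e * t)); [apply Hd|].
      auto_derive; auto; ring.
    - intros s Hs. auto_derive; auto. field.
    - intros s Hs. rewrite Rabs_mult.
      assert (Ee : Rabs e = 1).
      { destruct He as [-> | ->]; [apply Rabs_R1 | rewrite Rabs_left; lra]. }
      rewrite Ee, Rmult_1_l. eapply Rle_trans; [apply Hb|].
      rewrite Rabs_mult, Ee, Rmult_1_l, (Rabs_pos_eq s) by lra. lra. }
  replace (e * 0) with 0 in Hi by ring. rewrite H0, Rminus_0_r in Hi.
  pose proof (exp_pos (2 * M * 0)). nra. }
intros t. destruct (Rle_lt_dec 0 t) as [Ht|Ht].
- rewrite (Rabs_pos_eq t) by lra. replace t with (1 * t) at 1 by ring. apply H; auto.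
- rewrite (Rabs_left t) by lra. replace t with (-1 * - t) at 1 by ring. apply H; auto. lra.
Qed.

Lemma picard_at_0 (q : R -> R) (a b : R) (n : nat) :
  fst (picard q a b (S n)) 0 = 0 /\ snd (picard q a b (S n)) 0 = 0.
Proof. cbn. split; apply (RInt_point (V := R_CompleteNormedModule)). Qed.

(** Since [1 <= M], the same contraction handles both components: [y' = w] has coefficient 1 and
    [w' = - q y] has a coefficient of size at most [M]. *)
Lemma picard_bound (q : R -> R) (a b M : R) (n : nat) :
  (forall t, continuous q t) -> 1 <= M -> (forall t, Rabs (q t) <= M) ->
  forall t,
  Rabs (fst (picard q a b n) t) <= (Rabs a + Rabs b) * (1 / 2) ^ n * exp (2 * M * Rabs t) /\
  Rabs (snd (picard q a b n) t) <= (Rabs a + Rabs b) * (1 / 2) ^ n * exp (2 * M * Rabs t).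
Proof.
intros Hq HM Hb.
pose proof (Rabs_pos a). pose proof (Rabs_pos b).
assert (He : forall t, 1 <= exp (2 * M * Rabs t)).
{ intros t. rewrite <- exp_0.
  destruct (Rle_lt_or_eq_dec 0 (2 * M * Rabs t)) as [H1|H1].
  - pose proof (Rabs_pos t). nra.
  - left. apply exp_increasing; auto.
  - rewrite <- H1. lra. }
induction n as [|n IH].
- intros t. specialize (He t). cbn. split; nra.
- destruct (picard_at_0 q a b n) as [Z1 Z2].
  replace ((Rabs a + Rabs b) * (1 / 2) ^ S n) with ((Rabs a + Rabs b) * (1 / 2) ^ n / 2)
    by (cbn; field).
  set (c := (Rabs a + Rabs b) * (1 / 2) ^ n) in *.
  intros t. split; revert t.
  + apply (contraction_bound (fst (picard q a b (S n))) (snd (picard q a b n))); [lra | | exact Z1 |].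
    * intros t. apply (picard_derive q a b n t Hq).
    * intros t. destruct (IH t) as [_ H2]. pose proof (Rabs_pos (snd (picard q a b n) t)).
      nra.
  + apply (contraction_bound (snd (picard q a b (S n)))
      (fun t => - (q t * fst (picard q a b n) t))); [lra | | exact Z2 |].
    * intros t. apply (picard_derive q a b n t Hq).
    * intros t. rewrite Rabs_Ropp, Rabs_mult. destruct (IH t) as [H1 _].
      apply Rmult_le_compat; auto using Rabs_pos.
Qed.

Lemma CVN_R_geometric (f : nat -> R -> R) (C M : R) :
  0 <= C -> 0 <= M ->
  (forall n t, Rabs (f n t) <= C * (1 / 2) ^ n * exp (2 * M * Rabs t)) -> CVN_R f.
Proof.
intros HC HM Hf r.
exists (fun n => C * exp (2 * M * r) * (1 / 2) ^ n).
exists (C * exp (2 * M * r) * / (1 - 1 / 2)).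
pose proof (exp_pos (2 * M * r)) as He.
split.
- apply is_lim_seq_Reals.
  apply (is_lim_seq_ext (sum_n (fun n => C * exp (2 * M * r) * (1 / 2) ^ n))).
  + intros n. rewrite sum_n_Reals. apply sum_eq. intros i _.
    rewrite Rabs_pos_eq; auto.
    apply Rmult_le_pos; [nra | apply pow_le; lra].
  + apply (is_series_scal_l (C * exp (2 * M * r)) (fun n => (1 / 2) ^ n) (/ (1 - 1 / 2))).
    apply is_series_geom. rewrite Rabs_pos_eq; lra.
- intros n y Hy. unfold Boule in Hy. rewrite Rminus_0_r in Hy.
  eapply Rle_trans; [apply Hf|].
  replace (C * exp (2 * M * r) * (1 / 2) ^ n) with (C * (1 / 2) ^ n * exp (2 * M * r)) by ring.
  apply Rmult_le_compat_l.
  + apply Rmult_le_pos; [auto | apply pow_le; lra].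
  + destruct (Req_dec M 0) as [->|HM0].
    * right. f_equal. ring.
    * left. apply exp_increasing. apply Rmult_lt_compat_l; auto. lra.
Qed.

Lemma linear_ode_exists (q : R -> R) (a b M : R) :
  (forall t, continuous q t) -> (forall t, Rabs (q t) <= M) ->
  exists y w : R -> R,
    y 0 = a /\ w 0 = b /\
    (forall t, is_derive y t (w t)) /\ (forall t, is_derive w t (- (q t * y t))).
Proof.
intros Hq Hb0.
assert (Hb : forall t, Rabs (q t) <= Rmax 1 M).
{ intros t. eapply Rle_trans; [apply Hb0 | apply Rmax_r]. }
pose proof (Rmax_l 1 M) as HM. generalize (Rmax 1 M) HM Hb. clear M HM Hb Hb0.
intros M HM Hb.
pose (f := fun n => fst (picard q a b n)). pose (g := fun n => snd (picard q a b n)).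
pose proof (Rabs_pos a). pose proof (Rabs_pos b).
assert (Nf : CVN_R f).
{ apply (CVN_R_geometric f (Rabs a + Rabs b) M); try lra.
  intros n t. apply (picard_bound q a b M n Hq HM Hb t). }
assert (Ng : CVN_R g).
{ apply (CVN_R_geometric g (Rabs a + Rabs b) M); try lra.
  intros n t. apply (picard_bound q a b M n Hq HM Hb t). }
pose (cf := CVN_R_CVS f Nf). pose (cg := CVN_R_CVS g Ng).
assert (Lf : forall x, Un_cv (fun n => SP f n x) (SFL f cf x)).
{ intros x. unfold SFL. destruct (cf x); auto. }
assert (Lg : forall x, Un_cv (fun n => SP g n x) (SFL g cg x)).
{ intros x. unfold SFL. destruct (cg x); auto. }
assert (Hsh : forall (u : nat -> R) l, Un_cv u l -> Un_cv (fun n => u (S n)) l).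
{ intros u l Hu. apply is_lim_seq_Reals. apply (is_lim_seq_incr_1 u).
  apply is_lim_seq_Reals; auto. }
exists (SFL f cf), (SFL g cg).
(* Differentiation lowers the index by one: term 0 is constant and the derivative of term [n + 1]
   comes from term [n]. Hence the shifted partial sums here and in the termwise differentiation
   below. *)
assert (D : forall n t,
   is_derive (SP f (S n)) t (SP g n t) /\ is_derive (SP g (S n)) t (- (q t * SP f n t))).
{ intros n t. induction n as [|n [IH1 IH2]].
  - destruct (picard_derive q a b 0 t Hq) as [D1 D2].
    split; unfold SP, sum_f_R0.
    + eapply is_derive_val.
      * apply (is_derive_plus (f 0%nat) (f 1%nat)); [|exact D1].
        apply (is_derive_const (K := R_AbsRing) (V := R_NormedModule) a).
      * apply (plus_zero_l (snd (picard q a b 0) t)).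
    + eapply is_derive_val.
      * apply (is_derive_plus (g 0%nat) (g 1%nat)); [|exact D2].
        apply (is_derive_const (K := R_AbsRing) (V := R_NormedModule) b).
      * apply (plus_zero_l (- (q t * fst (picard q a b 0) t))).
  - destruct (picard_derive q a b (S n) t Hq) as [D1 D2].
    split.
    + apply (is_derive_plus (SP f (S n)) (f (S (S n)))); [exact IH1 | exact D1].
    + eapply is_derive_val.
      * apply (is_derive_plus (SP g (S n)) (g (S (S n)))); [exact IH2 | exact D2].
      * unfold plus, SP; cbn. unfold f. cbn. ring. }
assert (V0 : forall n, SP f n 0 = a /\ SP g n 0 = b).
{ intros n. induction n as [|n [IH1 IH2]]; [split; reflexivity|].
  destruct (picard_at_0 q a b n) as [Z1 Z2]. split.
  - change (SP f n 0 + fst (picard q a b (S n)) 0 = a). rewrite IH1, Z1. ring.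
  - change (SP g n 0 + snd (picard q a b (S n)) 0 = b). rewrite IH2, Z2. ring. }
split; [|split; [|split]].
- apply (UL_sequence (fun n => SP f n 0)); auto.
  apply is_lim_seq_Reals. apply (is_lim_seq_ext (fun _ => a)).
  + intros n. symmetry. apply V0.
  + apply is_lim_seq_const.
- apply (UL_sequence (fun n => SP g n 0)); auto.
  apply is_lim_seq_Reals. apply (is_lim_seq_ext (fun _ => b)).
  + intros n. symmetry. apply V0.
  + apply is_lim_seq_const.
- intros t. assert (Hr : 0 < Rabs t + 1) by (pose proof (Rabs_pos t); lra).
  apply is_derive_Reals.
  apply (CVU_derivable (fun n => SP f (S n)) (fun n => SP g n) _ _ 0 (mkposreal _ Hr)).
  + apply CVN_CVU. apply Ng.
  + intros x _. apply (Hsh (fun n => SP f n x)). apply Lf.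
  + intros n x _. apply is_derive_Reals. apply D.
  + unfold Boule. cbn. rewrite Rminus_0_r. lra.
- intros t. assert (Hr : 0 < Rabs t + 1) by (pose proof (Rabs_pos t); lra).
  apply is_derive_Reals.
  apply (CVU_derivable (fun n => SP g (S n)) (fun n x => - (q x * SP f n x)) _
    (fun x => - (q x * SFL f cf x)) 0 (mkposreal _ Hr)).
  + intros eps Heps.
    destruct (CVN_CVU f cf (mkposreal _ Hr) (Nf (mkposreal _ Hr)) (eps / M)) as [N HN].
    { apply Rdiv_lt_0_compat; lra. }
    exists N. intros n y Hn Hy. specialize (HN n y Hn Hy). cbv beta in HN.
    replace (- (q y * SFL f cf y) - - (q y * SP f n y))
      with (- (q y * (SFL f cf y - SP f n y))) by ring.
    rewrite Rabs_Ropp, Rabs_mult.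
    apply Rle_lt_trans with (M * Rabs (SFL f cf y - SP f n y)).
    * apply Rmult_le_compat_r; auto using Rabs_pos.
    * apply Rlt_le_trans with (M * (eps / M)).
      -- apply Rmult_lt_compat_l; lra.
      -- right. field. lra.
  + intros x _. apply (Hsh (fun n => SP g n x)). apply Lg.
  + intros n x _. apply is_derive_Reals. apply D.
  + unfold Boule. cbn. rewrite Rminus_0_r. lra.
Qed.

Definition ode_sol (q y w : R -> R) : Prop :=
  (forall t, is_derive y t (w t)) /\ (forall t, is_derive w t (- (q t * y t))).

Lemma ode_sol_hill (q y w : R -> R) : ode_sol q y w -> hill_solution q y.
Proof.
intros [H1 H2] t. split.
- exists (w t). apply H1.
- apply (is_derive_ext w); [|apply H2].
  intros s. symmetry. apply is_derive_unique, H1.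
Qed.

Lemma hill_ode_sol (q y : R -> R) : hill_solution q y -> ode_sol q y (Derive y).
Proof.
intros H. split; intros t.
- apply Derive_correct, H.
- apply H.
Qed.

Lemma ode_sol_lin (q y1 w1 y2 w2 : R -> R) (a b : R) :
  ode_sol q y1 w1 -> ode_sol q y2 w2 ->
  ode_sol q (fun t => a * y1 t + b * y2 t) (fun t => a * w1 t + b * w2 t).
Proof.
intros [H1 H2] [H3 H4]. split; intros t.
- apply (is_derive_plus (fun t => a * y1 t) (fun t => b * y2 t));
  apply is_derive_scal; auto.
- eapply is_derive_val.
  + apply (is_derive_plus (fun t => a * w1 t) (fun t => b * w2 t));
    apply is_derive_scal; auto.
  + unfold plus; cbn. ring.
Qed.

(** Treats two symmetries at once: reflection ([e = -1], [c = 0]) and translation by a period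
    ([e = 1]). *)
Lemma ode_sol_affine (q y w : R -> R) (e c : R) :
  e ^ 2 = 1 -> (forall t, q (e * t + c) = q t) -> ode_sol q y w ->
  ode_sol q (fun t => y (e * t + c)) (fun t => e * w (e * t + c)).
Proof.
intros He Hq [H1 H2].
assert (Ha : forall t, is_derive (fun t => e * t + c) t e).
{ intros t. auto_derive; auto; ring. }
split; intros t.
- apply (is_derive_comp y (fun t => e * t + c)); auto.
- eapply is_derive_val.
  + apply is_derive_scal. apply (is_derive_comp w (fun t => e * t + c)); auto.
  + unfold scal; cbn. unfold mult; cbn. rewrite Hq.
    transitivity (- (e ^ 2 * (q t * y (e * t + c)))); [ring | rewrite He; ring].
Qed.

(** With [q = r] this gives the constancy of the Wronskian; with different potentials it is the
    identity that compares the two equations. *)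
Lemma wronskian_derive (q r y w u v : R -> R) (t : R) :
  ode_sol q y w -> ode_sol r u v ->
  is_derive (fun t => y t * v t - w t * u t) t ((q t - r t) * (y t * u t)).
Proof.
intros [H1 H2] [H3 H4]. eapply is_derive_val.
- apply (is_derive_minus (fun t => y t * v t) (fun t => w t * u t));
  apply is_derive_Rmult; auto.
- unfold minus, plus, opp; cbn. ring.
Qed.

Lemma wronskian_const (q y w u v : R -> R) (t s : R) :
  ode_sol q y w -> ode_sol q u v ->
  y t * v t - w t * u t = y s * v s - w s * u s.
Proof.
intros H1 H2. apply (derive_zero_const (fun t => y t * v t - w t * u t)).
intros x. eapply is_derive_val; [apply (wronskian_derive q q); eauto | ring].
Qed.

Definition fundamental (q y1 w1 y2 w2 : R -> R) : Prop :=
  ode_sol q y1 w1 /\ ode_sol q y2 w2 /\ y1 0 = 1 /\ w1 0 = 0 /\ y2 0 = 0 /\ w2 0 = 1.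

Lemma fundamental_exists (q : R -> R) (M : R) :
  (forall t, continuous q t) -> (forall t, Rabs (q t) <= M) ->
  exists y1 w1 y2 w2, fundamental q y1 w1 y2 w2.
Proof.
intros Hq Hb.
destruct (linear_ode_exists q 1 0 M Hq Hb) as [y1 [w1 [A1 [A2 [A3 A4]]]]].
destruct (linear_ode_exists q 0 1 M Hq Hb) as [y2 [w2 [B1 [B2 [B3 B4]]]]].
exists y1, w1, y2, w2. repeat split; auto; apply A3 || apply A4 || apply B3 || apply B4.
Qed.

Lemma fundamental_wronskian (q y1 w1 y2 w2 : R -> R) (t : R) :
  fundamental q y1 w1 y2 w2 -> y1 t * w2 t - w1 t * y2 t = 1.
Proof.
intros [S1 [S2 [A1 [A2 [A3 A4]]]]].
rewrite (wronskian_const q y1 w1 y2 w2 t 0); auto. rewrite A1, A2, A3, A4. ring.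
Qed.

(** Cramer's rule: the Wronskians of [y] with [y1] and [y2] are constant, hence equal to the initial
    data up to sign. This also yields uniqueness for the initial value problem, without a Gronwall
    argument. *)
Lemma fundamental_span (q y1 w1 y2 w2 y w : R -> R) (t : R) :
  fundamental q y1 w1 y2 w2 -> ode_sol q y w ->
  y t = y 0 * y1 t + w 0 * y2 t /\ w t = y 0 * w1 t + w 0 * w2 t.
Proof.
intros F S. pose proof (fundamental_wronskian q y1 w1 y2 w2 t F) as HW.
destruct F as [S1 [S2 [A1 [A2 [A3 A4]]]]].
pose proof (wronskian_const q y w y2 w2 t 0 S S2) as E1.
pose proof (wronskian_const q y1 w1 y w t 0 S1 S) as E2.
rewrite A3, A4 in E1. rewrite A1, A2 in E2.
replace (y 0) with (y t * w2 t - w t * y2 t) by lra.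
replace (w 0) with (y1 t * w t - w1 t * y t) by lra.
split.
- transitivity (y t * (y1 t * w2 t - w1 t * y2 t)); [rewrite HW; ring | ring].
- transitivity (w t * (y1 t * w2 t - w1 t * y2 t)); [rewrite HW; ring | ring].
Qed.

Lemma fundamental_coeff (q y1 w1 y2 w2 : R -> R) (a b c d : R) :
  fundamental q y1 w1 y2 w2 ->
  (forall t, a * y1 t + b * y2 t = c * y1 t + d * y2 t) -> a = c /\ b = d.
Proof.
intros [[D1 _] [[D2 _] [A1 [A2 [A3 A4]]]]] H.
split.
- specialize (H 0). rewrite A1, A3 in H. lra.
- assert (E : a * w1 0 + b * w2 0 = c * w1 0 + d * w2 0).
  { assert (G : forall e f, is_derive (fun t => e * y1 t + f * y2 t) 0 (e * w1 0 + f * w2 0)).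
    { intros e f. apply (is_derive_plus (fun t => e * y1 t) (fun t => f * y2 t));
      apply is_derive_scal; auto. }
    rewrite <- (is_derive_unique _ _ _ (G a b)), <- (is_derive_unique _ _ _ (G c d)).
    apply Derive_ext. exact H. }
  rewrite A2, A4 in E. lra.
Qed.

Lemma fundamental_hill_basis (q y1 w1 y2 w2 : R -> R) :
  fundamental q y1 w1 y2 w2 -> hill_basis q y1 y2.
Proof.
intros F. pose proof F as [S1 [S2 _]].
split; [exact (ode_sol_hill _ _ _ S1)|]. split; [exact (ode_sol_hill _ _ _ S2)|].
intros w Hw. apply hill_ode_sol in Hw.
exists (w 0, Derive w 0). split.
- intros t. apply (fundamental_span q y1 w1 y2 w2 w (Derive w) t F Hw).
- intros [c d] Hc. cbn in Hc.
  destruct (fundamental_coeff q y1 w1 y2 w2 (w 0) (Derive w 0) c d F) as [-> ->]; auto.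
  intros t. rewrite <- Hc. symmetry.
  apply (fundamental_span q y1 w1 y2 w2 w (Derive w) t F Hw).
Qed.

(* The change of basis [P] satisfies [P M = A P], so the traces of [M] and [A] agree. *)
Lemma hill_trace_unique (q y1 w1 y2 w2 : R -> R) (sigma m11 m12 m21 m22 D : R) :
  fundamental q y1 w1 y2 w2 ->
  (forall t, y1 (t + sigma) = m11 * y1 t + m12 * y2 t) ->
  (forall t, y2 (t + sigma) = m21 * y1 t + m22 * y2 t) ->
  is_hill_discriminant q sigma D -> D = m11 + m22.
Proof.
intros F M1 M2 [u1 [u2 [a [b [c [d [[B1 [B2 B3]] [E1 [E2 ->]]]]]]]]].
apply hill_ode_sol in B1. apply hill_ode_sol in B2.
destruct (B3 y1) as [[i11 i12] [I1 _]]; [apply (ode_sol_hill q y1 w1); apply F|].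
destruct (B3 y2) as [[i21 i22] [I2 _]]; [apply (ode_sol_hill q y2 w2); apply F|].
cbn in I1, I2.
set (p11 := u1 0) in *. set (p12 := Derive u1 0) in *.
set (p21 := u2 0) in *. set (p22 := Derive u2 0) in *.
assert (U1 : forall t, u1 t = p11 * y1 t + p12 * y2 t).
{ intros t. apply (fundamental_span q y1 w1 y2 w2 u1 (Derive u1) t F B1). }
assert (U2 : forall t, u2 t = p21 * y1 t + p22 * y2 t).
{ intros t. apply (fundamental_span q y1 w1 y2 w2 u2 (Derive u2) t F B2). }
destruct (fundamental_coeff q y1 w1 y2 w2
   (i11 * p11 + i12 * p21) (i11 * p12 + i12 * p22) 1 0 F) as [J11 J12].
{ intros t. pose proof (I1 t) as H. rewrite U1, U2 in H. lra. }
destruct (fundamental_coeff q y1 w1 y2 w2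
   (i21 * p11 + i22 * p21) (i21 * p12 + i22 * p22) 0 1 F) as [J21 J22].
{ intros t. pose proof (I2 t) as H. rewrite U1, U2 in H. lra. }
destruct (fundamental_coeff q y1 w1 y2 w2
   (p11 * m11 + p12 * m21) (p11 * m12 + p12 * m22)
   (a * p11 + b * p21) (a * p12 + b * p22) F) as [K11 K12].
{ intros t. pose proof (E1 t) as H. rewrite !U1, U2, M1, M2 in H. lra. }
destruct (fundamental_coeff q y1 w1 y2 w2
   (p21 * m11 + p22 * m21) (p21 * m12 + p22 * m22)
   (c * p11 + d * p21) (c * p12 + d * p22) F) as [K21 K22].
{ intros t. pose proof (E2 t) as H. rewrite !U2, U1, M1, M2 in H. lra. }
(* The determinant of [P] is nonzero because the coordinates of [y1], [y2] in the basis [u1], [u2]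
   form an inverse matrix. The traces are then compared after multiplication by it. *)
set (k := p11 * p22 - p12 * p21).
assert (Hk : k <> 0).
{ intros Hk. assert (H : (i11 * i22 - i12 * i21) * k = 1).
  { transitivity ((i11 * p11 + i12 * p21) * (i21 * p12 + i22 * p22)
      - (i11 * p12 + i12 * p22) * (i21 * p11 + i22 * p21)); [unfold k; ring|].
    rewrite J11, J12, J21, J22. ring. }
  rewrite Hk in H. lra. }
apply (Rmult_eq_reg_r k); auto. unfold k.
transitivity ((a * p11 + b * p21) * p22 - (a * p12 + b * p22) * p21
   + (c * p12 + d * p22) * p11 - (c * p11 + d * p21) * p12); [ring|].
rewrite <- K11, <- K12, <- K21, <- K22. ring.
Qed.

(** The period map expands [y1 (t + 2 K)] and [y2 (t + 2 K)] in the basis. At [t = - K] parity turns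
    all values at [- K] into values at [K]; solving with the Wronskian gives [y1 (2 K) = w2 (2 K) =
    y1 K * w2 K + w1 K * y2 K]. The Wronskian once more removes [w1 K * y2 K], so only data on half
    a period are needed. *)
Lemma hill_discriminant_even (q y1 w1 y2 w2 : R -> R) (K : R) :
  (forall t, q (- t) = q t) -> (forall t, q (t + 2 * K) = q t) ->
  fundamental q y1 w1 y2 w2 ->
  hill_discriminant q (2 * K) = 4 * (y1 K * w2 K) - 2.
Proof.
intros He Hp F.
pose proof F as [S1 [S2 [A1 [A2 [A3 A4]]]]].
assert (Par : forall t, (y1 (- t) = y1 t /\ w1 (- t) = - w1 t) /\
                        (y2 (- t) = - y2 t /\ w2 (- t) = w2 t)).
{ assert (Hq : forall t, q (-1 * t + 0) = q t) by (intros t; rewrite <- (He t); f_equal; ring).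
  intros t.
  destruct (fundamental_span q y1 w1 y2 w2 _ _ t F
     (ode_sol_affine q y1 w1 (-1) 0 ltac:(ring) Hq S1)) as [P1 P2].
  destruct (fundamental_span q y1 w1 y2 w2 _ _ t F
     (ode_sol_affine q y2 w2 (-1) 0 ltac:(ring) Hq S2)) as [P3 P4].
  replace (-1 * t + 0) with (- t) in * by ring.
  replace (-1 * 0 + 0) with 0 in * by ring.
  rewrite A1, A2 in P1, P2. rewrite A3, A4 in P3, P4. repeat split; lra. }
assert (Sh : forall y w, ode_sol q y w -> forall t,
   y (t + 2 * K) = y (2 * K) * y1 t + w (2 * K) * y2 t /\
   w (t + 2 * K) = y (2 * K) * w1 t + w (2 * K) * w2 t).
{ intros y w S t.
  assert (Hq : forall t, q (1 * t + 2 * K) = q t) by (intros t0; rewrite <- (Hp t0); f_equal; ring).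
  destruct (fundamental_span q y1 w1 y2 w2 _ _ t F
     (ode_sol_affine q y w 1 (2 * K) ltac:(ring) Hq S)) as [P1 P2].
  replace (1 * t + 2 * K) with (t + 2 * K) in * by ring.
  replace (1 * 0 + 2 * K) with (2 * K) in * by ring. split; lra. }
pose proof (fundamental_wronskian q y1 w1 y2 w2 K F) as HW.
destruct (Par K) as [[Q1 Q2] [Q3 Q4]].
destruct (Sh y1 w1 S1 (- K)) as [R1 R2]. destruct (Sh y2 w2 S2 (- K)) as [R3 R4].
replace (- K + 2 * K) with K in * by ring.
rewrite Q1, Q2, Q3, Q4 in *.
assert (T1 : y1 (2 * K) = y1 K * w2 K + w1 K * y2 K).
{ pose proof (f_equal (Rmult (w2 K)) R1). pose proof (f_equal (Rmult (y2 K)) R2).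
  pose proof (f_equal (Rmult (y1 (2 * K))) HW). lra. }
assert (T2 : w2 (2 * K) = y1 K * w2 K + w1 K * y2 K).
{ pose proof (f_equal (Rmult (w1 K)) R3). pose proof (f_equal (Rmult (y1 K)) R4).
  pose proof (f_equal (Rmult (w2 (2 * K))) HW). lra. }
assert (Hval : y1 (2 * K) + w2 (2 * K) = 4 * (y1 K * w2 K) - 2) by lra.
rewrite <- Hval.
apply (iota_unique (V := R_CompleteNormedModule) (is_hill_discriminant q (2 * K))).
- intros D HD.
  apply (hill_trace_unique q y1 w1 y2 w2 (2 * K) (y1 (2 * K)) (w1 (2 * K))
    (y2 (2 * K)) (w2 (2 * K)) D F); auto.
  + intros t. apply (Sh y1 w1 S1 t).
  + intros t. apply (Sh y2 w2 S2 t).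
- exists y1, y2, (y1 (2 * K)), (w1 (2 * K)), (y2 (2 * K)), (w2 (2 * K)).
  split; [exact (fundamental_hill_basis q y1 w1 y2 w2 F)|].
  split; [intros t; apply (Sh y1 w1 S1 t)|].
  split; [intros t; apply (Sh y2 w2 S2 t)|]. reflexivity.
Qed.

(** * Elliptic integrals and the amplitude *)

Definition delta (k theta : R) : R := sqrt (1 - k ^ 2 * sin theta ^ 2).

Lemma sin_sqr_bound (theta : R) : 0 <= sin theta ^ 2 <= 1.
Proof. pose proof (SIN_bound theta). nra. Qed.

Lemma delta_arg_pos (k theta : R) : 0 < k < 1 -> 0 < 1 - k ^ 2 * sin theta ^ 2.
Proof. intros Hk. pose proof (sin_sqr_bound theta). nra. Qed.

Lemma delta_pos (k theta : R) : 0 < k < 1 -> 0 < delta k theta.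
Proof. intros Hk. apply sqrt_lt_R0, delta_arg_pos, Hk. Qed.

Lemma delta_sqr (k theta : R) : 0 < k < 1 -> delta k theta ^ 2 = 1 - k ^ 2 * sin theta ^ 2.
Proof. intros Hk. apply pow2_sqrt. left. apply delta_arg_pos, Hk. Qed.

Lemma delta_le_1 (k theta : R) : 0 < k < 1 -> delta k theta <= 1.
Proof.
intros Hk. pose proof (delta_sqr k theta Hk). pose proof (delta_pos k theta Hk).
pose proof (sin_sqr_bound theta). nra.
Qed.

Lemma delta_continuous (k theta : R) : 0 < k < 1 -> continuous (delta k) theta.
Proof.
intros Hk. apply (ex_derive_continuous (delta k)). unfold delta. auto_derive.
pose proof (delta_arg_pos k theta Hk). cbn in *. lra.
Qed.

Lemma inv_delta_continuous (k theta : R) :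
  0 < k < 1 -> continuous (fun x => 1 / delta k x) theta.
Proof.
intros Hk. apply (ex_derive_continuous (fun x => 1 / delta k x)). unfold delta. auto_derive.
pose proof (delta_arg_pos k theta Hk). pose proof (delta_pos k theta Hk) as H0.
unfold delta in H0. unfold Rminus in *. cbn in *. repeat split; lra.
Qed.

Lemma ellF_derive (k phi : R) :
  0 < k < 1 -> is_derive (fun phi => ellF phi k) phi (1 / delta k phi).
Proof.
intros Hk. apply (is_derive_RInt_continuous (fun x => 1 / delta k x)).
intros; apply inv_delta_continuous; auto.
Qed.

Lemma ellF_0 (k : R) : ellF 0 k = 0.
Proof. apply (RInt_point (V := R_CompleteNormedModule)). Qed.

(** Holds because [1 / delta >= 1]. One inequality gives injectivity, the bracket [[- |t|, |t|]] for
    surjectivity, and the 1-Lipschitz bound on the inverse function [jacobi_am]. *)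
Lemma ellF_expand (k a b : R) : 0 < k < 1 -> a <= b -> b - a <= ellF b k - ellF a k.
Proof.
intros Hk Hab.
enough (ellF a k - a <= ellF b k - b) by lra.
apply (derive_nonneg_le (fun t => ellF t k - t) (fun t => 1 / delta k t - 1)); auto.
- intros t _. apply (is_derive_minus (fun t => ellF t k) (fun t => t)).
  + apply ellF_derive; auto.
  + apply (is_derive_id (K := R_AbsRing)).
- intros t _. pose proof (delta_pos k t Hk). pose proof (delta_le_1 k t Hk).
  enough (1 <= 1 / delta k t) by lra.
  apply Rmult_le_reg_r with (delta k t); auto. field_simplify; lra.
Qed.

Lemma ellF_surjective (k t : R) : 0 < k < 1 -> exists phi, ellF phi k = t.
Proof.
intros Hk.
destruct (IVT_gen (fun phi => ellF phi k) (- Rabs t) (Rabs t) t) as [phi [_ H]].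
- intros x. apply derivable_continuous_pt. exists (1 / delta k x).
  apply is_derive_Reals, ellF_derive; auto.
- pose proof (Rabs_pos t).
  pose proof (ellF_expand k 0 (Rabs t) Hk ltac:(lra)) as H1.
  pose proof (ellF_expand k (- Rabs t) 0 Hk ltac:(lra)) as H2.
  rewrite ellF_0 in H1, H2. pose proof (Rle_abs t). pose proof (Rle_abs (- t)).
  rewrite Rabs_Ropp in *.
  rewrite Rmin_left, Rmax_right by lra. lra.
- exists phi. exact H.
Qed.

Lemma ellF_injective (k a b : R) : 0 < k < 1 -> ellF a k = ellF b k -> a = b.
Proof.
intros Hk H. destruct (Rle_dec a b) as [L|L].
- pose proof (ellF_expand k a b Hk L). lra.
- pose proof (ellF_expand k b a Hk ltac:(lra)). lra.
Qed.

Lemma ellF_am (k t : R) : 0 < k < 1 -> ellF (jacobi_am t k) k = t.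
Proof.
intros Hk.
apply (iota_correct (V := R_CompleteNormedModule) (fun phi => ellF phi k = t)).
destruct (ellF_surjective k t Hk) as [phi H].
exists phi. split; auto. intros psi H2. apply (ellF_injective k); auto. congruence.
Qed.

Lemma am_ellF (k phi : R) : 0 < k < 1 -> jacobi_am (ellF phi k) k = phi.
Proof. intros Hk. apply (ellF_injective k); auto. apply ellF_am; auto. Qed.

Lemma am_incr (k s t : R) :
  0 < k < 1 -> s <= t -> 0 <= jacobi_am t k - jacobi_am s k <= t - s.
Proof.
intros Hk Hst. destruct (Rle_dec (jacobi_am s k) (jacobi_am t k)) as [L|L].
- pose proof (ellF_expand k _ _ Hk L) as H. rewrite !ellF_am in H by auto. lra.
- assert (L' : jacobi_am t k <= jacobi_am s k) by lra.
  pose proof (ellF_expand k _ _ Hk L') as H. rewrite !ellF_am in H by auto. lra.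
Qed.

Lemma am_derive (k t : R) :
  0 < k < 1 -> is_derive (fun t => jacobi_am t k) t (delta k (jacobi_am t k)).
Proof.
intros Hk. apply is_derive_Reals.
(* The inverse function rule speaks of [derive_pt], which depends on a proof of derivability. An
   explicit proof term makes its value [1 / delta] hold by computation in [Ed]. *)
pose (Prf := fun (a : R) (_ : jacobi_am (t - 1) k <= a <= jacobi_am (t + 1) k) =>
   exist (fun l => derivable_pt_lim (fun phi => ellF phi k) a l) (1 / delta k a)
     (proj1 (is_derive_Reals _ _ _) (ellF_derive k a Hk))).
assert (Prg : jacobi_am (t - 1) k <= jacobi_am t k <= jacobi_am (t + 1) k).
{ pose proof (am_incr k (t - 1) t Hk ltac:(lra)).
  pose proof (am_incr k t (t + 1) Hk ltac:(lra)). lra. }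
pose proof (delta_pos k (jacobi_am t k) Hk) as Hd.
assert (Ed : derive_pt (fun phi => ellF phi k) (jacobi_am t k) (Prf (jacobi_am t k) Prg)
   = 1 / delta k (jacobi_am t k)) by reflexivity.
replace (delta k (jacobi_am t k)) with
  (1 / derive_pt (fun phi => ellF phi k) (jacobi_am t k) (Prf (jacobi_am t k) Prg)).
- apply (Ranalysis5.derivable_pt_lim_recip_interv (fun phi => ellF phi k)
    (fun t => jacobi_am t k) (t - 1) (t + 1) t Prf).
  + intros eps Heps. exists eps. split; auto. intros x [_ Hx].
    change (Rabs (x - t) < eps) in Hx. change (Rabs (jacobi_am x k - jacobi_am t k) < eps).
    eapply Rle_lt_trans; [|exact Hx].
    destruct (Rle_dec x t) as [L|L].
    * pose proof (am_incr k x t Hk L). rewrite (Rabs_left1 (x - t)) by lra. apply Rabs_le. lra.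
    * pose proof (am_incr k t x Hk ltac:(lra)). rewrite (Rabs_pos_eq (x - t)) by lra. apply Rabs_le; lra.
  + lra.
  + lra.
  + intros x _. apply ellF_am; auto.
  + rewrite Ed. assert (0 < 1 / delta k (jacobi_am t k)); [|lra].
    apply Rdiv_lt_0_compat; lra.
- rewrite Ed. field. lra.
Qed.

Lemma delta_opp (k theta : R) : delta k (- theta) = delta k theta.
Proof. unfold delta. rewrite sin_neg. f_equal. ring. Qed.

Lemma delta_shift (k theta : R) : delta k (theta + PI) = delta k theta.
Proof. unfold delta. rewrite neg_sin. f_equal. ring. Qed.

Lemma ellF_opp (k phi : R) : 0 < k < 1 -> ellF (- phi) k = - ellF phi k.
Proof.
intros Hk.
enough (ellF (- phi) k + ellF phi k = ellF (- 0) k + ellF 0 k)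
  by (rewrite Ropp_0, ellF_0 in *; lra).
apply (derive_zero_const (fun phi => ellF (- phi) k + ellF phi k)).
intros t. eapply is_derive_val.
- apply (is_derive_plus (fun t => ellF (- t) k) (fun t => ellF t k)); [|apply ellF_derive; auto].
  apply (is_derive_comp (fun t => ellF t k) (fun t => - t)); [apply ellF_derive; auto|].
  auto_derive; auto; reflexivity.
- rewrite delta_opp. unfold plus, scal; cbn. unfold mult; cbn. ring.
Qed.

(** [delta] has period [PI], so the increment over a length [PI] does not depend on the starting
    point; starting at [- PI / 2] it is evaluated by oddness. *)
Lemma ellF_shift_PI (k phi : R) : 0 < k < 1 -> ellF (phi + PI) k = ellF phi k + 2 * ellF (PI / 2) k.
Proof.
intros Hk.
assert (H : forall a b, ellF (a + PI) k - ellF a k = ellF (b + PI) k - ellF b k).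
{ apply (derive_zero_const (fun a => ellF (a + PI) k - ellF a k)).
  intros t. eapply is_derive_val.
  - apply (is_derive_minus (fun t => ellF (t + PI) k) (fun t => ellF t k));
      [|apply ellF_derive; auto].
    apply (is_derive_comp (fun t => ellF t k) (fun t => t + PI)); [apply ellF_derive; auto|].
    auto_derive; auto; reflexivity.
  - rewrite delta_shift. unfold minus, plus, scal, opp; cbn. unfold mult; cbn. ring. }
specialize (H phi (- (PI / 2))).
replace (- (PI / 2) + PI) with (PI / 2) in H by field.
rewrite (ellF_opp k (PI / 2)) in H by auto. lra.
Qed.

Lemma am_0 (k : R) : 0 < k < 1 -> jacobi_am 0 k = 0.
Proof. intros Hk. rewrite <- (ellF_0 k) at 1. apply am_ellF; auto. Qed.

Lemma am_opp (k t : R) : 0 < k < 1 -> jacobi_am (- t) k = - jacobi_am t k.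
Proof.
intros Hk. apply (ellF_injective k); auto. rewrite ellF_opp, !ellF_am; auto.
Qed.

Lemma am_shift (k t : R) :
  0 < k < 1 -> jacobi_am (t + 2 * ellF (PI / 2) k) k = jacobi_am t k + PI.
Proof.
intros Hk. apply (ellF_injective k); auto. rewrite ellF_shift_PI, !ellF_am; auto.
Qed.

Lemma am_quarter_range (k t : R) :
  0 < k < 1 -> 0 <= t <= ellF (PI / 2) k -> 0 <= jacobi_am t k <= PI / 2.
Proof.
intros Hk Ht.
pose proof (am_incr k 0 t Hk ltac:(lra)) as H1. rewrite am_0 in H1 by auto.
pose proof (am_incr k t (ellF (PI / 2) k) Hk ltac:(lra)) as H2. rewrite am_ellF in H2 by auto.
lra.
Qed.

(** The substitution [x = sin theta] removes the singularity at 1: up to [x < 1] the integral is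
    [G (asin x) - G 0], and the improper integral is the limit by continuity of [G] at [PI / 2].
    Serves for both [ellK] and [ellE]. *)
Lemma is_RInt_gen_sin (f g G : R -> R) :
  (forall x, 0 <= x < 1 -> continuous f x) ->
  (forall theta, 0 <= theta < PI / 2 -> cos theta * f (sin theta) = g theta) ->
  (forall theta, is_derive G theta (g theta)) ->
  is_RInt_gen f (at_point 0) (at_left 1) (G (PI / 2) - G 0).
Proof.
intros Hf Hg HG.
pose proof PI_RGT_0 as HPI.
assert (Hsub : forall x, 0 < x < 1 -> is_RInt f 0 x (G (asin x) - G 0)).
{ intros x Hx.
  pose proof (asin_bound_lt x ltac:(lra)) as Hb.
  assert (Ha : 0 <= asin x).
  { destruct (Rle_lt_dec 0 (asin x)) as [L|L]; auto.
    pose proof (sin_lt_0_var (asin x) ltac:(lra) L). rewrite sin_asin in H; lra. }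
  assert (Hr : forall y, 0 <= y <= asin x -> 0 <= sin y <= x).
  { intros y Hy. split.
    - apply sin_ge_0; lra.
    - rewrite <- (sin_asin x) by lra. apply sin_incr_1; lra. }
  pose proof (is_RInt_comp f sin cos 0 (asin x)) as HC.
  rewrite Rmin_left, Rmax_right, sin_0, sin_asin in HC by lra.
  assert (HC' : is_RInt (fun y => scal (cos y) (f (sin y))) 0 (asin x) (RInt f 0 x)).
  { apply HC.
    - intros y Hy. apply Hf. specialize (Hr y Hy). lra.
    - intros y _. split; [apply is_derive_sin | apply continuous_cos]. }
  assert (HD : is_RInt (fun y => scal (cos y) (f (sin y))) 0 (asin x) (G (asin x) - G 0)).
  { apply (is_RInt_derive (V := R_CompleteNormedModule) G).
    - intros y Hy. rewrite Rmin_left, Rmax_right in Hy by lra.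
      unfold scal; cbn. unfold mult; cbn. rewrite Hg by lra. apply HG.
    - intros y Hy. rewrite Rmin_left, Rmax_right in Hy by lra.
      apply (continuous_mult cos (fun y => f (sin y))); [apply continuous_cos|].
      apply (continuous_comp sin f); [apply continuous_sin|].
      apply Hf. specialize (Hr y Hy). lra. }
  (* The transformed integral is evaluated twice: [HC'] by the change of variable and [HD] by the
     antiderivative [G]. *)
  rewrite <- (is_RInt_unique _ _ _ _ HD), (is_RInt_unique _ _ _ _ HC').
  apply (RInt_correct f). apply (ex_RInt_continuous f).
  intros z Hz. rewrite Rmin_left, Rmax_right in Hz by lra. apply Hf. lra. }
intros P HP.
assert (Hc : continuous (fun theta => G theta - G 0) (PI / 2)).
{ apply (continuous_minus G (fun _ => G 0)); [|apply continuous_const].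
  eapply is_derive_continuous, HG. }
destruct (Hc P HP) as [d Hd].
(* The cap [PI / 2] keeps [PI / 2 - e] in the range where [sin] is increasing and nonnegative. *)
set (e := Rmin d (PI / 2)).
assert (He : 0 < e <= PI / 2).
{ unfold e. split; [apply Rmin_glb_lt; [apply d | lra] | apply Rmin_r]. }
assert (Hsin : sin (PI / 2 - e) < 1).
{ rewrite <- sin_PI2. apply sin_increasing_1; lra. }
assert (Hsin0 : 0 <= sin (PI / 2 - e)) by (apply sin_ge_0; lra).
apply (Filter_prod _ _ _ (fun x => x = 0) (fun y => sin (PI / 2 - e) < y < 1)).
- reflexivity.
- assert (Hp : 0 < 1 - sin (PI / 2 - e)) by lra.
  exists (mkposreal _ Hp). intros y Hy Hlt. split; auto.
  unfold ball in Hy; cbn in Hy. unfold AbsRing_ball, abs, minus, plus, opp in Hy; cbn in Hy.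
  apply Rabs_lt_between in Hy. lra.
- intros x y -> Hy. exists (G (asin y) - G 0). split.
  + apply Hsub. lra.
  + apply Hd. pose proof (asin_bound_lt y ltac:(lra)) as Hb.
    assert (PI / 2 - e < asin y).
    { destruct (Rlt_le_dec (PI / 2 - e) (asin y)) as [L|L]; auto.
      pose proof (sin_incr_1 (asin y) (PI / 2 - e) ltac:(lra) ltac:(lra) ltac:(lra)
        ltac:(lra) L) as H. rewrite sin_asin in H; lra. }
    unfold ball; cbn. unfold AbsRing_ball, abs, minus, plus, opp; cbn.
    pose proof (Rmin_l d (PI / 2)). fold e in H0.
    apply Rabs_lt_between. lra.
Qed.

Lemma cos_sqrt (theta : R) : 0 <= theta < PI / 2 -> sqrt (1 - sin theta ^ 2) = cos theta.
Proof.
intros H. pose proof (cos_gt_0 theta ltac:(lra) ltac:(lra)).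
pose proof (sin2_cos2 theta) as E. unfold Rsqr in E.
replace (1 - sin theta ^ 2) with (cos theta * cos theta) by lra.
apply sqrt_square. lra.
Qed.

Lemma ellK_ellF (k : R) : 0 < k < 1 -> ellK k = ellF (PI / 2) k.
Proof.
intros Hk. unfold ellK, ellE. apply (is_RInt_gen_unique (V := R_CompleteNormedModule)).
replace (ellF (PI / 2) k) with (ellF (PI / 2) k - ellF 0 k) by (rewrite ellF_0; ring).
apply (is_RInt_gen_sin _ (fun theta => 1 / delta k theta) (fun phi => ellF phi k)).
- intros x Hx.
  apply (ex_derive_continuous (fun t => 1 / (sqrt (1 - t ^ 2) * sqrt (1 - k ^ 2 * t ^ 2)))).
  assert (0 < 1 - x ^ 2) by nra. assert (0 < 1 - k ^ 2 * x ^ 2) by nra.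
  pose proof (sqrt_lt_R0 _ H). pose proof (sqrt_lt_R0 _ H0).
  auto_derive. unfold Rminus in *. cbn in *. repeat split; auto; try lra.
  apply Rgt_not_eq, Rmult_lt_0_compat; lra.
- intros theta Ht. rewrite cos_sqrt by auto.
  pose proof (cos_gt_0 theta ltac:(lra) ltac:(lra)). pose proof (delta_pos k theta Hk).
  fold (delta k theta). field. lra.
- intros. apply ellF_derive; auto.
Qed.

Definition ellEinc (k phi : R) : R := RInt (delta k) 0 phi.

Lemma ellEinc_derive (k phi : R) : 0 < k < 1 -> is_derive (ellEinc k) phi (delta k phi).
Proof.
intros Hk. apply (is_derive_RInt_continuous (delta k)). intros; apply delta_continuous; auto.
Qed.

Lemma ellEinc_0 (k : R) : ellEinc k 0 = 0.
Proof. apply (RInt_point (V := R_CompleteNormedModule)). Qed.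

Lemma ellE_ellEinc (k : R) : 0 < k < 1 -> ellE k = ellEinc k (PI / 2).
Proof.
intros Hk. unfold ellK, ellE. apply (is_RInt_gen_unique (V := R_CompleteNormedModule)).
replace (ellEinc k (PI / 2)) with (ellEinc k (PI / 2) - ellEinc k 0) by (rewrite ellEinc_0; ring).
apply (is_RInt_gen_sin _ (delta k) (ellEinc k)).
- intros x Hx.
  apply (ex_derive_continuous (fun t => sqrt (1 - k ^ 2 * t ^ 2) / sqrt (1 - t ^ 2))).
  assert (0 < 1 - x ^ 2) by nra. assert (0 < 1 - k ^ 2 * x ^ 2) by nra.
  pose proof (sqrt_lt_R0 _ H). pose proof (sqrt_lt_R0 _ H0).
  auto_derive. unfold Rminus in *. cbn in *. repeat split; try lra.
- intros theta Ht. rewrite cos_sqrt by auto.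
  pose proof (cos_gt_0 theta ltac:(lra) ltac:(lra)). pose proof (delta_pos k theta Hk).
  fold (delta k theta). field. lra.
- intros. apply ellEinc_derive; auto.
Qed.

(** This is how [E] enters the bound: [1 - k^2 sn^2 = dn^2] has the antiderivative
    [ellEinc k (am t)], which equals [ellE k] at [t = K]. *)
Lemma ellEinc_am_derive (k t : R) :
  0 < k < 1 ->
  is_derive (fun t => ellEinc k (jacobi_am t k)) t (1 - k ^ 2 * jacobi_sn t k ^ 2).
Proof.
intros Hk. eapply is_derive_val.
- apply (is_derive_comp (ellEinc k) (fun t => jacobi_am t k)).
  + apply ellEinc_derive; auto.
  + apply am_derive; auto.
- unfold jacobi_sn. rewrite <- delta_sqr by auto. unfold scal; cbn. unfold mult; cbn. ring.
Qed.

Lemma sn_derive (k t : R) :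
  0 < k < 1 ->
  is_derive (fun t => jacobi_sn t k) t (cos (jacobi_am t k) * delta k (jacobi_am t k)).
Proof.
intros Hk. eapply is_derive_val.
- apply (is_derive_comp sin (fun t => jacobi_am t k)).
  + apply is_derive_sin.
  + apply am_derive; auto.
- unfold scal; cbn. unfold mult; cbn. ring.
Qed.

Lemma sn_0 (k : R) : 0 < k < 1 -> jacobi_sn 0 k = 0.
Proof. intros Hk. unfold jacobi_sn. rewrite am_0, sin_0; auto. Qed.

Lemma sn_sqr_opp (k t : R) : 0 < k < 1 -> jacobi_sn (- t) k ^ 2 = jacobi_sn t k ^ 2.
Proof. intros Hk. unfold jacobi_sn. rewrite am_opp, sin_neg by auto. ring. Qed.

Lemma sn_sqr_shift (k t : R) :
  0 < k < 1 -> jacobi_sn (t + 2 * ellK k) k ^ 2 = jacobi_sn t k ^ 2.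
Proof. intros Hk. unfold jacobi_sn. rewrite ellK_ellF, am_shift, neg_sin by auto. ring. Qed.

(** * Hyperbolic functions and the comparison of [k sn] with [tanh] *)

Lemma cosh_pos (t : R) : 0 < cosh t.
Proof. unfold cosh. pose proof (exp_pos t). pose proof (exp_pos (- t)). lra. Qed.

Lemma cosh_sinh_sqr (t : R) : cosh t ^ 2 - sinh t ^ 2 = 1.
Proof.
unfold cosh, sinh. assert (exp t * exp (- t) = 1) by (rewrite <- exp_plus, Rplus_opp_r, exp_0; auto).
replace (((exp t + exp (- t)) / 2) ^ 2 - ((exp t - exp (- t)) / 2) ^ 2)
  with (exp t * exp (- t)) by field. exact H.
Qed.

Lemma cosh_derive (t : R) : is_derive cosh t (sinh t).
Proof. apply is_derive_Reals, derivable_pt_lim_cosh. Qed.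

Lemma sinh_derive (t : R) : is_derive sinh t (cosh t).
Proof. apply is_derive_Reals, derivable_pt_lim_sinh. Qed.

Lemma tanh_sqr (t : R) : 1 - tanh t ^ 2 = / cosh t ^ 2.
Proof.
unfold tanh. pose proof (cosh_pos t). pose proof (cosh_sinh_sqr t).
replace (/ cosh t ^ 2) with ((cosh t ^ 2 - sinh t ^ 2) / cosh t ^ 2); [field; lra|].
rewrite H0. field. lra.
Qed.

Lemma tanh_derive (t : R) : is_derive tanh t (/ cosh t ^ 2).
Proof.
unfold tanh. pose proof (cosh_pos t). rewrite <- tanh_sqr. unfold tanh.
eapply is_derive_val.
- apply (is_derive_div sinh cosh); [apply sinh_derive | apply cosh_derive | lra].
- cbn. field. lra.
Qed.

Lemma tanh_exp (t : R) : tanh t * (exp (2 * t) + 1) = exp (2 * t) - 1.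
Proof.
unfold tanh, cosh, sinh. replace (2 * t) with (t + t) by ring. rewrite exp_plus, exp_Ropp.
pose proof (exp_pos t). field. nra.
Qed.

Lemma tanh_0 : tanh 0 = 0.
Proof. unfold tanh. rewrite sinh_0. unfold Rdiv. ring. Qed.

Lemma tanh_lt_1 (t : R) : tanh t < 1.
Proof. pose proof (tanh_exp t). pose proof (exp_pos (2 * t)). nra. Qed.

Lemma tanh_nonneg (t : R) : 0 <= t -> 0 <= tanh t.
Proof.
intros Ht. rewrite <- tanh_0. apply (derive_nonneg_le tanh (fun t => / cosh t ^ 2)); auto.
- intros; apply tanh_derive.
- intros s _. left. apply Rinv_0_lt_compat, pow_lt, cosh_pos.
Qed.

(* [f = k sn] satisfies [f' <= 1 - f^2], the equation of [tanh]; hence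
   [exp (2 t) (1 - f) / (1 + f)] is nondecreasing. *)
Lemma k_sn_le_tanh (k t : R) :
  0 < k < 1 -> 0 <= t <= ellK k -> 0 <= k * jacobi_sn t k <= tanh t.
Proof.
intros Hk Ht. rewrite ellK_ellF in Ht by auto.
assert (Hs : forall s, 0 <= s <= t -> 0 <= jacobi_sn s k <= 1 /\ 0 <= cos (jacobi_am s k)).
{ intros s Hs. pose proof (am_quarter_range k s Hk ltac:(lra)). pose proof PI_RGT_0.
  unfold jacobi_sn. repeat split; [apply sin_ge_0; lra | apply SIN_bound | apply cos_ge_0; lra]. }
assert (Hd : forall s, 0 <= s <= t ->
  is_derive (fun s => exp (2 * s) * ((1 - k * jacobi_sn s k) / (1 + k * jacobi_sn s k))) s
   (2 * exp (2 * s) / (1 + k * jacobi_sn s k) ^ 2 *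
     (1 - k ^ 2 * jacobi_sn s k ^ 2 - k * (cos (jacobi_am s k) * delta k (jacobi_am s k))))).
{ intros s H. destruct (Hs s H) as [H1 _].
  assert (0 < 1 + k * jacobi_sn s k) by nra.
  assert (Dk : is_derive (fun s => k * jacobi_sn s k) s
     (k * (cos (jacobi_am s k) * delta k (jacobi_am s k)))).
  { apply is_derive_scal, sn_derive; auto. }
  set (v := k * (cos (jacobi_am s k) * delta k (jacobi_am s k))) in *.
  eapply is_derive_val.
  - apply is_derive_Rmult.
    + apply (is_derive_comp exp (fun s => 2 * s)); [apply is_derive_exp|].
      apply is_derive_scal. apply (is_derive_id (K := R_AbsRing)).
    + apply (is_derive_div (fun s => 1 - k * jacobi_sn s k) (fun s => 1 + k * jacobi_sn s k)).
      * apply (is_derive_minus (fun _ => 1) (fun s => k * jacobi_sn s k)); [|exact Dk].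
        apply (is_derive_const (K := R_AbsRing) (V := R_NormedModule)).
      * apply (is_derive_plus (fun _ => 1) (fun s => k * jacobi_sn s k)); [|exact Dk].
        apply (is_derive_const (K := R_AbsRing) (V := R_NormedModule)).
      * lra.
  - unfold minus, plus, opp, scal, one, zero; cbn. unfold mult; cbn. field. lra. }
destruct (Hs t ltac:(lra)) as [H1 _].
split; [nra|].
assert (H := derive_nonneg_le _ _ 0 t ltac:(lra) Hd). cbv beta in H.
rewrite sn_0, !Rmult_0_r, exp_0 in H by auto.
assert (H2 : 1 * ((1 - 0) / (1 + 0)) <=
   exp (2 * t) * ((1 - k * jacobi_sn t k) / (1 + k * jacobi_sn t k))).
{ apply H. intros s H3. destruct (Hs s H3) as [H4 H5].
  apply Rmult_le_pos.
  - assert (0 < 1 + k * jacobi_sn s k) by nra. pose proof (exp_pos (2 * s)).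
    left. apply Rdiv_lt_0_compat; [lra | apply pow_lt; auto].
  - pose proof (delta_sqr k (jacobi_am s k) Hk) as E1.
    pose proof (delta_pos k (jacobi_am s k) Hk).
    pose proof (sin2_cos2 (jacobi_am s k)) as E2. unfold Rsqr in E2.
    fold (jacobi_sn s k) in E1, E2.
    set (x := jacobi_sn s k) in *. set (c := cos (jacobi_am s k)) in *.
    set (dl := delta k (jacobi_am s k)) in *.
    rewrite <- E1.
    (* The expression to be shown nonnegative is [dl * (dl - k * c)], and
       [dl^2 - (k * c)^2 = 1 - k^2 > 0]. *)
    assert (k * c <= dl); [|nra].
    apply Rsqr_incr_0_var; [|lra]. unfold Rsqr. nra. }
replace (1 * ((1 - 0) / (1 + 0))) with 1 in H2 by field.
assert (Hp : 0 < 1 + k * jacobi_sn t k) by nra.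
apply (Rmult_le_compat_r (1 + k * jacobi_sn t k)) in H2; [|lra].
replace (exp (2 * t) * ((1 - k * jacobi_sn t k) / (1 + k * jacobi_sn t k)) * (1 + k * jacobi_sn t k))
  with (exp (2 * t) * (1 - k * jacobi_sn t k)) in H2 by (field; lra).
pose proof (tanh_exp t). pose proof (exp_pos (2 * t)).
apply Rmult_le_reg_r with (exp (2 * t) + 1); lra.
Qed.

(** * Energy bounds and comparison with the sech potential *)

Lemma sqr_le_abs (x c : R) : 0 <= c -> x ^ 2 <= c ^ 2 -> Rabs x <= c.
Proof.
intros Hc H. rewrite <- (Rabs_pos_eq c) by auto. apply Rsqr_le_abs_0. unfold Rsqr. lra.
Qed.

(* The two monotonicity cases (potential nonincreasing or nondecreasing on [0, T])
   lead to the same inequality with different constants. *)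
Definition energy_bound (p : R -> R) (T om a b : R) : Prop :=
  forall y w s t, ode_sol p y w -> 0 <= s <= t -> t <= T ->
    w t ^ 2 + om ^ 2 * y t ^ 2 <= a ^ 2 * w s ^ 2 + b ^ 2 * y s ^ 2.

(** The energy [w^2 + p y^2] has derivative [p' y^2 <= 0]; then [p] is replaced by [om^2] at the
    later time and by [h] at the earlier one. *)
Lemma energy_bound_nonincreasing (p p' : R -> R) (T om h : R) :
  0 <= h ->
  (forall t, 0 <= t <= T -> is_derive p t (p' t)) ->
  (forall t, 0 <= t <= T -> p' t <= 0) ->
  (forall t, 0 <= t <= T -> om ^ 2 <= p t <= h) ->
  energy_bound p T om 1 (sqrt h).
Proof.
intros Hh Hd Hn Hb y w s t [S1 S2] Hst HT.
rewrite pow2_sqrt by auto.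
assert (H : w t * w t + p t * (y t * y t) <= w s * w s + p s * (y s * y s)).
{ apply (derive_nonpos_ge (fun t => w t * w t + p t * (y t * y t))
    (fun t => p' t * (y t * y t)) s t); [lra | |].
  - intros x Hx. eapply is_derive_val.
    + apply (is_derive_plus (fun t => w t * w t) (fun t => p t * (y t * y t))).
      * apply is_derive_Rmult; auto.
      * apply is_derive_Rmult; [apply Hd; lra|]. apply is_derive_Rmult; auto.
    + unfold plus; cbn. ring.
  - intros x Hx. specialize (Hn x ltac:(lra)). nra. }
pose proof (Hb t ltac:(lra)). pose proof (Hb s ltac:(lra)). nra.
Qed.

(** For increasing [p] the decaying quantity is [y^2 + w^2 / p], with derivative [- p' (w / p)^2].
    Multiplication by [om^2] brings it to the common form. *)
Lemma energy_bound_nondecreasing (p p' : R -> R) (T om h : R) :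
  0 < h -> 0 < om ->
  (forall t, 0 <= t <= T -> is_derive p t (p' t)) ->
  (forall t, 0 <= t <= T -> 0 <= p' t) ->
  (forall t, 0 <= t <= T -> h <= p t <= om ^ 2) ->
  energy_bound p T om (om / sqrt h) om.
Proof.
intros Hh Hom Hd Hn Hb y w s t [S1 S2] Hst HT.
pose proof (sqrt_lt_R0 h Hh) as Hs.
replace ((om / sqrt h) ^ 2) with (om ^ 2 / sqrt h ^ 2) by (field; lra).
rewrite pow2_sqrt by lra.
assert (H : y t * y t + w t * w t / p t <= y s * y s + w s * w s / p s).
{ apply (derive_nonpos_ge (fun t => y t * y t + w t * w t / p t)
    (fun t => - (p' t * (w t / p t) ^ 2)) s t); [lra | |].
  - intros x Hx. pose proof (Hb x ltac:(lra)). eapply is_derive_val.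
    + apply (is_derive_plus (fun t => y t * y t) (fun t => w t * w t / p t)).
      * apply is_derive_Rmult; auto.
      * apply (is_derive_div (fun t => w t * w t) p); [|apply Hd; lra|lra].
        apply is_derive_Rmult; auto.
    + unfold plus; cbn. field. lra.
  - intros x Hx. specialize (Hn x ltac:(lra)). pose proof (pow2_ge_0 (w x / p x)). nra. }
pose proof (Hb t ltac:(lra)) as Ht. pose proof (Hb s ltac:(lra)) as Hs'.
assert (H1 : w t * w t / om ^ 2 <= w t * w t / p t).
{ apply Rmult_le_compat_l; [nra|]. apply Rinv_le_contravar; lra. }
assert (H2 : w s * w s / p s <= w s * w s / h).
{ apply Rmult_le_compat_l; [nra|]. apply Rinv_le_contravar; lra. }
assert (H3 : y t * y t + w t * w t / om ^ 2 <= y s * y s + w s * w s / h) by lra.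
apply (Rmult_le_compat_l (om ^ 2)) in H3; [|nra].
replace (om ^ 2 * (y t * y t + w t * w t / om ^ 2)) with (w t ^ 2 + om ^ 2 * y t ^ 2) in H3
  by (field; lra).
replace (om ^ 2 * (y s * y s + w s * w s / h))
  with (om ^ 2 / h * w s ^ 2 + om ^ 2 * y s ^ 2) in H3 by (field; lra).
exact H3.
Qed.

Lemma energy_bound_values (p y w : R -> R) (T om a b c s t : R) :
  0 < om -> energy_bound p T om a b -> ode_sol p y w -> 0 <= s <= t -> t <= T ->
  0 <= c -> a ^ 2 * w s ^ 2 + b ^ 2 * y s ^ 2 <= c ^ 2 ->
  Rabs (y t) <= c / om /\ Rabs (w t) <= c.
Proof.
intros Hom HE HS Hst HT Hc0 Hc. pose proof (HE y w s t HS Hst HT) as H.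
assert (0 <= om ^ 2 * y t ^ 2) by nra. split.
- apply sqr_le_abs.
  + apply Rmult_le_pos; [auto | left; apply Rinv_0_lt_compat; auto].
  + apply Rmult_le_reg_l with (om ^ 2); [nra|].
    replace (om ^ 2 * (c / om) ^ 2) with (c ^ 2) by (field; lra).
    pose proof (pow2_ge_0 (w t)). lra.
- apply sqr_le_abs; nra.
Qed.

(* With [U(s)] the solution of the [r]-equation that has Cauchy data (0,1) or (1,0) at [K],
   the Wronskian of [y] and [U] has derivative [(q - r) y U]. *)
Lemma fundamental_comparison (q r g g' y1 w1 y2 w2 u1 v1 u2 v2 : R -> R) (K om a b : R) :
  0 <= K -> 0 < om -> 0 <= a -> 0 <= b ->
  fundamental q y1 w1 y2 w2 -> fundamental r u1 v1 u2 v2 ->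
  energy_bound q K om a b -> energy_bound r K om a b ->
  (forall t, 0 <= t <= K -> is_derive g t (g' t)) ->
  (forall t, 0 <= t <= K -> Rabs (q t - r t) <= g' t) ->
  Rabs (4 * (y1 K * w2 K) - 4 * (u1 K * v2 K)) <= 8 * (a ^ 2 * b / om ^ 2) * (g K - g 0).
Proof.
intros HK Hom Ha Hb Fy Fu Eq Er Hg Hqr.
pose proof Fy as [Sy1 [Sy2 [A1 [A2 [A3 A4]]]]].
pose proof Fu as [Su1 [Su2 [B1 [B2 [B3 B4]]]]].
assert (By1 : forall t, 0 <= t <= K -> Rabs (y1 t) <= b / om).
{ intros t Ht. apply (energy_bound_values q y1 w1 K om a b b 0 t); auto; try lra.
  rewrite A1, A2. nra. }
assert (By2 : forall t, 0 <= t <= K -> Rabs (y2 t) <= a / om /\ Rabs (w2 t) <= a).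
{ intros t Ht. apply (energy_bound_values q y2 w2 K om a b a 0 t); auto; try lra.
  rewrite A3, A4. nra. }
assert (Bu1 : Rabs (u1 K) <= b / om).
{ apply (energy_bound_values r u1 v1 K om a b b 0 K); auto; try lra.
  rewrite B1, B2. nra. }
(* Energy bounds propagate only forward, while these solutions have their data at [K]. Up to sign,
   their values at [s] are the value and the derivative at [K] of the solution with data (0,1) at
   [s], for which the bound runs from [s] to [K]. *)
assert (BG : forall s, 0 <= s <= K ->
   Rabs (u1 K * u2 s + - u2 K * u1 s) <= a / om /\ Rabs (v2 K * u1 s + - v1 K * u2 s) <= a).
{ intros s Hs.
  pose proof (ode_sol_lin r u1 v1 u2 v2 (- u2 s) (u1 s) Su1 Su2) as SG.
  pose proof (energy_bound_values r _ _ K om a b a s K Hom Er SG Hs (Rle_refl K) Ha) as H.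
  cbv beta in H.
  replace (- u2 s * u1 s + u1 s * u2 s) with 0 in H by ring.
  replace (- u2 s * v1 s + u1 s * v2 s) with 1 in H
    by (pose proof (fundamental_wronskian r u1 v1 u2 v2 s Fu); lra).
  destruct H as [H1 H2]; [lra|]. split.
  - rewrite <- Rabs_Ropp. eapply Rle_trans; [right|exact H1]. f_equal. ring.
  - eapply Rle_trans; [right|exact H2]. f_equal. ring. }
pose proof (fundamental_wronskian r u1 v1 u2 v2 K Fu) as HW.
assert (Hc : 0 <= a / om) by (apply Rmult_le_pos; [auto | left; apply Rinv_0_lt_compat; auto]).
assert (Hd : 0 <= b / om) by (apply Rmult_le_pos; [auto | left; apply Rinv_0_lt_compat; auto]).
assert (HI : 0 <= g K - g 0).
{ enough (g 0 <= g K) by lra. apply (derive_nonneg_le g g'); auto.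
  intros t Ht. eapply Rle_trans; [apply Rabs_pos | apply Hqr; auto]. }
assert (Main : forall y w U V m1 m2, ode_sol q y w -> ode_sol r U V ->
   0 <= m1 -> 0 <= m2 ->
   (forall t, 0 <= t <= K -> Rabs (y t) <= m1) -> (forall t, 0 <= t <= K -> Rabs (U t) <= m2) ->
   Rabs ((y K * V K - w K * U K) - (y 0 * V 0 - w 0 * U 0)) <= m1 * m2 * g K - m1 * m2 * g 0).
{ intros y w U V m1 m2 S1 S2 Hm1 Hm2 M1 M2.
  apply (increment_bound (fun t => y t * V t - w t * U t)
    (fun t => (q t - r t) * (y t * U t)) (fun t => m1 * m2 * g t) (fun t => m1 * m2 * g' t)); auto.
  - intros t _. apply wronskian_derive; auto.
  - intros t Ht. apply is_derive_scal; auto.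
  - intros t Ht. rewrite !Rabs_mult, (Rmult_comm (Rabs _)).
    apply Rmult_le_compat; auto using Rabs_pos.
    + apply Rmult_le_pos; apply Rabs_pos.
    + apply Rmult_le_compat; auto using Rabs_pos. }
(* With data (0,1) at [K] for the second solution, the Wronskian equals [y1 K] at [K] and [u1 K] at
   0. In [D2], data (1,0) give [- w2 K] and [- v2 K]. *)
assert (D1 : Rabs (y1 K - u1 K) <= b / om * (a / om) * (g K - g 0)).
{ pose proof (Main y1 w1 _ _ (b / om) (a / om) Sy1
    (ode_sol_lin r u2 v2 u1 v1 (u1 K) (- u2 K) Su2 Su1) Hd Hc By1
    (fun t Ht => proj1 (BG t Ht))) as H. cbv beta in H.
  rewrite A1, A2, B2, B4 in H.
  replace (u1 K * v2 K + - u2 K * v1 K) with 1 in H by lra.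
  replace (u1 K * u2 K + - u2 K * u1 K) with 0 in H by ring.
  replace (y1 K * 1 - w1 K * 0 - (1 * (u1 K * 1 + - u2 K * 0) - 0 * (u1 K * u2 0 + - u2 K * u1 0)))
    with (y1 K - u1 K) in H by ring. lra. }
assert (D2 : Rabs (w2 K - v2 K) <= a / om * a * (g K - g 0)).
{ pose proof (Main y2 w2 _ _ (a / om) a Sy2
    (ode_sol_lin r u1 v1 u2 v2 (v2 K) (- v1 K) Su1 Su2) Hc Ha
    (fun t Ht => proj1 (By2 t Ht)) (fun t Ht => proj2 (BG t Ht))) as H. cbv beta in H.
  rewrite A3, A4, B1, B3 in H.
  replace (v2 K * v1 K + - v1 K * v2 K) with 0 in H by ring.
  replace (v2 K * u1 K + - v1 K * u2 K) with 1 in H by lra.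
  rewrite <- Rabs_Ropp.
  replace (y2 K * 0 - w2 K * 1 - (0 * (v2 K * v1 0 + - v1 K * v2 0) - 1 * (v2 K * 1 + - v1 K * 0)))
    with (- (w2 K - v2 K)) in H by ring. lra. }
(* Each of the two terms contributes [a^2 b / om^2] times the increment of [g], whence the factor
   8. *)
replace (4 * (y1 K * w2 K) - 4 * (u1 K * v2 K))
  with (4 * ((y1 K - u1 K) * w2 K + u1 K * (w2 K - v2 K))) by ring.
rewrite Rabs_mult, (Rabs_pos_eq 4) by lra.
apply Rle_trans with (4 * (b / om * (a / om) * (g K - g 0) * a + b / om * (a / om * a * (g K - g 0)))).
- apply Rmult_le_compat_l; [lra|].
  eapply Rle_trans; [apply Rabs_triang|]. rewrite !Rabs_mult.
  apply Rplus_le_compat; apply Rmult_le_compat; auto using Rabs_pos.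
  apply By2. lra.
- right. field. lra.
Qed.

(** * The sech and Lame potentials on a quarter period *)

Definition sech_potential (om lam : R) (t : R) : R := om ^ 2 + lam * / cosh t ^ 2.

Lemma sech_potential_derive (om lam t : R) :
  is_derive (sech_potential om lam) t (- (2 * lam * (tanh t * / cosh t ^ 2))).
Proof.
apply (is_derive_ext (fun t => om ^ 2 + lam * (1 - tanh t * tanh t))).
{ intros s. unfold sech_potential. rewrite <- tanh_sqr. cbn. ring. }
eapply is_derive_val.
- apply (is_derive_plus (fun _ => om ^ 2) (fun t => lam * (1 - tanh t * tanh t))).
  + apply (is_derive_const (K := R_AbsRing) (V := R_NormedModule)).
  + apply is_derive_scal. apply (is_derive_minus (fun _ => 1) (fun t => tanh t * tanh t)).
    * apply (is_derive_const (K := R_AbsRing) (V := R_NormedModule)).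
    * apply is_derive_Rmult; apply tanh_derive.
- unfold minus, plus, opp, zero; cbn. ring.
Qed.

Lemma sech_sqr_range (t : R) : 0 < / cosh t ^ 2 <= 1.
Proof.
split; [apply Rinv_0_lt_compat, pow_lt, cosh_pos|].
rewrite <- tanh_sqr. pose proof (pow2_ge_0 (tanh t)). lra.
Qed.

Lemma sech_potential_energy (om lam T : R) :
  0 < om ->
  (0 <= lam -> energy_bound (sech_potential om lam) T om 1 (sqrt (om ^ 2 + lam))) /\
  (lam <= 0 -> 0 < om ^ 2 + lam ->
    energy_bound (sech_potential om lam) T om (om / sqrt (om ^ 2 + lam)) om).
Proof.
intros Hom.
assert (Hs : forall t, 0 <= t <= T -> 0 <= tanh t * / cosh t ^ 2).
{ intros t Ht. apply Rmult_le_pos; [apply tanh_nonneg; lra | left; apply sech_sqr_range]. }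
split; intros Hl; [|intros Hh].
- apply (energy_bound_nonincreasing _ (fun t => - (2 * lam * (tanh t * / cosh t ^ 2)))).
  + nra.
  + intros; apply sech_potential_derive.
  + intros t Ht. specialize (Hs t Ht). nra.
  + intros t Ht. unfold sech_potential. pose proof (sech_sqr_range t). nra.
- apply (energy_bound_nondecreasing _ (fun t => - (2 * lam * (tanh t * / cosh t ^ 2)))); auto.
  + intros; apply sech_potential_derive.
  + intros t Ht. specialize (Hs t Ht). nra.
  + intros t Ht. unfold sech_potential. pose proof (sech_sqr_range t). nra.
Qed.

Lemma lame_potential_derive (h nu k t : R) :
  0 < k < 1 ->
  is_derive (lame_potential h nu k) t
    (- (2 * (nu * (nu + 1)) * k ^ 2 *
       (jacobi_sn t k * (cos (jacobi_am t k) * delta k (jacobi_am t k))))).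
Proof.
intros Hk.
apply (is_derive_ext (fun t => h - nu * (nu + 1) * k ^ 2 * (jacobi_sn t k * jacobi_sn t k))).
{ intros s. unfold lame_potential. refine (_ : @eq R _ _). ring. }
eapply is_derive_val.
- apply (is_derive_minus (fun _ => h)
    (fun t => nu * (nu + 1) * k ^ 2 * (jacobi_sn t k * jacobi_sn t k))).
  + apply (is_derive_const (K := R_AbsRing) (V := R_NormedModule)).
  + apply is_derive_scal. apply is_derive_Rmult; apply sn_derive; auto.
- unfold minus, plus, opp, zero; cbn. ring.
Qed.

Lemma k2_sn2_range (k t : R) : 0 < k < 1 -> 0 <= k ^ 2 * jacobi_sn t k ^ 2 <= 1.
Proof. intros Hk. pose proof (sin_sqr_bound (jacobi_am t k)). unfold jacobi_sn. nra. Qed.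

(** On [[0, K]] the function [sn^2] increases, and the potential starts at [h] and stays between [h]
    and [om^2 = h - lam]. These are the monotonicity and the range of the sech potential, hence the
    same constants. *)
Lemma lame_potential_energy (h nu k om : R) :
  0 < k < 1 -> 0 < om -> om ^ 2 = h - nu * (nu + 1) ->
  (0 <= nu * (nu + 1) -> energy_bound (lame_potential h nu k) (ellK k) om 1 (sqrt h)) /\
  (nu * (nu + 1) <= 0 -> 0 < h ->
    energy_bound (lame_potential h nu k) (ellK k) om (om / sqrt h) om).
Proof.
intros Hk Hom Ho. set (lam := nu * (nu + 1)) in *.
assert (Hs : forall t, 0 <= t <= ellK k ->
  0 <= k ^ 2 * (jacobi_sn t k * (cos (jacobi_am t k) * delta k (jacobi_am t k)))).
{ intros t Ht. rewrite ellK_ellF in Ht by auto.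
  pose proof (am_quarter_range k t Hk Ht). pose proof PI_RGT_0.
  apply Rmult_le_pos; [nra|]. apply Rmult_le_pos; [apply sin_ge_0; lra|].
  apply Rmult_le_pos; [apply cos_ge_0; lra | left; apply delta_pos; auto]. }
assert (Hr : forall t, lame_potential h nu k t = h - lam * (k ^ 2 * jacobi_sn t k ^ 2)).
{ intros t. unfold lame_potential, lam. ring. }
split; intros Hl; [|intros Hh].
- eapply energy_bound_nonincreasing.
  + nra.
  + intros; apply lame_potential_derive; auto.
  + intros t Ht. specialize (Hs t Ht). fold lam. nra.
  + intros t Ht. rewrite Hr. pose proof (k2_sn2_range k t Hk). nra.
- eapply energy_bound_nondecreasing; auto.
  + intros; apply lame_potential_derive; auto.
  + intros t Ht. specialize (Hs t Ht). fold lam. nra.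
  + intros t Ht. rewrite Hr. pose proof (k2_sn2_range k t Hk). nra.
Qed.

(** The bound is left as [dn^2 - sech^2] because this is the derivative of
    [ellEinc k (am t) - tanh t]. *)
Lemma lame_sech_difference (h nu k om t : R) :
  0 < k < 1 -> om ^ 2 = h - nu * (nu + 1) -> 0 <= t <= ellK k ->
  Rabs (lame_potential h nu k t - sech_potential om (nu * (nu + 1)) t)
  <= Rabs (nu * (nu + 1)) * ((1 - k ^ 2 * jacobi_sn t k ^ 2) - / cosh t ^ 2).
Proof.
intros Hk Ho Ht. unfold lame_potential, sech_potential. rewrite Ho, <- tanh_sqr.
pose proof (k_sn_le_tanh k t Hk Ht).
replace (h - nu * (nu + 1) * k ^ 2 * jacobi_sn t k ^ 2 -
  (h - nu * (nu + 1) + nu * (nu + 1) * (1 - tanh t ^ 2)))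
  with (nu * (nu + 1) * (1 - k ^ 2 * jacobi_sn t k ^ 2 - (1 - tanh t ^ 2))) by ring.
rewrite Rabs_mult, (Rabs_pos_eq (1 - k ^ 2 * jacobi_sn t k ^ 2 - (1 - tanh t ^ 2))); [lra|].
nra.
Qed.

Lemma lame_bounded (h nu k t : R) :
  0 < k < 1 -> Rabs (lame_potential h nu k t) <= Rabs h + Rabs (nu * (nu + 1)).
Proof.
intros Hk. unfold lame_potential.
replace (h - nu * (nu + 1) * k ^ 2 * jacobi_sn t k ^ 2)
  with (h + - (nu * (nu + 1)) * (k ^ 2 * jacobi_sn t k ^ 2)) by ring.
eapply Rle_trans; [apply Rabs_triang|]. rewrite Rabs_mult, Rabs_Ropp.
pose proof (k2_sn2_range k t Hk).
rewrite (Rabs_pos_eq (k ^ 2 * jacobi_sn t k ^ 2)) by lra.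
pose proof (Rabs_pos (nu * (nu + 1))). nra.
Qed.

Lemma sech_fundamental_exists (om lam : R) :
  exists u1 v1 u2 v2, fundamental (sech_potential om lam) u1 v1 u2 v2.
Proof.
apply (fundamental_exists _ (om ^ 2 + Rabs lam)).
- intros t. eapply is_derive_continuous, sech_potential_derive.
- intros t. unfold sech_potential. eapply Rle_trans; [apply Rabs_triang|].
  rewrite Rabs_mult. pose proof (sech_sqr_range t).
  rewrite (Rabs_pos_eq (om ^ 2)), (Rabs_pos_eq (/ cosh t ^ 2)); try nra.
  pose proof (Rabs_pos lam). nra.
Qed.

Lemma ellK_pos (k : R) : 0 < k < 1 -> 0 < ellK k.
Proof.
intros Hk. rewrite ellK_ellF by auto. pose proof PI_RGT_0.
pose proof (ellF_expand k 0 (PI / 2) Hk ltac:(lra)) as H1. rewrite ellF_0 in H1. lra.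
Qed.

Lemma lameD_sech_comparison (h nu k om a b : R) (u1 v1 u2 v2 : R -> R) :
  0 < k < 1 -> 0 < om -> om ^ 2 = h - nu * (nu + 1) -> 0 <= a -> 0 <= b ->
  fundamental (sech_potential om (nu * (nu + 1))) u1 v1 u2 v2 ->
  energy_bound (lame_potential h nu k) (ellK k) om a b ->
  energy_bound (sech_potential om (nu * (nu + 1))) (ellK k) om a b ->
  Rabs (lameD h nu k - (4 * (u1 (ellK k) * v2 (ellK k)) - 2))
  <= 8 * (a ^ 2 * b / om ^ 2) * (Rabs (nu * (nu + 1)) * (ellE k - tanh (ellK k))).
Proof.
intros Hk Hom Ho Ha Hb Fu Eq Er.
destruct (fundamental_exists (lame_potential h nu k) (Rabs h + Rabs (nu * (nu + 1))))
  as [y1 [w1 [y2 [w2 Fy]]]].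
{ intros t. eapply is_derive_continuous, lame_potential_derive; auto. }
{ intros t. apply lame_bounded; auto. }
pose proof (ellK_pos k Hk) as HK.
unfold lameD. rewrite (hill_discriminant_even _ y1 w1 y2 w2); auto.
2:{ intros t. unfold lame_potential. rewrite sn_sqr_opp; auto. }
2:{ intros t. unfold lame_potential. rewrite sn_sqr_shift; auto. }
(* [g] is the explicit antiderivative of the bound on the difference of the potentials;
   [am K = PI / 2] turns its increment into [E - tanh K]. *)
set (g := fun t => Rabs (nu * (nu + 1)) * (ellEinc k (jacobi_am t k) - tanh t)).
replace (Rabs (nu * (nu + 1)) * (ellE k - tanh (ellK k))) with (g (ellK k) - g 0).
2:{ unfold g. rewrite am_0, ellEinc_0, tanh_0, ellE_ellEinc by auto.
    rewrite (ellK_ellF k Hk) at 1. rewrite am_ellF by auto. ring. }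
replace (4 * (y1 (ellK k) * w2 (ellK k)) - 2 - (4 * (u1 (ellK k) * v2 (ellK k)) - 2))
  with (4 * (y1 (ellK k) * w2 (ellK k)) - 4 * (u1 (ellK k) * v2 (ellK k))) by ring.
apply (fundamental_comparison (lame_potential h nu k) (sech_potential om (nu * (nu + 1))) g
   (fun t => Rabs (nu * (nu + 1)) * ((1 - k ^ 2 * jacobi_sn t k ^ 2) - / cosh t ^ 2))
   y1 w1 y2 w2 u1 v1 u2 v2); auto; [lra | |].
- intros t _. apply is_derive_scal.
  apply (is_derive_minus (fun t => ellEinc k (jacobi_am t k)) tanh).
  + apply ellEinc_am_derive; auto.
  + apply tanh_derive.
- intros t Ht. apply lame_sech_difference; auto.
Qed.

(** * Amplitudes at infinity and the ladder operator *)

(** Componentwise, to match the definition of [Cgamma] by separate limits of real and imaginary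
    parts. *)
Definition Cconv (u : nat -> C) (l : C) : Prop :=
  is_lim_seq (fun n => Re (u n)) (Re l) /\ is_lim_seq (fun n => Im (u n)) (Im l).

Lemma Cconv_ext (u v : nat -> C) (l : C) : (forall n, u n = v n) -> Cconv u l -> Cconv v l.
Proof.
intros H [H1 H2]. split.
- apply (is_lim_seq_ext (fun n => Re (u n))); auto. intros n; rewrite H; auto.
- apply (is_lim_seq_ext (fun n => Im (u n))); auto. intros n; rewrite H; auto.
Qed.

Lemma Cconv_const (c : C) : Cconv (fun _ => c) c.
Proof. split; apply is_lim_seq_const. Qed.

Lemma Cconv_plus (u v : nat -> C) (a b : C) :
  Cconv u a -> Cconv v b -> Cconv (fun n => u n + v n)%C (a + b)%C.
Proof. intros [H1 H2] [H3 H4]. split; apply is_lim_seq_plus'; auto. Qed.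

Lemma Cconv_mult (u v : nat -> C) (a b : C) :
  Cconv u a -> Cconv v b -> Cconv (fun n => u n * v n)%C (a * b)%C.
Proof.
intros [H1 H2] [H3 H4]. split.
- apply is_lim_seq_minus'; apply is_lim_seq_mult'; auto.
- apply is_lim_seq_plus'; apply is_lim_seq_mult'; auto.
Qed.

Lemma Cconv_unique (u : nat -> C) (a b : C) : Cconv u a -> Cconv u b -> a = b.
Proof.
intros [H1 H2] [H3 H4].
apply is_lim_seq_unique in H1, H2, H3, H4.
rewrite H1 in H3. rewrite H2 in H4.
destruct a, b. cbn in *. congruence.
Qed.

Lemma Cconv_shift (u : nat -> C) (l : C) : Cconv u l <-> Cconv (fun n => u (S n)) l.
Proof.
split; intros [H1 H2]; split.
- apply (is_lim_seq_incr_1 (fun n => Re (u n))); auto.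
- apply (is_lim_seq_incr_1 (fun n => Im (u n))); auto.
- apply (is_lim_seq_incr_1 (fun n => Re (u n))) in H1; auto.
- apply (is_lim_seq_incr_1 (fun n => Im (u n))) in H2; auto.
Qed.

Lemma Re_le_Cmod (z : C) : Rabs (Re z) <= Cmod z.
Proof.
apply sqr_le_abs; [apply Cmod_ge_0|]. rewrite Cmod_sqr. pose proof (pow2_ge_0 (Im z)). lra.
Qed.

Lemma Im_le_Cmod (z : C) : Rabs (Im z) <= Cmod z.
Proof.
apply sqr_le_abs; [apply Cmod_ge_0|]. rewrite Cmod_sqr. pose proof (pow2_ge_0 (Re z)). lra.
Qed.

Lemma Cmod_le_sqr (z : C) (c : R) : 0 <= c -> Re z ^ 2 + Im z ^ 2 <= c ^ 2 -> Cmod z <= c.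
Proof.
intros Hc H. rewrite <- Cmod_sqr in H. pose proof (Cmod_ge_0 z).
rewrite <- (Rabs_pos_eq (Cmod z)) by auto. apply sqr_le_abs; auto.
Qed.

Lemma Cconv_of_bound (u : nat -> C) (l : C) (e : nat -> R) :
  (forall n, Cmod (u n - l)%C <= e n) -> is_lim_seq e 0 -> Cconv u l.
Proof.
intros H He.
assert (G : forall p : C -> R, (forall z w : C, p (z - w)%C = p z - p w) ->
   (forall z, Rabs (p z) <= Cmod z) -> is_lim_seq (fun n => p (u n)) (p l)).
{ intros p Hp Hle.
  apply (is_lim_seq_le_le (fun n => p l - e n) _ (fun n => p l + e n)).
  - intros n. specialize (H n). specialize (Hle (u n - l)%C). rewrite Hp in Hle.
    assert (Hc : Rabs (p (u n) - p l) <= e n) by lra. apply Rabs_le_between in Hc. lra.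
  - replace (Finite (p l)) with (Finite (p l - 0)) by (f_equal; ring).
    apply is_lim_seq_minus'; auto. apply is_lim_seq_const.
  - replace (Finite (p l)) with (Finite (p l + 0)) by (f_equal; ring).
    apply is_lim_seq_plus'; auto. apply is_lim_seq_const. }
split; apply G; auto using Re_le_Cmod, Im_le_Cmod.
Qed.

Lemma Cconv_Cmod_le (u : nat -> C) (l c : C) (M : R) (N : nat) :
  Cconv u l -> (forall n, (N <= n)%nat -> Cmod (u n - c)%C <= M) -> Cmod (l - c)%C <= M.
Proof.
intros Hu Hb.
assert (HM : 0 <= M) by (eapply Rle_trans; [apply Cmod_ge_0 | apply (Hb N (le_n N))]).
pose proof (Cconv_plus u (fun _ => Copp c) l (Copp c) Hu (Cconv_const _)) as [H1 H2].
apply Cmod_le_sqr; auto.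
assert (H3 : is_lim_seq (fun n => Re (u n - c)%C * Re (u n - c)%C + Im (u n - c)%C * Im (u n - c)%C)
   (Re (l - c)%C * Re (l - c)%C + Im (l - c)%C * Im (l - c)%C)).
{ apply is_lim_seq_plus'; apply is_lim_seq_mult'; auto. }
apply (is_lim_seq_incr_n _ N) in H3.
assert (H4 : Rbar_le (Re (l - c)%C * Re (l - c)%C + Im (l - c)%C * Im (l - c)%C) (M ^ 2)).
{ eapply (is_lim_seq_le _ (fun _ => M ^ 2)); [|exact H3|apply is_lim_seq_const].
  intros n. cbv beta. specialize (Hb (n + N)%nat ltac:(lia)).
  pose proof (Cmod_sqr (u (n + N)%nat - c)%C). pose proof (Cmod_ge_0 (u (n + N)%nat - c)%C).
  nra. }
cbn [Rbar_le] in H4. lra.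
Qed.

Lemma Cconv_of_cauchy (u : nat -> C) (g : nat -> R) (c : R) :
  0 <= c -> ex_finite_lim_seq g ->
  (forall n m, (n <= m)%nat -> Cmod (u m - u n)%C <= c * (g m - g n)) -> exists l, Cconv u l.
Proof.
intros Hc Hg H. apply ex_lim_seq_cauchy_corr in Hg.
assert (G : forall p : C -> R, (forall z w : C, p (z - w)%C = p z - p w) ->
   (forall z, Rabs (p z) <= Cmod z) -> exists l : R, is_lim_seq (fun n => p (u n)) l).
{ intros p Hp Hle. apply ex_lim_seq_cauchy_corr. intros eps.
  (* [c + 1] instead of [c] because [c] may be 0. *)
  assert (He : 0 < eps / (c + 1)).
  { apply Rdiv_lt_0_compat; [apply eps | lra]. }
  destruct (Hg (mkposreal _ He)) as [N HN]. cbn in HN. exists N.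
  assert (K : forall n m, (N <= n)%nat -> (n <= m)%nat -> Rabs (p (u m) - p (u n)) < eps).
  { intros n m Hn Hm. rewrite <- Hp. eapply Rle_lt_trans; [apply Hle|].
    eapply Rle_lt_trans; [apply H; auto|].
    specialize (HN m n ltac:(lia) Hn).
    pose proof (Rle_abs (g m - g n)). pose proof (Rabs_pos (g m - g n)).
    apply Rle_lt_trans with (c * Rabs (g m - g n)).
    - apply Rmult_le_compat_l; auto.
    - replace (pos eps) with ((c + 1) * (eps / (c + 1))) by (field; lra).
      apply Rle_lt_trans with ((c + 1) * Rabs (g m - g n)); [nra|].
      apply Rmult_lt_compat_l; lra. }
  intros n m Hn Hm. destruct (Nat.le_ge_cases n m) as [L|L].
  - rewrite Rabs_minus_sym. apply K; auto.
  - apply K; auto. }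
destruct (G Re) as [a Ha]; auto using Re_le_Cmod.
destruct (G Im) as [b Hb]; auto using Im_le_Cmod.
exists (a, b). split; auto.
Qed.

Lemma tanh_le (s t : R) : s <= t -> tanh s <= tanh t.
Proof.
intros Ht. apply (derive_nonneg_le tanh (fun t => / cosh t ^ 2)); auto.
- intros; apply tanh_derive.
- intros x _. left. apply sech_sqr_range.
Qed.

Lemma tanh_seq_converges : ex_finite_lim_seq (fun n => tanh (INR n)).
Proof.
apply (ex_finite_lim_seq_incr _ 1).
- intros n. apply tanh_le. rewrite S_INR. lra.
- intros n. left. apply tanh_lt_1.
Qed.

(** The limit equation with a complex parameter: [z = i om] gives the sech potential, and the ladder
    moves [z] off the imaginary axis while [lam] stays fixed. *)
Definition csol (lam : R) (z : C) (y w : R -> C) : Prop :=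
  (forall t, is_Cderive y t (w t)) /\
  (forall t, is_Cderive w t ((z * z - RtoC (lam * / cosh t ^ 2)) * y t)%C).

(* Written [p exp (z t) + q exp (- z t)], a solution of [y'' = z^2 y] has [amp = 2 z p]
   and [coamp = - 2 z q exp (- 2 z t)]. *)
Definition amp (z : C) (y w : R -> C) (t : R) : C :=
  ((w t + z * y t) * Cexp (- (z * RtoC t)))%C.

Definition coamp (z : C) (y w : R -> C) (t : R) : C :=
  ((w t - z * y t) * Cexp (- (z * RtoC t)))%C.

Lemma Cexp_lin_derive (z : C) (t : R) :
  is_Cderive (fun t => Cexp (- (z * RtoC t))%C) t (- z * Cexp (- (z * RtoC t)))%C.
Proof.
apply is_Cderive_Cexp. split; cbn; auto_derive; auto; unfold Re, Im; ring.
Qed.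

Lemma amp_split (z : C) (y w : R -> C) (t : R) :
  z <> RtoC 0 -> (y t * Cexp (- (z * RtoC t)) = (amp z y w t - coamp z y w t) / (2 * z))%C.
Proof.
intros Hz. unfold amp, coamp. field. exact Hz.
Qed.

Lemma amp_derive (lam : R) (z : C) (y w : R -> C) (t : R) :
  csol lam z y w ->
  is_Cderive (amp z y w) t
    (- RtoC (lam * / cosh t ^ 2) * (y t * Cexp (- (z * RtoC t))))%C.
Proof.
intros [H1 H2]. eapply is_Cderive_val.
- apply (is_Cderive_mult (fun t => w t + z * y t)%C (fun t => Cexp (- (z * RtoC t))%C)).
  + apply (is_Cderive_plus w (fun t => z * y t)%C); [apply H2|].
    apply is_Cderive_scal. apply H1.
  + apply Cexp_lin_derive.
- cbv beta. ring.
Qed.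

Lemma coamp_derive (lam : R) (z : C) (y w : R -> C) (t : R) :
  csol lam z y w ->
  is_Cderive (coamp z y w) t
    (- (2 * z * coamp z y w t)
     - RtoC (lam * / cosh t ^ 2) * (y t * Cexp (- (z * RtoC t))))%C.
Proof.
intros [H1 H2].
apply (is_Cderive_ext (fun t => (w t + (- z) * y t) * Cexp (- (z * RtoC t)))%C).
{ intros s. unfold coamp. ring. }
eapply is_Cderive_val.
- apply (is_Cderive_mult (fun t => w t + (- z) * y t)%C (fun t => Cexp (- (z * RtoC t))%C)).
  + apply (is_Cderive_plus w (fun t => (- z) * y t)%C); [apply H2|].
    apply is_Cderive_scal. apply H1.
  + apply Cexp_lin_derive.
- cbv beta. unfold coamp. ring.
Qed.

Lemma is_derive_Cmod_sqr (f : R -> C) (t : R) (l : C) :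
  is_Cderive f t l ->
  is_derive (fun t => Cmod (f t) ^ 2) t (2 * (Re (f t) * Re l + Im (f t) * Im l)).
Proof.
intros [H1 H2].
apply (is_derive_ext (fun t => Re (f t) * Re (f t) + Im (f t) * Im (f t))).
{ intros s. rewrite Cmod_sqr. refine (_ : @eq R _ _). ring. }
eapply is_derive_val.
- apply (is_derive_plus (fun t => Re (f t) * Re (f t)) (fun t => Im (f t) * Im (f t)));
  apply is_derive_Rmult; eassumption.
- refine (_ : @eq R _ _). unfold plus; cbn. unfold Re, Im. ring.
Qed.

Lemma parallelogram (u v : C) :
  Cmod (u + v)%C ^ 2 + Cmod (u - v)%C ^ 2 = 2 * (Cmod u ^ 2 + Cmod v ^ 2).
Proof. rewrite !Cmod_sqr. unfold Re, Im; cbn. ring. Qed.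

Lemma exp_ge_1 (x : R) : 0 <= x -> 1 <= exp x.
Proof. intros H. pose proof (exp_ineq1_le x). lra. Qed.

Lemma Cmod_2 : Cmod 2 = 2.
Proof. rewrite Cmod_R. apply Rabs_pos_eq. lra. Qed.

Lemma Cmod_pos (z : C) : z <> RtoC 0 -> 0 < Cmod z.
Proof. apply Cmod_gt_0. Qed.

Definition amp_energy (z : C) (y w : R -> C) (t : R) : R :=
  Cmod (amp z y w t) ^ 2 + Cmod (coamp z y w t) ^ 2.

Lemma C2z_neq_0 (z : C) : z <> RtoC 0 -> (2 * z)%C <> RtoC 0.
Proof.
intros Hz. apply Cmult_neq_0; auto. intros H. injection H. lra.
Qed.

Lemma Cmod_normalized (z : C) (y w : R -> C) (t : R) :
  z <> RtoC 0 ->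
  Cmod (y t * Cexp (- (z * RtoC t)))%C = Cmod (amp z y w t - coamp z y w t)%C / (2 * Cmod z).
Proof.
intros Hz. rewrite (amp_split z y w t Hz), Cmod_div, Cmod_mult, Cmod_2 by (apply C2z_neq_0; exact Hz).
reflexivity.
Qed.

(** The free motion contributes [- 4 Re z |coamp|^2 <= 0], which is where [Re z >= 0] enters. The
    coupling through the potential is at most [x sech^2] times the energy, with [x = |lam| / |z|].
    Gronwall with the integrating factor [exp (- x tanh)] and [tanh < 1] then gives a bound uniform
    in [t]. *)
Lemma amp_energy_bound (lam : R) (z : C) (y w : R -> C) (t : R) :
  csol lam z y w -> z <> RtoC 0 -> 0 <= Re z -> 0 <= t ->
  amp_energy z y w t <= amp_energy z y w 0 * exp (Rabs lam / Cmod z).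
Proof.
intros HS Hz Hre Ht.
pose proof (Cmod_pos z Hz) as Hm.
set (x := Rabs lam / Cmod z).
assert (Hx : 0 <= x).
{ apply Rmult_le_pos; [apply Rabs_pos | left; apply Rinv_0_lt_compat; auto]. }
assert (He0 : forall s, 0 <= amp_energy z y w s).
{ intros s. unfold amp_energy. pose proof (pow2_ge_0 (Cmod (amp z y w s))).
  pose proof (pow2_ge_0 (Cmod (coamp z y w s))). lra. }
set (p := fun s => (y s * Cexp (- (z * RtoC s)))%C).
set (sg := fun s => lam * / cosh s ^ 2).
set (e' := fun s =>
   2 * (Re (amp z y w s) * Re (- RtoC (sg s) * p s)%C + Im (amp z y w s) * Im (- RtoC (sg s) * p s)%C)
 + 2 * (Re (coamp z y w s) * Re (- (2 * z * coamp z y w s) - RtoC (sg s) * p s)%C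
      + Im (coamp z y w s) * Im (- (2 * z * coamp z y w s) - RtoC (sg s) * p s)%C)).
assert (Hd : forall s, is_derive (amp_energy z y w) s (e' s)).
{ intros s. apply (is_derive_plus (fun s => Cmod (amp z y w s) ^ 2)
    (fun s => Cmod (coamp z y w s) ^ 2)); apply is_derive_Cmod_sqr.
  - apply (amp_derive lam); auto.
  - apply (coamp_derive lam); auto. }
assert (Hb : forall s, e' s <= x * / cosh s ^ 2 * amp_energy z y w s).
{ intros s. pose proof (sech_sqr_range s) as Hsech.
  assert (Hp : Cmod (p s) = Cmod (amp z y w s - coamp z y w s)%C / (2 * Cmod z))
    by (apply Cmod_normalized; auto).
  pose proof (parallelogram (amp z y w s) (coamp z y w s)) as HP.
  fold (amp_energy z y w s) in HP.
  assert (E : e' s = - 4 * Re z * Cmod (coamp z y w s) ^ 2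
     - 2 * sg s * (Re (amp z y w s + coamp z y w s)%C * Re (p s)
                  + Im (amp z y w s + coamp z y w s)%C * Im (p s))).
  { unfold e'. rewrite Cmod_sqr. unfold Re, Im; cbn. ring. }
  rewrite E. pose proof (re_dot_le (amp z y w s + coamp z y w s)%C (p s)) as HD.
  rewrite Hp in HD.
  set (A := Cmod (amp z y w s + coamp z y w s)%C) in *.
  set (B := Cmod (amp z y w s - coamp z y w s)%C) in *.
  set (d := Re (amp z y w s + coamp z y w s)%C * Re (p s)
      + Im (amp z y w s + coamp z y w s)%C * Im (p s)) in *.
  assert (Hsd : - 2 * sg s * d <= 2 * (Rabs lam * / cosh s ^ 2) * (A * (B / (2 * Cmod z)))).
  { eapply Rle_trans; [apply Rle_abs|]. unfold sg. rewrite !Rabs_mult.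
    rewrite (Rabs_pos_eq (/ cosh s ^ 2)) by lra.
    replace (Rabs (-2)) with 2 by (rewrite Rabs_left; lra).
    apply Rmult_le_compat_l; auto.
    apply Rmult_le_pos; [lra|]. apply Rmult_le_pos; [apply Rabs_pos | lra]. }
  replace (2 * (Rabs lam * / cosh s ^ 2) * (A * (B / (2 * Cmod z))))
    with (x * / cosh s ^ 2 * (A * B)) in Hsd by
      (unfold x; field; pose proof (cosh_pos s); lra).
  (* [A] and [B] are the moduli of sum and difference of [amp] and [coamp]; by the parallelogram law
     [A^2 + B^2] is twice the energy. *)
  assert (HAB : A * B <= amp_energy z y w s).
  { pose proof (pow2_ge_0 (A - B)). nra. }
  assert (0 <= x * / cosh s ^ 2) by (apply Rmult_le_pos; lra).
  assert (x * / cosh s ^ 2 * (A * B) <= x * / cosh s ^ 2 * amp_energy z y w s)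
    by (apply Rmult_le_compat_l; auto).
  pose proof (pow2_ge_0 (Cmod (coamp z y w s))). nra. }
assert (Hmono : amp_energy z y w t * exp (- x * tanh t) <= amp_energy z y w 0 * exp (- x * tanh 0)).
{ apply (derive_nonpos_ge (fun s => amp_energy z y w s * exp (- x * tanh s))
    (fun s => (e' s - x * / cosh s ^ 2 * amp_energy z y w s) * exp (- x * tanh s)) 0 t); auto.
  - intros s _. eapply is_derive_val.
    + apply is_derive_Rmult; [apply Hd|].
      apply (is_derive_comp exp (fun s => - x * tanh s)); [apply is_derive_exp|].
      apply is_derive_scal. apply tanh_derive.
    + unfold scal; cbn. unfold mult; cbn. ring.
  - intros s _. specialize (Hb s). pose proof (exp_pos (- x * tanh s)). nra. }
rewrite tanh_0, Rmult_0_r, exp_0, Rmult_1_r in Hmono.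
pose proof (exp_pos (- x * tanh t)) as Hp. pose proof (exp_pos (x * tanh t)) as Hp2.
assert (Hi : exp (- x * tanh t) * exp (x * tanh t) = 1).
{ rewrite <- exp_plus. replace (- x * tanh t + x * tanh t) with 0 by ring. apply exp_0. }
assert (Hle : exp (x * tanh t) <= exp x).
{ pose proof (tanh_lt_1 t). destruct (Req_dec x 0) as [->|Hx0].
  - right. f_equal. ring.
  - left. apply exp_increasing. nra. }
apply Rle_trans with (amp_energy z y w 0 * exp (x * tanh t)).
- replace (amp_energy z y w t)
    with (amp_energy z y w t * exp (- x * tanh t) * exp (x * tanh t))
    by (rewrite Rmult_assoc, Hi; ring).
  apply Rmult_le_compat_r; lra.
- apply Rmult_le_compat_l; auto.
Qed.

(** The normalization [2 c^2] fits the two solutions of interest: at 0 their [amp] and [coamp] agree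
    up to sign, so [c] is [|z|] for data (1,0) and 1 for data (0,1). *)
Lemma normalized_bound (lam c : R) (z : C) (y w : R -> C) (t : R) :
  csol lam z y w -> z <> RtoC 0 -> 0 <= Re z -> 0 <= t ->
  0 <= c -> amp_energy z y w 0 <= 2 * c ^ 2 ->
  Cmod (y t * Cexp (- (z * RtoC t)))%C <= c * exp (Rabs lam / Cmod z) / Cmod z.
Proof.
intros HS Hz Hre Ht Hc H0.
pose proof (Cmod_pos z Hz) as Hm.
pose proof (amp_energy_bound lam z y w t HS Hz Hre Ht) as HE.
set (x := Rabs lam / Cmod z) in *.
assert (Hx : 0 <= x).
{ apply Rmult_le_pos; [apply Rabs_pos | left; apply Rinv_0_lt_compat; auto]. }
pose proof (exp_ge_1 x Hx) as He.
rewrite (Cmod_normalized z y w t Hz).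
pose proof (parallelogram (amp z y w t) (coamp z y w t)) as HP.
fold (amp_energy z y w t) in HP.
pose proof (pow2_ge_0 (Cmod (amp z y w t + coamp z y w t)%C)).
assert (HB : Rabs (Cmod (amp z y w t - coamp z y w t)%C) <= 2 * c * exp x).
{ apply sqr_le_abs; [nra|].
  assert (amp_energy z y w 0 * exp x <= 2 * c ^ 2 * exp x) by (apply Rmult_le_compat_r; lra).
  assert (c ^ 2 * exp x <= c ^ 2 * exp x ^ 2) by (apply Rmult_le_compat_l; nra).
  nra. }
rewrite Rabs_pos_eq in HB by apply Cmod_ge_0.
apply Rmult_le_reg_r with (2 * Cmod z); [lra|]. field_simplify; [|lra|lra]. lra.
Qed.

Lemma amp_increment (lam c : R) (z : C) (y w : R -> C) (s t : R) :
  csol lam z y w -> z <> RtoC 0 -> 0 <= Re z -> 0 <= s <= t ->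
  0 <= c -> amp_energy z y w 0 <= 2 * c ^ 2 ->
  Cmod (amp z y w t - amp z y w s)%C
  <= Rabs lam / Cmod z * (c * exp (Rabs lam / Cmod z)) * (tanh t - tanh s).
Proof.
intros HS Hz Hre Hst Hc H0.
pose proof (Cmod_pos z Hz) as Hm.
set (k := Rabs lam / Cmod z * (c * exp (Rabs lam / Cmod z))).
replace (k * (tanh t - tanh s)) with (k * tanh t - k * tanh s) by ring.
apply (Cincrement_bound (amp z y w)
  (fun t => - RtoC (lam * / cosh t ^ 2) * (y t * Cexp (- (z * RtoC t))))%C
  (fun t => k * tanh t) (fun t => k * / cosh t ^ 2)); [lra | | |].
- intros x _. apply (amp_derive lam); auto.
- intros x _. apply is_derive_scal, tanh_derive.
- intros x Hx. pose proof (sech_sqr_range x) as Hsech.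
  rewrite Cmod_mult, Cmod_opp, Cmod_R, Rabs_mult, (Rabs_pos_eq (/ cosh x ^ 2)) by lra.
  pose proof (normalized_bound lam c z y w x HS Hz Hre ltac:(lra) Hc H0) as HB.
  pose proof (Rabs_pos lam).
  replace (k * / cosh x ^ 2) with
    (Rabs lam * / cosh x ^ 2 * (c * exp (Rabs lam / Cmod z) / Cmod z)).
  + apply Rmult_le_compat_l; auto. apply Rmult_le_pos; lra.
  + unfold k, Rdiv. ring.
Qed.

Lemma amp_converges (lam : R) (z : C) (y w : R -> C) :
  csol lam z y w -> z <> RtoC 0 -> 0 <= Re z ->
  exists l, Cconv (fun n => amp z y w (INR n)) l.
Proof.
intros HS Hz Hre.
(* Any [c] with initial energy at most [2 c^2] would do; [x <= 2 (x + 1)^2] for [x >= 0]. *)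
set (c := amp_energy z y w 0 + 1).
assert (He : 0 <= amp_energy z y w 0).
{ unfold amp_energy. pose proof (pow2_ge_0 (Cmod (amp z y w 0))).
  pose proof (pow2_ge_0 (Cmod (coamp z y w 0))). lra. }
apply (Cconv_of_cauchy _ (fun n => tanh (INR n))
  (Rabs lam / Cmod z * (c * exp (Rabs lam / Cmod z)))).
- pose proof (Cmod_pos z Hz). pose proof (exp_pos (Rabs lam / Cmod z)).
  apply Rmult_le_pos.
  + apply Rmult_le_pos; [apply Rabs_pos | left; apply Rinv_0_lt_compat; auto].
  + unfold c. nra.
- apply tanh_seq_converges.
- intros n m Hnm. apply (amp_increment lam); auto.
  + split; [apply pos_INR | apply le_INR; auto].
  + unfold c. lra.
  + unfold c. nra.
Qed.

Lemma amp_at_0 (z : C) (y w : R -> C) : amp z y w 0 = (w 0 + z * y 0)%C.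
Proof.
unfold amp. replace (Cexp (- (z * RtoC 0))%C) with (RtoC 1); [ring|].
unfold Cexp. rewrite Cmult_0_r. cbn. rewrite Ropp_0, exp_0, cos_0, sin_0.
apply injective_projections; cbn; ring.
Qed.

Lemma coamp_at_0 (z : C) (y w : R -> C) : coamp z y w 0 = (w 0 - z * y 0)%C.
Proof.
unfold coamp. replace (Cexp (- (z * RtoC 0))%C) with (RtoC 1); [ring|].
unfold Cexp. rewrite Cmult_0_r. cbn. rewrite Ropp_0, exp_0, cos_0, sin_0.
apply injective_projections; cbn; ring.
Qed.

Lemma amp_limit_estimate (lam c : R) (z l : C) (y w : R -> C) :
  csol lam z y w -> z <> RtoC 0 -> 0 <= Re z ->
  0 <= c -> amp_energy z y w 0 <= 2 * c ^ 2 ->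
  Cconv (fun n => amp z y w (INR n)) l ->
  Cmod (l - (w 0 + z * y 0))%C <= Rabs lam / Cmod z * (c * exp (Rabs lam / Cmod z)).
Proof.
intros HS Hz Hre Hc H0 Hl. rewrite <- amp_at_0.
apply (Cconv_Cmod_le _ l _ _ 0 Hl). intros n _.
pose proof (amp_increment lam c z y w 0 (INR n) HS Hz Hre
  (conj (Rle_refl 0) (pos_INR n)) Hc H0) as H.
eapply Rle_trans; [exact H|]. rewrite tanh_0, Rminus_0_r.
pose proof (tanh_lt_1 (INR n)). pose proof (Cmod_pos z Hz). pose proof (exp_pos (Rabs lam / Cmod z)).
assert (0 <= Rabs lam / Cmod z * (c * exp (Rabs lam / Cmod z))).
{ apply Rmult_le_pos; [|nra].
  apply Rmult_le_pos; [apply Rabs_pos | left; apply Rinv_0_lt_compat; auto]. }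
nra.
Qed.

(* [(y, w)] goes to [(g, g')] with [g = cosh * w + z sinh * y]: this is the ladder operator
   raising the order [z] of the associated Legendre equation by one. *)
Definition ladder_val (z : C) (y w : R -> C) (t : R) : C :=
  (RtoC (cosh t) * w t + z * RtoC (sinh t) * y t)%C.

Definition ladder_der (lam : R) (z : C) (y w : R -> C) (t : R) : C :=
  ((1 + z) * RtoC (sinh t) * w t
   + ((z * z + z) * RtoC (cosh t) - RtoC (lam * / cosh t)) * y t)%C.

Lemma RtoC_cosh_neq_0 (t : R) : RtoC (cosh t) <> RtoC 0.
Proof. intros H. apply RtoC_inj in H. pose proof (cosh_pos t). lra. Qed.

Lemma RtoC_sech (lam t : R) :
  RtoC (lam * / cosh t) = (RtoC lam / RtoC (cosh t))%C /\
  RtoC (lam * / cosh t ^ 2) = (RtoC lam / (RtoC (cosh t) * RtoC (cosh t)))%C.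
Proof.
pose proof (cosh_pos t). split.
- rewrite <- RtoC_div by lra. reflexivity.
- rewrite <- RtoC_mult, <- RtoC_div by nra. f_equal. field. lra.
Qed.

Lemma ladder_csol (lam : R) (z : C) (y w : R -> C) :
  csol lam z y w -> csol lam (z + 1)%C (ladder_val z y w) (ladder_der lam z y w).
Proof.
intros [H1 H2].
assert (Dc : forall t, is_Cderive (fun t => RtoC (cosh t)) t (RtoC (sinh t)))
  by (intros; apply is_Cderive_RtoC, cosh_derive).
assert (Ds : forall t, is_Cderive (fun t => RtoC (sinh t)) t (RtoC (cosh t)))
  by (intros; apply is_Cderive_RtoC, sinh_derive).
assert (Dh : forall t, is_Cderive (fun t => RtoC (lam * / cosh t)) t
   (RtoC (lam * (- sinh t / cosh t ^ 2)))).
{ intros t. apply is_Cderive_RtoC, is_derive_scal.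
  apply (is_derive_inv cosh); [apply cosh_derive | apply Rgt_not_eq, cosh_pos]. }
split; intros t; pose proof (RtoC_cosh_neq_0 t) as Hc; destruct (RtoC_sech lam t) as [E1 E2].
- eapply is_Cderive_val.
  + apply (is_Cderive_plus (fun t => RtoC (cosh t) * w t)%C (fun t => z * RtoC (sinh t) * y t)%C).
    * apply is_Cderive_mult; auto.
    * apply (is_Cderive_mult (fun t => z * RtoC (sinh t))%C y); auto.
      apply is_Cderive_scal; auto.
  + cbv beta. unfold ladder_der. rewrite E1, E2. field. auto.
- assert (E4 : RtoC (lam * (- sinh t / cosh t ^ 2))
      = (- (RtoC lam * RtoC (sinh t) / (RtoC (cosh t) * RtoC (cosh t))))%C).
  { pose proof (cosh_pos t).
    rewrite <- !RtoC_mult, <- RtoC_div, <- RtoC_opp by nra. f_equal. field. lra. }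
  eapply is_Cderive_val.
  + apply (is_Cderive_plus (fun t => (1 + z) * RtoC (sinh t) * w t)%C
      (fun t => ((z * z + z) * RtoC (cosh t) + - RtoC (lam * / cosh t)) * y t)%C).
    * apply (is_Cderive_mult (fun t => (1 + z) * RtoC (sinh t))%C w); auto.
      apply is_Cderive_scal; auto.
    * apply (is_Cderive_mult (fun t => (z * z + z) * RtoC (cosh t) + - RtoC (lam * / cosh t))%C y); auto.
      apply is_Cderive_plus; [apply is_Cderive_scal; auto|].
      apply (is_Cderive_ext (fun t => (- RtoC 1) * RtoC (lam * / cosh t))%C).
      { intros s. ring. }
      apply is_Cderive_scal. apply Dh.
  + cbv beta. unfold ladder_val. rewrite E4, E1, E2. field. auto.
Qed.

Lemma Cexp_plus (a b : C) : Cexp (a + b)%C = (Cexp a * Cexp b)%C.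
Proof.
unfold Cexp, Re, Im; cbn. rewrite exp_plus, cos_plus, sin_plus.
apply injective_projections; cbn; ring.
Qed.

Lemma Cexp_RtoC (x : R) : Cexp (RtoC x) = RtoC (exp x).
Proof. unfold Cexp; cbn. rewrite cos_0, sin_0. apply injective_projections; cbn; ring. Qed.

Lemma is_lim_seq_inv_S : is_lim_seq (fun n => / (INR n + 1)) 0.
Proof.
apply (is_lim_seq_ext (fun n => / INR (S n))).
{ intros n. rewrite S_INR. reflexivity. }
apply (is_lim_seq_incr_1 (fun n => / INR n)).
replace (Finite 0) with (Rbar_inv p_infty) by reflexivity.
apply is_lim_seq_inv; [apply is_lim_seq_INR | discriminate].
Qed.

Lemma is_lim_seq_scal_inv_S (c : R) : is_lim_seq (fun n => c * / (INR n + 1)) 0.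
Proof.
replace (Finite 0) with (Finite (c * 0)) by (f_equal; ring).
apply is_lim_seq_mult'; [apply is_lim_seq_const | apply is_lim_seq_inv_S].
Qed.

(** Since [(cosh t + sinh t) exp (- t) = 1], the ladder multiplies the amplitude by [1 + z], up to a
    term in which the bounded normalized solution is multiplied by [sech t * exp (- t)]. *)
Lemma ladder_amp (lam : R) (z : C) (y w : R -> C) (t : R) :
  amp (z + 1)%C (ladder_val z y w) (ladder_der lam z y w) t =
  ((1 + z) * amp z y w t
   - RtoC (lam * / cosh t * exp (- t)) * (y t * Cexp (- (z * RtoC t))))%C.
Proof.
unfold amp, ladder_val, ladder_der.
replace (- ((z + 1) * RtoC t))%C with (- (z * RtoC t) + RtoC (- t))%C
  by (rewrite RtoC_opp; ring).
rewrite Cexp_plus, Cexp_RtoC.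
assert (He : RtoC (exp (- t)) = (RtoC (cosh t) - RtoC (sinh t))%C).
{ rewrite <- RtoC_minus. f_equal. unfold cosh, sinh. field. }
assert (Hcs : (RtoC (cosh t) * RtoC (cosh t) = 1 + RtoC (sinh t) * RtoC (sinh t))%C).
{ rewrite <- !RtoC_mult, <- RtoC_plus. f_equal. pose proof (cosh_sinh_sqr t). lra. }
set (E := Cexp (- (z * RtoC t))%C).
rewrite (RtoC_mult (lam * / cosh t)).
set (h := RtoC (lam * / cosh t)).
transitivity ((1 + z) * ((w t + z * y t) * E) *
   ((RtoC (cosh t) + RtoC (sinh t)) * RtoC (exp (- t))) - h * RtoC (exp (- t)) * (y t * E))%C;
  [ring|].
replace ((RtoC (cosh t) + RtoC (sinh t)) * RtoC (exp (- t)))%C with (RtoC 1); [ring|].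
rewrite He.
transitivity (RtoC (cosh t) * RtoC (cosh t) - RtoC (sinh t) * RtoC (sinh t))%C; [|ring].
rewrite Hcs. ring.
Qed.

Lemma ladder_amp_limit (lam : R) (z l : C) (y w : R -> C) :
  csol lam z y w -> z <> RtoC 0 -> 0 <= Re z ->
  Cconv (fun n => amp z y w (INR n)) l ->
  Cconv (fun n => amp (z + 1)%C (ladder_val z y w) (ladder_der lam z y w) (INR n))
    ((1 + z) * l)%C.
Proof.
intros HS Hz Hre Hl.
apply (Cconv_ext (fun n => (1 + z) * amp z y w (INR n)
   + - (RtoC (lam * / cosh (INR n) * exp (- INR n)) * (y (INR n) * Cexp (- (z * RtoC (INR n))))))%C).
{ intros n. rewrite ladder_amp. reflexivity. }
replace ((1 + z) * l)%C with ((1 + z) * l + 0)%C by ring.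
apply Cconv_plus; [apply Cconv_mult; [apply Cconv_const | exact Hl]|].
set (c := amp_energy z y w 0 + 1).
assert (He : 0 <= amp_energy z y w 0).
{ unfold amp_energy. pose proof (pow2_ge_0 (Cmod (amp z y w 0))).
  pose proof (pow2_ge_0 (Cmod (coamp z y w 0))). lra. }
(* A crude rate is enough: [sech <= 1] and [exp (- n) <= 1 / (n + 1)]. *)
apply (Cconv_of_bound _ _ (fun n => Rabs lam * (c * exp (Rabs lam / Cmod z) / Cmod z) * / (INR n + 1)));
  [|apply is_lim_seq_scal_inv_S].
intros n. cbv beta.
match goal with |- Cmod (- ?a - RtoC 0)%C <= _ => replace (- a - RtoC 0)%C with (- a)%C by ring end.
rewrite Cmod_opp, Cmod_mult, Cmod_R, !Rabs_mult.
pose proof (pos_INR n) as Hn.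
pose proof (normalized_bound lam c z y w (INR n) HS Hz Hre Hn ltac:(unfold c; lra)
  ltac:(unfold c; nra)) as HB.
assert (H1 : Rabs (/ cosh (INR n)) <= 1).
{ apply sqr_le_abs; [lra|]. rewrite pow_inv. pose proof (sech_sqr_range (INR n)). lra. }
assert (H2 : Rabs (exp (- INR n)) <= / (INR n + 1)).
{ rewrite Rabs_pos_eq by (left; apply exp_pos). rewrite exp_Ropp.
  apply Rinv_le_contravar; [lra|]. pose proof (exp_ineq1_le (INR n)). lra. }
set (M := c * exp (Rabs lam / Cmod z) / Cmod z) in *.
pose proof (Cmod_ge_0 (y (INR n) * Cexp (- (z * RtoC (INR n))))%C).
pose proof (Rabs_pos lam). pose proof (Rabs_pos (/ cosh (INR n))).
pose proof (Rabs_pos (exp (- INR n))).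
apply Rle_trans with (Rabs lam * 1 * / (INR n + 1) * M); [|right; ring].
apply Rmult_le_compat; auto.
- repeat apply Rmult_le_pos; auto.
- apply Rmult_le_compat; auto.
  + apply Rmult_le_pos; auto.
  + apply Rmult_le_compat; auto. lra.
Qed.

(** [a] and [b] are the amplitudes at infinity of the even and the odd solution. A relation rather
    than two functions of [z], so that each rung of the ladder may supply its own solutions. *)
Definition amp_pair (lam : R) (z a b : C) : Prop :=
  exists c c' s s' : R -> C,
    csol lam z c c' /\ csol lam z s s' /\
    (c 0 = RtoC 1 /\ c' 0 = RtoC 0 /\ s 0 = RtoC 0 /\ s' 0 = RtoC 1) /\
    Cconv (fun n => amp z c c' (INR n)) a /\ Cconv (fun n => amp z s s' (INR n)) b.

Lemma csol_scal (lam : R) (z k : C) (y w : R -> C) :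
  csol lam z y w -> csol lam z (fun t => k * y t)%C (fun t => k * w t)%C.
Proof.
intros [H1 H2]. split; intros t.
- apply is_Cderive_scal; auto.
- eapply is_Cderive_val; [apply is_Cderive_scal; auto | ring].
Qed.

(** The ladder exchanges parities: at 0 it sends data [(y, w)] to [(w, (z (z + 1) - lam) y)]. So the
    odd solution becomes the even one, and the even solution becomes the odd one after division by
    [z (z + 1) - lam]; both amplitudes gain the factor [1 + z]. *)
Lemma amp_pair_step (lam : R) (z a b : C) :
  z <> RtoC 0 -> 0 <= Re z -> (z * (z + 1) - RtoC lam)%C <> RtoC 0 ->
  amp_pair lam z a b ->
  amp_pair lam (z + 1)%C ((1 + z) * b)%C ((1 + z) * a / (z * (z + 1) - RtoC lam))%C.
Proof.
intros Hz Hre Hn [c [c' [s [s' [Sc [Ss [[I1 [I2 [I3 I4]]] [La Lb]]]]]]]].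
set (k := (/ (z * (z + 1) - RtoC lam))%C).
exists (ladder_val z s s'), (ladder_der lam z s s'),
  (fun t => k * ladder_val z c c' t)%C, (fun t => k * ladder_der lam z c c' t)%C.
split; [apply ladder_csol; auto|].
split; [apply csol_scal, ladder_csol; auto|].
split; [|split].
- unfold ladder_val, ladder_der. rewrite I1, I2, I3, I4, cosh_0, sinh_0, Rinv_1, Rmult_1_r.
  repeat split; try ring. unfold k.
  replace ((1 + z) * 0 * 0 + ((z * z + z) * 1 - RtoC lam) * 1)%C
    with (z * (z + 1) - RtoC lam)%C by ring.
  field. exact Hn.
- apply ladder_amp_limit; auto.
- apply (Cconv_ext (fun n => k *
    amp (z + 1)%C (ladder_val z c c') (ladder_der lam z c c') (INR n))%C).
  { intros n. unfold amp. ring. }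
  replace ((1 + z) * a / (z * (z + 1) - RtoC lam))%C with (k * ((1 + z) * a))%C
    by (unfold k, Cdiv; ring).
  apply Cconv_mult; [apply Cconv_const|]. apply ladder_amp_limit; auto.
Qed.

(** For [lam = 0] the amplitudes are exactly [z] and 1. In general each has relative error at most
    [e = x exp x] with [x = |lam| / |z|], and the product has error at most [(1 + e)^2 - 1]. *)
Lemma amp_pair_estimate (lam : R) (z a b : C) :
  z <> RtoC 0 -> 0 <= Re z -> amp_pair lam z a b ->
  Cmod (a * b / z - 1)%C <= 2 * (Rabs lam / Cmod z * exp (Rabs lam / Cmod z))
     + (Rabs lam / Cmod z * exp (Rabs lam / Cmod z)) ^ 2.
Proof.
intros Hz Hre [c [c' [s [s' [Sc [Ss [[I1 [I2 [I3 I4]]] [La Lb]]]]]]]].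
pose proof (Cmod_pos z Hz) as Hm.
set (x := Rabs lam / Cmod z).
assert (Ha : Cmod (a - z)%C <= x * (Cmod z * exp x)).
{ replace (a - z)%C with (a - (c' 0 + z * c 0))%C by (rewrite I1, I2; ring).
  apply (amp_limit_estimate lam (Cmod z) z a c c'); auto; [lra|].
  unfold amp_energy. rewrite amp_at_0, coamp_at_0, I1, I2.
  replace (0 + z * 1)%C with z by ring. replace (0 - z * 1)%C with (- z)%C by ring.
  rewrite Cmod_opp. lra. }
assert (Hb : Cmod (b - 1)%C <= x * (1 * exp x)).
{ replace (b - 1)%C with (b - (s' 0 + z * s 0))%C by (rewrite I3, I4; ring).
  apply (amp_limit_estimate lam 1 z b s s'); auto; [lra|].
  unfold amp_energy. rewrite amp_at_0, coamp_at_0, I3, I4.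
  replace (1 + z * 0)%C with (RtoC 1) by ring. replace (1 - z * 0)%C with (RtoC 1) by ring.
  rewrite Cmod_1. lra. }
rewrite Rmult_1_l in Hb. set (e := x * exp x) in *.
assert (Hb1 : Cmod b <= 1 + e).
{ replace b with (1 + (b - 1))%C by ring. eapply Rle_trans; [apply Cmod_triangle|].
  rewrite Cmod_1. lra. }
replace (a * b / z - 1)%C with ((a - z) / z * b + (b - 1))%C by (field; auto).
eapply Rle_trans; [apply Cmod_triangle|]. rewrite Cmod_mult, Cmod_div by auto.
assert (Ha1 : Cmod (a - z)%C / Cmod z <= e).
{ apply Rmult_le_reg_r with (Cmod z); auto. unfold e.
  replace (Cmod (a - z)%C / Cmod z * Cmod z) with (Cmod (a - z)%C) by (field; lra). lra. }
assert (0 <= Cmod (a - z)%C / Cmod z).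
{ apply Rmult_le_pos; [apply Cmod_ge_0 | left; apply Rinv_0_lt_compat; auto]. }
pose proof (Cmod_ge_0 b). nra.
Qed.

Lemma Im_pos_neq_0 (z : C) : 0 < Im z -> z <> RtoC 0.
Proof. intros H ->. cbn in H. lra. Qed.

(** The imaginary part is [Im z * (2 Re z + 1) > 0], whatever the real [lam]. *)
Lemma legendre_factor_neq_0 (lam : R) (z : C) :
  0 < Im z -> 0 <= Re z -> (z * (z + 1) - RtoC lam)%C <> RtoC 0.
Proof.
intros Hi Hr. apply Im_pos_neq_0. unfold Re, Im in *; cbn. nra.
Qed.

Fixpoint legendre_prod (lam : R) (z : C) (n : nat) : C :=
  match n with
  | O => RtoC 1
  | S m => (legendre_prod lam z m *
      (((z + RtoC (INR m)) * (z + RtoC (INR m) + 1) - RtoC lam)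
       / ((z + RtoC (INR m)) * (z + RtoC (INR m) + 1))))%C
  end.

Lemma shifted_im_re (z : C) (n : nat) :
  0 < Im z -> 0 <= Re z -> 0 < Im (z + RtoC (INR n))%C /\ INR n <= Re (z + RtoC (INR n))%C.
Proof. intros Hi Hr. unfold Im, Re in *; cbn. lra. Qed.

Lemma amp_pair_product (lam : R) (z a b : C) (n : nat) :
  0 < Im z -> 0 <= Re z -> amp_pair lam z a b ->
  legendre_prod lam z n <> RtoC 0 /\
  exists an bn, amp_pair lam (z + RtoC (INR n))%C an bn /\
    (a * b / z = legendre_prod lam z n * (an * bn / (z + RtoC (INR n))))%C.
Proof.
intros Hi Hr H0. induction n as [|n [IH0 [an [bn [IH1 IH2]]]]].
- split.
  + cbn. intros H. injection H. lra.
  + exists a, b. cbn. replace (z + 0)%C with z by ring. split; auto.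
    field. apply Im_pos_neq_0; auto.
- destruct (shifted_im_re z n Hi Hr) as [Hi1 Hr1]. pose proof (pos_INR n) as Hn.
  assert (E : (z + RtoC (INR (S n)) = z + RtoC (INR n) + 1)%C).
  { rewrite S_INR, RtoC_plus. ring. }
  set (zn := (z + RtoC (INR n))%C) in *.
  assert (N1 : zn <> RtoC 0) by (apply Im_pos_neq_0; auto).
  assert (N2 : (zn + 1)%C <> RtoC 0).
  { apply Im_pos_neq_0. unfold Im in *; cbn. lra. }
  assert (N3 : (zn * (zn + 1) - RtoC lam)%C <> RtoC 0).
  { apply legendre_factor_neq_0; auto. lra. }
  split.
  + cbn. fold zn. apply Cmult_neq_0; auto. apply Cmult_neq_0; auto.
    intros H.
    assert (H2 : ((zn * (zn + 1)) * / (zn * (zn + 1)) = 1)%C).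
    { apply Cinv_r. apply Cmult_neq_0; auto. }
    rewrite H in H2. rewrite Cmult_0_r in H2. injection H2. lra.
  + rewrite E. exists ((1 + zn) * bn)%C, ((1 + zn) * an / (zn * (zn + 1) - RtoC lam))%C.
    split; [apply amp_pair_step; auto; lra|].
    rewrite IH2. cbn. fold zn. field. auto.
Qed.

(** By telescoping, the quotient is exactly the normalized product of amplitudes at [z + n]. In this
    form neither convergence of [legendre_prod] nor nonvanishing of [a * b] has to be known
    beforehand. *)
Lemma legendre_prod_limit (lam : R) (z a b : C) :
  0 < Im z -> 0 <= Re z -> amp_pair lam z a b ->
  Cconv (fun n => (a * b / z) / legendre_prod lam z n)%C 1%C.
Proof.
intros Hi Hr H0. apply Cconv_shift.
(* After the shift by one, [|z + n + 1| >= n + 1 >= 1], so [x exp x <= D / (n + 1)]. *)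
set (D := Rabs lam * exp (Rabs lam)).
apply (Cconv_of_bound _ _ (fun n => (2 * D + D ^ 2) * / (INR n + 1)));
  [|apply is_lim_seq_scal_inv_S].
intros n.
destruct (amp_pair_product lam z a b (S n) Hi Hr H0) as [HP [an [bn [Hp HE]]]].
destruct (shifted_im_re z (S n) Hi Hr) as [Hi1 Hr1]. rewrite S_INR in Hr1 at 1.
pose proof (pos_INR n) as Hn.
rewrite HE.
set (zn := (z + RtoC (INR (S n)))%C) in *.
assert (N1 : zn <> RtoC 0) by (apply Im_pos_neq_0; auto).
replace (legendre_prod lam z (S n) * (an * bn / zn) / legendre_prod lam z (S n))%C
  with (an * bn / zn)%C by (field; auto).
eapply Rle_trans; [apply (amp_pair_estimate lam zn an bn); auto; lra|].
assert (Hm : INR n + 1 <= Cmod zn).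
{ eapply Rle_trans; [exact Hr1|]. eapply Rle_trans; [apply Rle_abs | apply Re_le_Cmod]. }
pose proof (Rabs_pos lam) as Hl.
set (v := / (INR n + 1)).
assert (Hv : 0 < v <= 1).
{ unfold v. split; [apply Rinv_0_lt_compat; lra|]. rewrite <- Rinv_1.
  apply Rinv_le_contravar; lra. }
assert (Hx : 0 <= Rabs lam / Cmod zn <= Rabs lam * v).
{ split.
  - apply Rmult_le_pos; auto. left. apply Rinv_0_lt_compat. lra.
  - apply Rmult_le_compat_l; auto. apply Rinv_le_contravar; lra. }
set (x := Rabs lam / Cmod zn) in *.
assert (Hex : 0 < exp x <= exp (Rabs lam)).
{ split; [apply exp_pos|].
  destruct (Req_dec x (Rabs lam)) as [->|Hne]; [lra|].
  left. apply exp_increasing. nra. }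
assert (He : 0 <= x * exp x <= D * v).
{ split; [nra|]. unfold D. apply Rle_trans with (Rabs lam * v * exp (Rabs lam)); [|right; ring].
  apply Rmult_le_compat; lra. }
assert (HD : 0 <= D) by (unfold D; pose proof (exp_pos (Rabs lam)); nra).
assert (Hvv : D ^ 2 * (v * v) <= D ^ 2 * v) by (apply Rmult_le_compat_l; nra).
assert ((x * exp x) ^ 2 <= (D * v) ^ 2) by (apply pow_incr; auto).
lra.
Qed.

(** * Euler-Gauss limits *)

Lemma Cmod_Cexp (w : C) : Cmod (Cexp w) = exp (Re w).
Proof.
pose proof (exp_pos (Re w)). rewrite <- (Rabs_pos_eq (exp (Re w))) by lra.
rewrite <- (Rabs_pos_eq (Cmod _)) by apply Cmod_ge_0.
apply Rsqr_eq_abs_0. unfold Rsqr.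
replace (Cmod (Cexp w) * Cmod (Cexp w)) with (Cmod (Cexp w) ^ 2) by ring.
rewrite Cmod_sqr. unfold Cexp, Re, Im; cbn.
pose proof (sin2_cos2 (snd w)) as E. unfold Rsqr in E. cbn in E.
transitivity (exp (fst w) * exp (fst w) * (sin (snd w) * sin (snd w) + cos (snd w) * cos (snd w)));
  [ring | rewrite E; ring].
Qed.

Lemma Cexp_0 : Cexp 0 = 1.
Proof. rewrite Cexp_RtoC, exp_0. reflexivity. Qed.

Lemma Cexp_neq_0 (w : C) : Cexp w <> 0.
Proof.
intros H. pose proof (Cmod_Cexp w) as E. rewrite H, Cmod_0 in E.
pose proof (exp_pos (Re w)). lra.
Qed.

(** The rule for the complex power [(1 + s)^c], written through [Cexp] and [ln] as in
    [gamma_seq]. *)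
Lemma Cpower_derive (c : C) (s : R) :
  0 <= s ->
  is_Cderive (fun s => Cexp (c * RtoC (ln (1 + s))))%C s (c * Cexp ((c - 1) * RtoC (ln (1 + s))))%C.
Proof.
intros Hs.
assert (Hl : is_derive (fun s => ln (1 + s)) s (/ (1 + s))).
{ auto_derive; [lra | field; lra]. }
eapply is_Cderive_val.
- apply (is_Cderive_Cexp (fun s => c * RtoC (ln (1 + s)))%C).
  apply is_Cderive_scal, is_Cderive_RtoC, Hl.
- replace ((c - 1) * RtoC (ln (1 + s)))%C
    with (c * RtoC (ln (1 + s)) + RtoC (- ln (1 + s)))%C by (rewrite RtoC_opp; ring).
  rewrite Cexp_plus, Cexp_RtoC, exp_Ropp, exp_ln by lra.
  ring.
Qed.

Lemma Cpower_bound (c : C) (s : R) :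
  0 <= s <= 1 -> Cmod (Cexp (c * RtoC (ln (1 + s))))%C <= exp (Cmod c).
Proof.
intros Hs. rewrite Cmod_Cexp.
assert (E : Re (c * RtoC (ln (1 + s)))%C = Re c * ln (1 + s)) by (unfold Re; cbn; ring).
rewrite E. pose proof (Re_le_Cmod c) as H. pose proof (Rle_abs (Re c)).
assert (0 <= ln (1 + s) <= 1).
{ split.
  - rewrite <- ln_1. destruct (Req_dec s 0) as [->|]; [right; f_equal; ring|].
    left. apply ln_increasing; lra.
  - pose proof (exp_ineq1_le (ln (1 + s))). rewrite exp_ln in * by lra. lra. }
pose proof (Rabs_pos (Re c)).
assert (Re c * ln (1 + s) <= Cmod c) by nra.
destruct (Req_dec (Re c * ln (1 + s)) (Cmod c)) as [->|]; [lra|].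
left. apply exp_increasing. lra.
Qed.

Lemma Cpower_lipschitz (c : C) (s : R) :
  0 <= s <= 1 ->
  Cmod (Cexp (c * RtoC (ln (1 + s))) - 1)%C <= Cmod c * exp (Cmod (c - 1)%C) * s.
Proof.
intros Hs. set (M := Cmod c * exp (Cmod (c - 1)%C)).
replace (M * s) with (M * s - M * 0) by ring.
replace (RtoC 1) with (Cexp (c * RtoC (ln (1 + 0)))%C).
2:{ rewrite Rplus_0_r, ln_1, Cmult_0_r. apply Cexp_0. }
apply (Cincrement_bound (fun s => Cexp (c * RtoC (ln (1 + s))))%C
  (fun s => c * Cexp ((c - 1) * RtoC (ln (1 + s))))%C (fun s => M * s) (fun _ => M)); [lra | | |].
- intros t Ht. apply Cpower_derive. lra.
- intros t Ht. auto_derive; auto. ring.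
- intros t Ht. rewrite Cmod_mult. apply Rmult_le_compat_l; [apply Cmod_ge_0|].
  apply Cpower_bound. lra.
Qed.

(** The derivative of the remainder is [c ((1 + s)^(c - 1) - 1)], to which the Lipschitz bound
    applies with exponent [c - 1]; the factor 1/2 from integration is dropped. *)
Lemma Cpower_taylor (c : C) (s : R) :
  0 <= s <= 1 ->
  Cmod (Cexp (c * RtoC (ln (1 + s))) - 1 - c * RtoC s)%C
  <= Cmod c * (Cmod (c - 1)%C * exp (Cmod (c - 1 - 1)%C)) * s ^ 2.
Proof.
intros Hs. set (M := Cmod c * (Cmod (c - 1)%C * exp (Cmod (c - 1 - 1)%C))).
assert (HM : 0 <= M).
{ unfold M. pose proof (Cmod_ge_0 c). pose proof (Cmod_ge_0 (c - 1)%C).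
  pose proof (exp_pos (Cmod (c - 1 - 1)%C)).
  apply Rmult_le_pos; auto. apply Rmult_le_pos; lra. }
apply Rle_trans with (M * s ^ 2 / 2 - M * 0 ^ 2 / 2); [|nra].
replace (Cexp (c * RtoC (ln (1 + s))) - 1 - c * RtoC s)%C
  with ((Cexp (c * RtoC (ln (1 + s))) + (- c) * RtoC s)
       - (Cexp (c * RtoC (ln (1 + 0))) + (- c) * RtoC 0))%C.
2:{ rewrite Rplus_0_r, ln_1, Cmult_0_r, Cexp_0. ring. }
apply (Cincrement_bound (fun s => Cexp (c * RtoC (ln (1 + s))) + (- c) * RtoC s)%C
  (fun s => c * Cexp ((c - 1) * RtoC (ln (1 + s))) + (- c) * RtoC 1)%C
  (fun s => M * s ^ 2 / 2) (fun s => M * s)); [lra | | |].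
- intros t Ht. apply is_Cderive_plus; [apply Cpower_derive; lra|].
  apply is_Cderive_scal, is_Cderive_RtoC. apply (is_derive_id (K := R_AbsRing)).
- intros t Ht. auto_derive; auto. field.
- intros t Ht.
  replace (c * Cexp ((c - 1) * RtoC (ln (1 + t))) + - c * 1)%C
    with (c * (Cexp ((c - 1) * RtoC (ln (1 + t))) - 1))%C by ring.
  rewrite Cmod_mult. unfold M. rewrite !Rmult_assoc. apply Rmult_le_compat_l; [apply Cmod_ge_0|].
  rewrite <- Rmult_assoc. apply Cpower_lipschitz. lra.
Qed.

(** The majorant of order [1 / n^2] is given in telescoping form, so its partial sums are explicit
    and the bound [|v n| <= |v 0| exp (K (1 - 1 / (n + 1)))] follows by induction. *)
Lemma product_converges (v a : nat -> C) (K : R) :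
  0 <= K -> (forall n, v (S n) = (v n * (1 + a n))%C) ->
  (forall n, Cmod (a n) <= K * (/ (INR n + 1) - / (INR n + 1 + 1))) ->
  exists l, Cconv v l.
Proof.
intros HK Hv Ha.
set (r := fun n => / (INR n + 1)).
assert (Ha' : forall n, Cmod (a n) <= K * (r n - r (S n))).
{ intros n. unfold r. rewrite S_INR. apply Ha. }
assert (Hr : forall n, 0 < r n).
{ intros n. unfold r. apply Rinv_0_lt_compat. pose proof (pos_INR n). lra. }
assert (Hr0 : r 0%nat = 1) by (unfold r; cbn; field).
pose proof (Cmod_ge_0 (v 0%nat)) as Hv0.
assert (Hb : forall n, Cmod (v n) <= Cmod (v 0%nat) * exp (K * (1 - r n))).
{ intros n. induction n as [|n IH].
  - rewrite Hr0. replace (K * (1 - 1)) with 0 by ring. rewrite exp_0. lra.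
  - rewrite Hv, Cmod_mult.
    assert (H1 : Cmod (1 + a n)%C <= exp (K * (r n - r (S n)))).
    { eapply Rle_trans; [apply Cmod_triangle|]. rewrite Cmod_1.
      pose proof (exp_ineq1_le (K * (r n - r (S n)))). specialize (Ha' n). lra. }
    replace (K * (1 - r (S n))) with (K * (1 - r n) + K * (r n - r (S n))) by ring.
    rewrite exp_plus, <- Rmult_assoc.
    apply Rmult_le_compat; auto using Cmod_ge_0. }
set (U := Cmod (v 0%nat) * exp K).
assert (HU : forall n, Cmod (v n) <= U).
{ intros n. eapply Rle_trans; [apply Hb|]. apply Rmult_le_compat_l; auto.
  specialize (Hr n). destruct (Req_dec K 0) as [->|H0].
  - rewrite Rmult_0_l. lra.
  - left. apply exp_increasing. nra. }
apply (Cconv_of_cauchy v (fun n => - r n) (U * K)).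
- apply Rmult_le_pos; auto. eapply Rle_trans; [apply Cmod_ge_0 | apply (HU 0%nat)].
- exists 0. replace (Finite 0) with (Rbar_opp 0) by (cbn; f_equal; ring).
  apply (is_lim_seq_opp r). apply is_lim_seq_inv_S.
- intros n m Hnm. induction Hnm as [|m Hnm IH].
  + replace (v n - v n)%C with (RtoC 0) by ring. rewrite Cmod_0. lra.
  + replace (v (S m) - v n)%C with ((v m - v n) + v m * a m)%C by (rewrite Hv; ring).
    eapply Rle_trans; [apply Cmod_triangle|]. rewrite Cmod_mult.
    assert (Cmod (v m) * Cmod (a m) <= U * (K * (r m - r (S m)))).
    { apply Rmult_le_compat; auto using Cmod_ge_0. }
    lra.
Qed.

Lemma Cconv_neq_0_of_inv (u v : nat -> C) (a b : C) :
  Cconv u a -> Cconv v b -> (forall n, (u n * v n)%C = 1) -> a <> 0.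
Proof.
intros Hu Hv H Ha.
assert (E : (a * b)%C = 1).
{ apply (Cconv_unique (fun n => u n * v n)%C); [apply Cconv_mult; auto|].
  apply (Cconv_ext (fun _ => RtoC 1)); [intros n; symmetry; apply H | apply Cconv_const]. }
rewrite Ha, Cmult_0_l in E. injection E. lra.
Qed.

(* The limit is nonzero because the product of the inverses converges as well. *)
Lemma product_converges_neq_0 (v a : nat -> C) (K : R) :
  0 <= K -> v 0%nat <> 0 -> (forall n, v (S n) = (v n * (1 + a n))%C) ->
  (forall n, Cmod (a n) <= 1 / 2) ->
  (forall n, Cmod (a n) <= K * (/ (INR n + 1) - / (INR n + 1 + 1))) ->
  exists l, Cconv v l /\ l <> 0.
Proof.
intros HK H0 Hv Hh Ha.
assert (Hone : forall n, 1 / 2 <= Cmod (1 + a n)%C).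
{ intros n. pose proof (Cmod_triangle (1 + a n)%C (- a n)%C) as H.
  replace (1 + a n + - a n)%C with (RtoC 1) in H by ring.
  rewrite Cmod_1, Cmod_opp in H. specialize (Hh n). lra. }
assert (Hn1 : forall n, (1 + a n)%C <> 0).
{ intros n H. specialize (Hone n). rewrite H, Cmod_0 in Hone. lra. }
assert (Hvn : forall n, v n <> 0).
{ intros n. induction n as [|n IH]; auto. rewrite Hv. apply Cmult_neq_0; auto. }
destruct (product_converges v a K HK Hv Ha) as [l Hl].
destruct (product_converges (fun n => / v n)%C (fun n => - (a n / (1 + a n)))%C (2 * K))
  as [m Hm]; [lra | | |].
- intros n. rewrite Hv. field. auto.
- intros n. rewrite Cmod_opp, Cmod_div by auto. specialize (Ha n). specialize (Hone n).
  pose proof (Cmod_ge_0 (a n)).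
  apply Rle_trans with (2 * Cmod (a n)); [|lra].
  apply Rmult_le_reg_r with (Cmod (1 + a n)%C); [lra|].
  replace (Cmod (a n) / Cmod (1 + a n)%C * Cmod (1 + a n)%C) with (Cmod (a n)) by (field; lra).
  nra.
- exists l. split; auto. apply (Cconv_neq_0_of_inv v (fun n => / v n)%C l m); auto.
  intros n. apply Cinv_r; auto.
Qed.

Lemma Im_shift_neq_0 (z : C) (x : R) : 0 < Im z -> (z + RtoC x)%C <> 0.
Proof. intros H. apply Im_pos_neq_0. unfold Im in *; cbn. lra. Qed.

Lemma Crising_neq_0 (z : C) (n : nat) : 0 < Im z -> Crising z n <> 0.
Proof.
intros Hz. induction n as [|n IH].
- cbn. intros H. injection H. lra.
- cbn [Crising]. apply Cmult_neq_0; auto. apply Im_shift_neq_0; auto.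
Qed.

Lemma gamma_seq_neq_0 (z : C) (n : nat) : 0 < Im z -> gamma_seq z n <> 0.
Proof.
intros Hz. unfold gamma_seq. apply Cmult_neq_0.
- apply Cmult_neq_0; [|apply Cexp_neq_0].
  intros H. apply RtoC_inj in H. pose proof (INR_fact_neq_0 n). auto.
- intros H.
  assert (E : (Crising z (S n) * / Crising z (S n))%C = 1)
    by (apply Cinv_r, Crising_neq_0; auto).
  rewrite H, Cmult_0_r in E. injection E. lra.
Qed.

(** With [s = 1 / n], the ratio of consecutive terms is [(1 + s)^(z + 1) / (1 + (z + 1) s)].
    Numerator and denominator agree to first order in [s], and the correction to 1 is isolated so
    that [Cpower_taylor] makes it quadratic. *)
Lemma gamma_seq_step (z : C) (n : nat) :
  0 < Im z -> (1 <= n)%nat ->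
  gamma_seq z (S n) =
  (gamma_seq z n * (1 + (Cexp ((z + 1) * RtoC (ln (1 + / INR n))) - 1 - (z + 1) * RtoC (/ INR n))
      / (1 + (z + 1) * RtoC (/ INR n))))%C.
Proof.
intros Hz Hn.
assert (Hn0 : 0 < INR n) by (apply lt_0_INR; lia).
pose proof (Rinv_0_lt_compat _ Hn0) as Hi.
assert (Hd : (1 + (z + 1) * RtoC (/ INR n))%C <> 0).
{ apply Im_pos_neq_0. unfold Im in *; cbn. nra. }
assert (Hln : ln (INR (S n)) = ln (INR n) + ln (1 + / INR n)).
{ rewrite <- ln_mult by lra. f_equal. rewrite S_INR. field. lra. }
assert (Hex : Cexp ((z + 1) * RtoC (ln (1 + / INR n)))%C
   = (Cexp (z * RtoC (ln (1 + / INR n))) * RtoC (1 + / INR n))%C).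
{ replace ((z + 1) * RtoC (ln (1 + / INR n)))%C
    with (z * RtoC (ln (1 + / INR n)) + RtoC (ln (1 + / INR n)))%C by ring.
  rewrite Cexp_plus, Cexp_RtoC, exp_ln by lra. reflexivity. }
assert (Hs : RtoC (INR (S n)) = (RtoC (INR n) + 1)%C) by (rewrite S_INR, RtoC_plus; reflexivity).
assert (Hnn : RtoC (INR n) <> 0) by (intros H; apply RtoC_inj in H; lra).
unfold gamma_seq. rewrite Hln, RtoC_plus, Cmult_plus_distr_l, Cexp_plus.
change (fact (S n)) with (S n * fact n)%nat. rewrite mult_INR, RtoC_mult.
cbn [Crising]. rewrite Hex, RtoC_plus, RtoC_inv in * by lra.
rewrite !Hs.
pose proof (Crising_neq_0 z n Hz) as HC.
pose proof (Im_shift_neq_0 z (INR n) Hz) as HC1.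
pose proof (Im_shift_neq_0 z (INR (S n)) Hz) as HC2. rewrite Hs in HC2.
field. repeat split; auto.
intros H. apply HC2. rewrite <- H. ring.
Qed.

Lemma gamma_seq_converges (z : C) :
  0 < Im z -> exists l, Cconv (gamma_seq z) l /\ l <> 0.
Proof.
intros Hz. set (c := (z + 1)%C).
set (M := Cmod c * (Cmod (c - 1)%C * exp (Cmod (c - 1 - 1)%C))).
assert (HM : 0 <= M).
{ unfold M. pose proof (Cmod_ge_0 c). pose proof (Cmod_ge_0 (c - 1)%C).
  pose proof (exp_pos (Cmod (c - 1 - 1)%C)).
  apply Rmult_le_pos; auto. apply Rmult_le_pos; lra. }
pose proof (Cmod_ge_0 c) as Hc.
(* Past this index [|c| s <= 1/2], which keeps the denominators away from 0, and [2 M s^2 <= 1/2],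
   as the nonvanishing criterion for products requires. *)
destruct (nfloor_ex (1 + 2 * Cmod c + 4 * M)) as [N0 [_ HN0]]; [lra|].
set (N := S N0). assert (HN : 1 + 2 * Cmod c + 4 * M < INR N) by (unfold N; rewrite S_INR; lra).
clearbody N. clear N0 HN0.
set (a := fun n => ((Cexp (c * RtoC (ln (1 + / INR (n + N)))) - 1 - c * RtoC (/ INR (n + N)))
      / (1 + c * RtoC (/ INR (n + N))))%C).
assert (Hbound : forall n, Cmod (a n) <= 2 * M * (/ INR (n + N)) ^ 2).
{ intros n. unfold a. rewrite plus_INR. pose proof (pos_INR n) as Hn.
  set (s := / (INR n + INR N)).
  assert (Hs0 : 0 < s) by (apply Rinv_0_lt_compat; lra).
  assert (Hsm : s * (INR n + INR N) = 1) by (unfold s; field; lra).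
  assert (Hs1 : s <= 1) by nra.
  assert (Hcs : Cmod c * s <= 1 / 2) by nra.
  assert (Hden : 1 / 2 <= Cmod (1 + c * RtoC s)%C).
  { pose proof (Cmod_triangle (1 + c * RtoC s)%C (- (c * RtoC s))%C) as H.
    replace (1 + c * RtoC s + - (c * RtoC s))%C with (RtoC 1) in H by ring.
    rewrite Cmod_1, Cmod_opp, Cmod_mult, Cmod_R, (Rabs_pos_eq s) in H by lra. lra. }
  assert (Hd0 : (1 + c * RtoC s)%C <> 0).
  { intros H. rewrite H, Cmod_0 in Hden. lra. }
  rewrite Cmod_div by auto.
  pose proof (Cpower_taylor c s ltac:(lra)) as HT. fold M in HT.
  pose proof (Cmod_ge_0 (Cexp (c * RtoC (ln (1 + s))) - 1 - c * RtoC s)%C).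
  set (T := Cmod (Cexp (c * RtoC (ln (1 + s))) - 1 - c * RtoC s)%C) in *.
  set (Dn := Cmod (1 + c * RtoC s)%C) in *.
  apply Rmult_le_reg_r with Dn; [lra|].
  replace (T / Dn * Dn) with T by (field; lra).
  assert (0 <= M * s ^ 2) by nra. nra. }
destruct (product_converges_neq_0 (fun n => gamma_seq z (n + N)) a (4 * M)) as [l [Hl Hl0]].
- lra.
- apply gamma_seq_neq_0; auto.
- intros n. cbn [Nat.add]. apply gamma_seq_step; auto.
  destruct N; [cbn in HN; lra | lia].
- intros n. eapply Rle_trans; [apply Hbound|]. rewrite plus_INR. pose proof (pos_INR n) as Hn.
  set (s := / (INR n + INR N)).
  assert (Hs0 : 0 < s) by (apply Rinv_0_lt_compat; lra).
  assert (Hsm : s * (INR n + INR N) = 1) by (unfold s; field; lra).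
  assert (Hs1 : s <= 1) by nra. assert (Hms : M * s <= 1 / 4) by nra. nra.
- intros n. eapply Rle_trans; [apply Hbound|]. rewrite plus_INR. pose proof (pos_INR n) as Hn.
  assert (H1 : / (INR n + INR N) <= / (INR n + 1)) by (apply Rinv_le_contravar; lra).
  assert (H0 : 0 < / (INR n + INR N)) by (apply Rinv_0_lt_compat; lra).
  assert (H2 : (/ (INR n + INR N)) ^ 2 <= (/ (INR n + 1)) ^ 2) by (apply pow_incr; lra).
  (* Passage from [1 / (n + 1)^2] to a telescoping difference costs a factor 2, whence the constant
     [4 * M]. *)
  assert (H3 : (/ (INR n + 1)) ^ 2 <= 2 * (/ (INR n + 1) - / (INR n + 1 + 1))).
  { replace (2 * (/ (INR n + 1) - / (INR n + 1 + 1)))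
      with (/ (INR n + 1) * (2 / (INR n + 1 + 1))) by (field; lra).
    replace ((/ (INR n + 1)) ^ 2) with (/ (INR n + 1) * / (INR n + 1)) by ring.
    apply Rmult_le_compat_l; [left; apply Rinv_0_lt_compat; lra|].
    apply Rmult_le_reg_r with ((INR n + 1) * (INR n + 1 + 1)); [nra|].
    field_simplify; lra. }
  nra.
- exists l. split; auto. destruct Hl as [L1 L2]. split.
  + apply (is_lim_seq_incr_n (fun n => Re (gamma_seq z n)) N); auto.
  + apply (is_lim_seq_incr_n (fun n => Im (gamma_seq z n)) N); auto.
Qed.

(** [Lim_seq] and [real] are total, so [Cgamma] is the true limit only once convergence is proved.
    The nonvanishing allows division by the gamma factors in the denominator of [B]. *)
Lemma Cgamma_limit (z : C) : 0 < Im z -> Cconv (gamma_seq z) (Cgamma z) /\ Cgamma z <> 0.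
Proof.
intros Hz. destruct (gamma_seq_converges z Hz) as [l [Hl Hl0]].
assert (E : Cgamma z = l).
{ destruct Hl as [L1 L2]. unfold Cgamma.
  rewrite (is_lim_seq_unique _ _ L1), (is_lim_seq_unique _ _ L2). destruct l; reflexivity. }
rewrite E. auto.
Qed.

(** With [x = z + m], factor by factor: [(x + 1 + nu) (x - nu) = x (x + 1) - nu (nu + 1)]. *)
Lemma Crising_product (z : C) (nu : R) (n : nat) :
  0 < Im z ->
  (Crising (1 + z + RtoC nu) n * Crising (z - RtoC nu) n
   = legendre_prod (nu * (nu + 1)) z n * (Crising (1 + z) n * Crising z n))%C.
Proof.
intros Hz. induction n as [|n IH]; cbn [Crising legendre_prod].
- ring.
- pose proof (Im_shift_neq_0 z (INR n) Hz) as N1.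
  assert (N2 : (z + RtoC (INR n) + 1)%C <> 0).
  { apply Im_pos_neq_0. unfold Im in *; cbn. lra. }
  transitivity (Crising (1 + z + RtoC nu) n * Crising (z - RtoC nu) n
    * ((1 + z + RtoC nu + RtoC (INR n)) * (z - RtoC nu + RtoC (INR n))))%C; [ring|].
  rewrite IH, RtoC_mult, RtoC_plus. field. auto.
Qed.

(** Exact for every [n]: the two pairs of arguments have the same sum, so the powers of [n] cancel
    and only rising factorials remain. *)
Lemma gamma_seq_product (z : C) (nu : R) (n : nat) :
  0 < Im z ->
  (gamma_seq (1 + z) n * gamma_seq z n
   = legendre_prod (nu * (nu + 1)) z (S n)
     * (gamma_seq (1 + z + RtoC nu) n * gamma_seq (z - RtoC nu) n))%C.
Proof.
intros Hz. unfold gamma_seq.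
assert (I1 : 0 < Im (1 + z)%C) by (unfold Im in *; cbn; lra).
assert (I2 : 0 < Im (1 + z + RtoC nu)%C) by (unfold Im in *; cbn; lra).
assert (I3 : 0 < Im (z - RtoC nu)%C) by (unfold Im in *; cbn; lra).
pose proof (Crising_neq_0 _ (S n) Hz) as C0. pose proof (Crising_neq_0 _ (S n) I1) as C1.
pose proof (Crising_neq_0 _ (S n) I2) as C2. pose proof (Crising_neq_0 _ (S n) I3) as C3.
pose proof (Crising_product z nu (S n) Hz) as HP.
set (L := RtoC (ln (INR n))) in *. set (F := RtoC (INR (fact n))) in *.
assert (HE : (Cexp ((1 + z) * L) * Cexp (z * L)
   = Cexp ((1 + z + RtoC nu) * L) * Cexp ((z - RtoC nu) * L))%C).
{ rewrite <- !Cexp_plus. f_equal. ring. }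
set (R0 := Crising z (S n)) in *. set (R1 := Crising (1 + z) (S n)) in *.
set (R2 := Crising (1 + z + RtoC nu) (S n)) in *. set (R3 := Crising (z - RtoC nu) (S n)) in *.
set (PP := legendre_prod (nu * (nu + 1)) z (S n)) in *.
transitivity (F * F * (Cexp ((1 + z) * L) * Cexp (z * L)) * (R2 * R3) / (R0 * R1 * R2 * R3))%C;
  [field; auto|].
rewrite HE, HP. field. auto.
Qed.

(* Both sides are [lim legendre_prod]: on the left through the Euler-Gauss limits, on the
   right because [amp_pair_product] telescopes along the ladder [z, z + 1, ...]. *)
Lemma gamma_amp (z a b : C) (nu : R) :
  0 < Im z -> 0 <= Re z -> amp_pair (nu * (nu + 1)) z a b ->
  (Cgamma (1 + z) * Cgamma z / (Cgamma (1 + z + RtoC nu) * Cgamma (z - RtoC nu)))%C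
  = (a * b / z)%C.
Proof.
intros Hi Hr HA.
assert (I1 : 0 < Im (1 + z)%C) by (unfold Im in *; cbn; lra).
assert (I2 : 0 < Im (1 + z + RtoC nu)%C) by (unfold Im in *; cbn; lra).
assert (I3 : 0 < Im (z - RtoC nu)%C) by (unfold Im in *; cbn; lra).
destruct (Cgamma_limit _ Hi) as [L0 _]. destruct (Cgamma_limit _ I1) as [L1 _].
destruct (Cgamma_limit _ I2) as [L2 N2]. destruct (Cgamma_limit _ I3) as [L3 N3].
set (J := (a * b / z)%C).
assert (E : (Cgamma (1 + z) * Cgamma z * 1
   = J * (Cgamma (1 + z + RtoC nu) * Cgamma (z - RtoC nu)))%C).
{ apply (Cconv_unique (fun n => J * (gamma_seq (1 + z + RtoC nu) n * gamma_seq (z - RtoC nu) n))%C).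
  - apply (Cconv_ext (fun n => gamma_seq (1 + z) n * gamma_seq z n
       * (J / legendre_prod (nu * (nu + 1)) z (S n)))%C).
    + intros n. rewrite (gamma_seq_product z nu n Hi). field.
      apply (amp_pair_product _ z a b (S n) Hi Hr HA).
    + apply Cconv_mult; [apply Cconv_mult; auto|].
      apply (Cconv_shift (fun n => J / legendre_prod (nu * (nu + 1)) z n)%C).
      apply (legendre_prod_limit _ z a b); auto.
  - apply Cconv_mult; [apply Cconv_const|]. apply Cconv_mult; auto. }
rewrite Cmult_1_r in E. rewrite E. field. auto.
Qed.

(** * The limit equation and the discriminant *)

Lemma sech_csol (om lam : R) (u v : R -> R) :
  ode_sol (sech_potential om lam) u v ->
  csol lam (Ci * RtoC om)%C (fun t => RtoC (u t)) (fun t => RtoC (v t)).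
Proof.
intros [H1 H2]. split; intros t.
- apply is_Cderive_RtoC; auto.
- eapply is_Cderive_val; [apply is_Cderive_RtoC, H2|].
  unfold sech_potential. apply injective_projections; cbn; ring.
Qed.

(** For real solutions and imaginary [z] the squared amplitude is the quantity controlled by
    [energy_bound]. These sharp constants replace the factor [exp (|lam| / |z|)] of the general
    bounds. *)
Lemma Cmod_amp_real (om : R) (u v : R -> R) (t : R) :
  Cmod (amp (Ci * RtoC om)%C (fun t => RtoC (u t)) (fun t => RtoC (v t)) t) ^ 2
  = v t ^ 2 + om ^ 2 * u t ^ 2.
Proof.
unfold amp. rewrite Cmod_mult, Cmod_Cexp.
replace (Re (- (Ci * RtoC om * RtoC t))%C) with 0 by (unfold Re; cbn; ring).
rewrite exp_0, Rmult_1_r, Cmod_sqr. unfold Re, Im; cbn. ring.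
Qed.

Lemma sech_amp_bounds (om lam a b c K : R) (u v : R -> R) (l : C) :
  0 < om -> 0 <= K -> 0 <= c ->
  (forall T, energy_bound (sech_potential om lam) T om a b) ->
  ode_sol (sech_potential om lam) u v ->
  a ^ 2 * v 0 ^ 2 + b ^ 2 * u 0 ^ 2 <= c ^ 2 ->
  let A := amp (Ci * RtoC om)%C (fun t => RtoC (u t)) (fun t => RtoC (v t)) in
  Cconv (fun n => A (INR n)) l ->
  Cmod (A K) <= c /\ Cmod l <= c /\
  Cmod (l - A K)%C <= Rabs lam * (c / om) * (1 - tanh K).
Proof.
intros Hom HK Hc HE HS H0 A Hl.
assert (HA : forall t, 0 <= t -> Cmod (A t) <= c).
{ intros t Ht. rewrite <- (Rabs_pos_eq (Cmod _)) by apply Cmod_ge_0.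
  apply sqr_le_abs; auto. unfold A. rewrite Cmod_amp_real.
  eapply Rle_trans; [|exact H0]. apply (HE t u v 0 t); auto; lra. }
split; [auto|]. split.
- replace l with (l - 0)%C by ring. apply (Cconv_Cmod_le _ l 0 c 0 Hl).
  intros n _. replace (A (INR n) - 0)%C with (A (INR n)) by ring. apply HA, pos_INR.
(* The limit is taken along integers, so [K] is compared with all integers beyond it. *)
- destruct (nfloor_ex K HK) as [N [_ HN]].
  apply (Cconv_Cmod_le _ l (A K) _ (S N) Hl). intros n Hn.
  assert (HKn : K <= INR n).
  { apply le_INR in Hn. rewrite S_INR in Hn. lra. }
  assert (Hcom : 0 <= c / om) by (apply Rmult_le_pos; [auto | left; apply Rinv_0_lt_compat; auto]).
  pose proof (Rabs_pos lam) as Hlam.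
  apply Rle_trans with (Rabs lam * (c / om) * tanh (INR n) - Rabs lam * (c / om) * tanh K).
  + apply (Cincrement_bound A
      (fun t => - RtoC (lam * / cosh t ^ 2) * (RtoC (u t) * Cexp (- (Ci * RtoC om * RtoC t))))%C
      (fun t => Rabs lam * (c / om) * tanh t) (fun t => Rabs lam * (c / om) * / cosh t ^ 2)); auto.
    * intros t _. apply (amp_derive lam (Ci * RtoC om)%C (fun t => RtoC (u t)) (fun t => RtoC (v t))).
      apply (sech_csol om lam u v HS).
    * intros t _. apply is_derive_scal, tanh_derive.
    * intros t Ht. pose proof (sech_sqr_range t).
      rewrite !Cmod_mult, Cmod_opp, !Cmod_R, Rabs_mult, (Rabs_pos_eq (/ cosh t ^ 2)), Cmod_Cexp by lra.
      replace (Re (- (Ci * RtoC om * RtoC t))%C) with 0 by (unfold Re; cbn; ring).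
      rewrite exp_0, Rmult_1_r.
      assert (Rabs (u t) <= c / om).
      { apply (energy_bound_values (sech_potential om lam) u v t om a b c 0 t); auto; lra. }
      replace (Rabs lam * (c / om) * / cosh t ^ 2) with (Rabs lam * / cosh t ^ 2 * (c / om)) by ring.
      apply Rmult_le_compat_l; auto. apply Rmult_le_pos; lra.
  + pose proof (tanh_lt_1 (INR n)). pose proof (Rmult_le_pos _ _ Hlam Hcom). nra.
Qed.

Lemma sech_asymptotics (om lam a b K : R) (u1 v1 u2 v2 : R -> R) :
  0 < om -> 0 <= K -> 0 <= a -> 0 <= b ->
  (forall T, energy_bound (sech_potential om lam) T om a b) ->
  fundamental (sech_potential om lam) u1 v1 u2 v2 ->
  exists al be : C, amp_pair lam (Ci * RtoC om)%C al be /\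
    Rabs (4 * (u1 K * v2 K) - 2
      - 2 * Re (al * be / (Ci * RtoC om) * Cexp (2 * (Ci * RtoC om) * RtoC K))%C)
    <= 4 * (a * b / om ^ 2) * (Rabs lam * (1 - tanh K)).
Proof.
intros Hom HK Ha Hb HE F. set (z := (Ci * RtoC om)%C).
assert (Hi : Im z = om) by (unfold z, Im; cbn; ring).
assert (Hr : Re z = 0) by (unfold z, Re; cbn; ring).
assert (Hz : z <> RtoC 0) by (apply Im_pos_neq_0; lra).
assert (Hm : Cmod z = om).
{ assert (HCi : Cmod Ci = 1).
  { unfold Cmod, Ci. cbn [fst snd]. replace (0 ^ 2 + 1 ^ 2) with 1 by ring. apply sqrt_1. }
  unfold z. rewrite Cmod_mult, HCi, Cmod_R, Rabs_pos_eq by lra. ring. }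
pose proof F as [S1 [S2 [A1 [A2 [A3 A4]]]]].
pose proof (sech_csol om lam u1 v1 S1) as C1. pose proof (sech_csol om lam u2 v2 S2) as C2.
fold z in C1, C2.
destruct (amp_converges lam z _ _ C1 Hz ltac:(lra)) as [al Hal].
destruct (amp_converges lam z _ _ C2 Hz ltac:(lra)) as [be Hbe].
exists al, be. split.
{ exists (fun t => RtoC (u1 t)), (fun t => RtoC (v1 t)),
    (fun t => RtoC (u2 t)), (fun t => RtoC (v2 t)).
  rewrite A1, A2, A3, A4.
  split; [exact C1|]. split; [exact C2|]. split; [auto|]. split; [exact Hal | exact Hbe]. }
destruct (sech_amp_bounds om lam a b b K u1 v1 al Hom HK Hb HE S1) as [X1 [X2 X3]]; auto.
{ rewrite A1, A2. lra. }
destruct (sech_amp_bounds om lam a b a K u2 v2 be Hom HK Ha HE S2) as [Y1 [Y2 Y3]]; auto.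
{ rewrite A3, A4. lra. }
fold z in X1, X2, X3, Y1, Y2, Y3.
set (P := amp z (fun t => RtoC (u1 t)) (fun t => RtoC (v1 t)) K) in *.
set (Q := amp z (fun t => RtoC (u2 t)) (fun t => RtoC (v2 t)) K) in *.
set (ex := Cexp (2 * z * RtoC K)%C).
assert (HPQ : (P * Q * ex = (RtoC (v1 K) + z * RtoC (u1 K)) * (RtoC (v2 K) + z * RtoC (u2 K)))%C).
{ unfold P, Q, amp, ex.
  transitivity ((RtoC (v1 K) + z * RtoC (u1 K)) * (RtoC (v2 K) + z * RtoC (u2 K)) *
    (Cexp (- (z * RtoC K)) * Cexp (- (z * RtoC K)) * Cexp (2 * z * RtoC K)))%C; [ring|].
  rewrite <- !Cexp_plus.
  replace (- (z * RtoC K) + - (z * RtoC K) + 2 * z * RtoC K)%C with (RtoC 0) by ring.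
  rewrite Cexp_0. ring. }
(* As [z] and [1 / z] are imaginary, the real part keeps only the mixed terms [u1 v2 + v1 u2]; the
   Wronskian then gives [2 (u1 v2 + v1 u2) = 4 u1 v2 - 2]. *)
assert (Hval : 4 * (u1 K * v2 K) - 2 = 2 * Re (P * Q / z * ex)%C).
{ replace (P * Q / z * ex)%C with (P * Q * ex / z)%C by (field; auto).
  rewrite HPQ. pose proof (fundamental_wronskian _ u1 v1 u2 v2 K F) as HW.
  assert (Hiz : (/ z)%C = (0, - / om)).
  { unfold z. apply injective_projections; cbn; field; lra. }
  unfold Cdiv. rewrite Hiz. unfold Re, z; cbn.
  transitivity (2 * (u1 K * v2 K + v1 K * u2 K)); [lra|]. field. lra. }
rewrite Hval.
(* The difference of the two products is split so that each term has one amplitude error and one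
   bounded factor. Each contributes [a b |lam| (1 - tanh K) / om]; the outer 2 and [|z| = om] yield
   [4 a b / om^2]. *)
replace (2 * Re (P * Q / z * ex)%C - 2 * Re (al * be / z * ex)%C)
  with (2 * Re ((- (P * (be - Q) + be * (al - P))) / z * ex)%C).
2:{ replace ((- (P * (be - Q) + be * (al - P))) / z * ex)%C
      with (P * Q / z * ex - al * be / z * ex)%C by (field; auto).
    unfold Re; cbn. ring. }
rewrite Rabs_mult, (Rabs_pos_eq 2) by lra.
assert (Hex : Cmod ex = 1).
{ unfold ex. rewrite Cmod_Cexp.
  replace (Re (2 * z * RtoC K)%C) with 0 by (unfold z, Re; cbn; ring). apply exp_0. }
assert (Hsum : Cmod (P * (be - Q) + be * (al - P))%C
   <= b * (Rabs lam * (a / om) * (1 - tanh K)) + a * (Rabs lam * (b / om) * (1 - tanh K))).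
{ eapply Rle_trans; [apply Cmod_triangle|]. rewrite !Cmod_mult.
  apply Rplus_le_compat; apply Rmult_le_compat; auto using Cmod_ge_0. }
apply Rle_trans with (2 * ((b * (Rabs lam * (a / om) * (1 - tanh K))
    + a * (Rabs lam * (b / om) * (1 - tanh K))) / om)).
- apply Rmult_le_compat_l; [lra|]. eapply Rle_trans; [apply Re_le_Cmod|].
  rewrite Cmod_mult, Hex, Rmult_1_r, Cmod_div, Cmod_opp, Hm by auto.
  apply Rmult_le_compat_r; auto. left. apply Rinv_0_lt_compat. auto.
- right. field. lra.
Qed.

(** The hypothesis [1 <= a] absorbs the second error [4 a b] into [8 a^2 b], so that [E - tanh K]
    and [1 - tanh K] can be added with one constant. *)
Lemma lameD_estimate (h nu k om a b : R) :
  0 < k < 1 -> 0 < om -> om ^ 2 = h - nu * (nu + 1) -> 1 <= a -> 0 <= b ->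
  energy_bound (lame_potential h nu k) (ellK k) om a b ->
  (forall T, energy_bound (sech_potential om (nu * (nu + 1))) T om a b) ->
  let z := (Ci * RtoC om)%C in
  let B := (Cgamma (1 + z) * Cgamma z
     / (Cgamma (1 + z + RtoC nu) * Cgamma (z - RtoC nu)))%C in
  Rabs (lameD h nu k - 2 * Re (B * Cexp (2 * z * RtoC (ellK k)))%C)
  <= 8 * (a ^ 2 * b / om ^ 2) * Rabs (nu * (nu + 1)) * (ellE k + 1 - 2 * tanh (ellK k)).
Proof.
intros Hk Hom Ho Ha Hb Eq Er z B.
destruct (sech_fundamental_exists om (nu * (nu + 1))) as [u1 [v1 [u2 [v2 F]]]].
pose proof (ellK_pos k Hk) as HK.
pose proof (lameD_sech_comparison h nu k om a b u1 v1 u2 v2 Hk Hom Ho ltac:(lra) Hb F Eq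
  (Er (ellK k))) as H1.
destruct (sech_asymptotics om (nu * (nu + 1)) a b (ellK k) u1 v1 u2 v2 Hom ltac:(lra)
  ltac:(lra) Hb Er F) as [al [be [HA H2]]].
fold z in HA, H2.
assert (HB : B = (al * be / z)%C).
{ apply gamma_amp; auto; unfold z, Re, Im; cbn; lra. }
rewrite HB. set (ap := 2 * Re (al * be / z * Cexp (2 * z * RtoC (ellK k)))%C) in *.
set (md := 4 * (u1 (ellK k) * v2 (ellK k)) - 2) in *.
replace (lameD h nu k - ap) with ((lameD h nu k - md) + (md - ap)) by ring.
eapply Rle_trans; [apply Rabs_triang|].
pose proof (tanh_lt_1 (ellK k)) as Ht. pose proof (Rabs_pos (nu * (nu + 1))) as Hl.
set (l := Rabs (nu * (nu + 1))) in *.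
assert (Hinv : 0 <= / om ^ 2) by (left; apply Rinv_0_lt_compat, pow_lt, Hom).
assert (H3 : a * b / om ^ 2 <= a ^ 2 * b / om ^ 2).
{ apply Rmult_le_compat_r; auto. apply Rmult_le_compat_r; auto. clear - Ha. nra. }
assert (H4 : 0 <= a * b / om ^ 2).
{ apply Rmult_le_pos; auto. apply Rmult_le_pos; lra. }
assert (H5 : 0 <= l * (1 - tanh (ellK k))) by (apply Rmult_le_pos; lra).
assert (H6 : 4 * (a * b / om ^ 2) * (l * (1 - tanh (ellK k)))
   <= 8 * (a ^ 2 * b / om ^ 2) * (l * (1 - tanh (ellK k)))).
{ apply Rmult_le_compat_r; lra. }
lra.
Qed.

Theorem theorem5p1 (h nu : R) (hnu : - (1 / 2) <= nu) (hh : nu * (nu + 1) < h) :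
  let omega : R := sqrt (h - nu * (nu + 1)) in
  let iomega : C := (Ci * RtoC omega)%C in
  let B : C :=
    (Cgamma (1 + iomega) * Cgamma iomega
     / (Cgamma (1 + iomega + RtoC nu) * Cgamma (iomega - RtoC nu)))%C in
  (0 <= nu ->
   forall k : R, 0 < k < 1 ->
     Rabs (lameD h nu k - 2 * Re (B * Cexp (2 * iomega * RtoC (ellK k)))%C)
     <= 8 * sqrt h * / omega ^ 2 * (nu * (nu + 1))
        * (ellE k + 1 - 2 * tanh (ellK k)))
  /\
  (- (1 / 2) <= nu < 0 -> 0 < h ->
   forall k : R, 0 < k < 1 ->
     Rabs (lameD h nu k - 2 * Re (B * Cexp (2 * iomega * RtoC (ellK k)))%C)
     <= 8 * omega * / h * (Rabs nu * (nu + 1))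
        * (ellE k + 1 - 2 * tanh (ellK k))).
Proof.
intros omega iomega B.
assert (Hom : 0 < omega) by (apply sqrt_lt_R0; lra).
assert (Ho : omega ^ 2 = h - nu * (nu + 1)) by (apply pow2_sqrt; lra).
assert (Hs : omega ^ 2 + nu * (nu + 1) = h) by lra.
split.
- intros Hnu k Hk.
  assert (Hl : 0 <= nu * (nu + 1)) by nra.
  pose proof (lameD_estimate h nu k omega 1 (sqrt h) Hk Hom Ho ltac:(lra) (sqrt_pos h)) as H.
  eapply Rle_trans; [apply H|].
  + apply lame_potential_energy; auto.
  + intros T. pose proof (proj1 (sech_potential_energy omega (nu * (nu + 1)) T Hom) Hl) as E.
    rewrite Hs in E. exact E.
  + rewrite (Rabs_pos_eq (nu * (nu + 1))) by auto. right. field. lra.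
- intros Hnu Hh k Hk.
  assert (Hl : nu * (nu + 1) <= 0) by nra.
  pose proof (sqrt_lt_R0 h Hh) as Hsh. pose proof (pow2_sqrt h ltac:(lra)) as Hsq.
  (* Here [omega^2 = h - nu (nu + 1) >= h] because [nu (nu + 1) <= 0]. *)
  assert (Ha : 1 <= omega / sqrt h).
  { apply Rmult_le_reg_r with (sqrt h); auto. field_simplify; [|lra].
    apply Rsqr_incr_0_var; [|lra]. unfold Rsqr. lra. }
  pose proof (lameD_estimate h nu k omega (omega / sqrt h) omega Hk Hom Ho Ha ltac:(lra)) as H.
  eapply Rle_trans; [apply H|].
  + apply lame_potential_energy; auto.
  + intros T. assert (Hp : 0 < omega ^ 2 + nu * (nu + 1)) by lra.
    pose proof (proj2 (sech_potential_energy omega (nu * (nu + 1)) T Hom) Hl Hp) as E.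
    rewrite Hs in E. exact E.
  + rewrite Rabs_mult, (Rabs_pos_eq (nu + 1)) by lra.
    (* The constant [a^2 b / omega^2] of part (b). *)
    replace ((omega / sqrt h) ^ 2 * omega / omega ^ 2) with (omega * / h); [right; ring|].
    rewrite <- Hsq at 1. field. lra.
Qed.
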